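(* The exceptional finite irreducible complex reflection groups of dimension greater than $2$ are the Shephard–Todd groups $G_{23},\ldots,G_{37}$. Among them, only the reflection arrangements of $G_{24}$, $G_{27}$, $G_{29}$, $G_{33}$ and $G_{34}$ are not combinatorially simplicial; that is, for $23\le i\le 37$ the reflection arrangement of $G_i$ is combinatorially simplicial if and only if $i\notin\{24,27,29,33,34\}$.
   Context: $G_i$ refers to the Shephard–Todd numbering of the irreducible finite complex reflection groups. The reflection arrangement of a finite complex reflection group $W\le\mathrm{GL}(V)$, acting irreducibly on the complex vector space $V$, is the set of its reflecting hyperplanes (fixed hyperplanes of its reflections) in $V$. An arrangement of hyperplanes is a finite set of hyperplanes in $V=K^r$; it is central if all hyperplanes are linear subspaces, and a central arrangement is essential if the intersection of all its hyperplanes is $0$. The intersection lattice $L(\mathcal{A})$ is the set of all intersections of elements of $\mathcal{A}$ (including $V$ as the empty intersection), ordered by reverse inclusion. The characteristic polynomial is $\chi_{\mathcal{A}}(t)=\sum_{X\in L(\mathcal{A})}\mu(X)t^{\dim X}$, where $\mu(X)=\mu(V,X)$ is the Möbius function of $L(\mathcal{A})$. For $X\in L(\mathcal{A})$ the restriction is $\mathcal{A}^X=\{X\cap H\mid H\in\mathcal{A},\ X\not\subseteq H,\ X\cap H\neq\emptyset\}$, an arrangement in $X$. A finite set $\mathcal{A}$ of hyperplanes in $K^r$ is (combinatorially) simplicial if it is a central, essential arrangement satisfying $r\chi_{\mathcal{A}}(-1)+2\sum_{H\in\mathcal{A}}\chi_{\mathcal{A}^H}(-1)=0$. *)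

(* Defs.v *)
From HB Require Import structures.
From mathcomp Require Import all_boot all_order all_algebra.
From mathcomp Require Import finmap.
From mathcomp Require Import all_classical.

Set Implicit Arguments.
Unset Strict Implicit.
Unset Printing Implicit Defensive.

Import Order.TTheory GRing.Theory Num.Theory.
Local Open Scope fset_scope.
Local Open Scope ring_scope.

Section Moebius.
Context {T : choiceType} (le : rel T) (L : {fset T}).

(* mu(x, x) = 1 and mu(x, y) = - \sum_(x <= z < y) mu(x, z), with fuel n.
   Fuel #|` L| is always enough: see mobius_sum. *)
Fixpoint mobius_rec (n : nat) (x y : T) : int :=
  if x == y then 1
  else if n is n'.+1 then
    - \sum_(z <- L | [&& le x z, le z y & z != y]) mobius_rec n' x z
  else 0.

Definition mobius (x y : T) : int := mobius_rec #|` L| x y.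

Lemma mobius_xx x : mobius x x = 1.
Proof. by rewrite /mobius; case: #|` L| => [|n] /=; rewrite eqxx. Qed.

Hypotheses (le_refl : reflexive le) (le_trans : transitive le)
           (le_anti : antisymmetric le).

Let below y := [seq z <- enum_fset L | le z y & z != y].

Let below_lt y z : z \in L -> le z y -> z != y ->
  (size (below z) < size (below y))%N.
Proof.
move=> zL zy nzy; rewrite -[(size (below z)).+1]/(size (z :: below z)).
apply: uniq_leq_size => [|u].
  by rewrite /= mem_filter eqxx andbF /= filter_uniq // fset_uniq.
rewrite inE !mem_filter => /orP[/eqP->|/andP[/andP[uz nuz] uL]].
  by rewrite zy nzy.
rewrite (le_trans uz zy) uL andbT /=; apply: contraNneq nuz => uy.
by apply/eqP/le_anti; rewrite uz uy zy.
Qed.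

Let mobius_rec_fuel n m x y : (size (below y) <= n)%N ->
  (size (below y) <= m)%N -> mobius_rec n x y = mobius_rec m x y.
Proof.
have base k u : size (below u) = 0%N -> mobius_rec k x u = (x == u)%:R.
  case: k => [|k] /= u0; first by case: eqP.
  case: eqP => // _; rewrite big1_seq ?oppr0 // => z /andP[/and3P[_ zu nzu] zL].
  by have := below_lt zL zu nzu; rewrite u0.
elim: n m y => [|n IHn] [|m] y hn hm.
- by [].
- by rewrite !base //; apply/eqP; rewrite -leqn0.
- by rewrite !base //; apply/eqP; rewrite -leqn0.
rewrite /=; case: eqP => // _; congr (- _).
rewrite big_seq_cond [RHS]big_seq_cond.
apply: eq_bigr => z /andP[zL /and3P[_ zy nzy]].
have lt := below_lt zL zy nzy.
by apply: IHn; rewrite -ltnS (leq_trans lt).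
Qed.

Lemma mobius_sum x y : x \in L -> y \in L -> le x y -> x != y ->
  \sum_(z <- L | le x z && le z y) mobius x z = 0.
Proof.
move=> xL yL xy nxy.
rewrite big_mkcond (bigD1_seq y) ?fset_uniq //= xy le_refl /= -big_mkcondr /=.
have yLt : (size (below y) < #|` L|)%N.
  rewrite -[(size (below y)).+1]/(size (y :: below y)).
  apply: uniq_leq_size => [|u]; last first.
    by rewrite inE mem_filter => /orP[/eqP->|/andP[]].
  by rewrite /= mem_filter eqxx andbF /= filter_uniq // fset_uniq.
rewrite {1}/mobius; case E : #|` L| yLt => [|n] // yLt /=.
rewrite (negPf nxy) addrC; apply/eqP; rewrite subr_eq0; apply/eqP.
rewrite big_seq_cond [RHS]big_seq_cond; apply: eq_big => [z|z].
  by case: (z \in L) (le x z) (le z y) (z != y) => [] [] [] [].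
move=> /andP[zL /andP[nzy /andP[_ zy]]]; rewrite /mobius E.
have lt := leq_trans (below_lt zL zy nzy) yLt.
by apply: mobius_rec_fuel; rewrite ?leqW // ltnW.
Qed.

End Moebius.

Section Arrangements.
Context {K : fieldType} {V : vectType K}.
Implicit Types (E X H : {vspace V}) (A B : {fset {vspace V}}).

(* H is a linear hyperplane of the subspace E. *)
Definition is_hyperplane E H : Prop := (H <= E)%VS /\ (\dim H).+1 = \dim E.

(* Intersection lattice of an arrangement A of hyperplanes of E; the
   empty intersection is E itself. *)
Definition intersection_lattice E A : {fset {vspace V}} :=
  [fset (E :&: \bigcap_(H <- (B : {fset {vspace V}})) H)%VS
      | B in fpowerset A].

Definition reverse_inclusion : rel {vspace V} := fun X Y => (Y <= X)%VS.

Definition characteristic_polynomial E A : {poly int} :=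
  let L := intersection_lattice E A in
  \sum_(X <- L) mobius reverse_inclusion L E X *: 'X^(\dim X).

(* A^X, an arrangement of hyperplanes of X; linear subspaces always meet. *)
Definition restriction A X : {fset {vspace V}} :=
  [fset (X :&: H)%VS | H in A & ~~ (X <= H)%VS].

(* All hyperplanes are linear subspaces, so centrality is built in. *)
Definition simplicial (A : set {vspace V}) : Prop :=
  [/\ finite_set A,
      forall H, A H -> is_hyperplane fullv H,
      (\bigcap_(H <- fset_set A) H)%VS = 0%VS &
      (\dim {:V})%:R * (characteristic_polynomial fullv (fset_set A)).[-1]
        + 2 * \sum_(H <- fset_set A)
          (characteristic_polynomial H (restriction (fset_set A) H)).[-1] = 0].

End Arrangements.

(* Matrices act on row vectors from the right: v |-> v *m g. *)
Section ReflectionGroups.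
Context {C : numClosedFieldType}.

Inductive generated_group n (S : set 'M[C]_n) : set 'M[C]_n :=
| generated_one : generated_group S 1%:M
| generated_gen g of S g : generated_group S g
| generated_mul g h of generated_group S g & generated_group S h :
    generated_group S (g *m h)
| generated_inv g of generated_group S g : generated_group S (invmx g).

Definition fixed_space n (g : 'M[C]_n) : {vspace 'rV[C]_n} :=
  fixedSpace (linfun (mulmxr g)).

Definition is_reflection n (g : 'M[C]_n) : Prop :=
  (exists2 k, (0 < k)%N & g ^+ k = 1%:M) /\
  is_hyperplane fullv (fixed_space g).

Definition reflection_arrangement n (W : set 'M[C]_n) :
    set {vspace 'rV[C]_n} :=
  [set fixed_space g | g in [set g | W g /\ is_reflection g]]%classic.

(* The reflection v |-> v - (1 - z) (v, a) / (a, a) a of root a and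
   eigenvalue z, for the Hermitian form (u, v) = u B v^*. *)
Definition root_reflection n (B : 'M[C]_n) (z : C) (a : 'rV[C]_n) : 'M[C]_n :=
  let Ba := B *m map_mx Num.conj a^T in
  1%:M - ((1 - z) / (a *m Ba) 0 0) *: (Ba *m a).

End ReflectionGroups.

(* The Shephard-Todd groups G_23, ..., G_37, each generated by reflections
   with given roots in C^n, n = st_rank i.

   G_23 = H_3, G_28 = F_4, G_30 = H_4, G_35 = E_6, G_36 = E_7, G_37 = E_8 are
   the finite Coxeter groups of these types, in the geometric representation.
   The roots of the others generate the line systems (in the notation of
   Lehrer and Taylor) J_3(4), L_3, M_3, J_3(5), N_4, O_4, L_4, K_5 and K_6 for
   G_24, G_25, G_26, G_27, G_29, G_31, G_32, G_33 and G_34. *)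
Section ShephardTodd.
Variable C : numClosedFieldType.

Definition omega : C := (-1 + 'i * sqrtC 3) / 2.
Definition lambda7 : C := (-1 + 'i * sqrtC 7) / 2.
Definition golden : C := (1 + sqrtC 5) / 2.

Definition st_rank (i : nat) : nat :=
  match i with
  | 23 | 24 | 25 | 26 | 27 => 3
  | 28 | 29 | 30 | 31 | 32 => 4
  | 33 => 5
  | 34 | 35 => 6
  | 36 => 7
  | 37 => 8
  | _ => 0
  end%N.

(* 2 cos (pi / m) *)
Definition two_cos_pi_div (m : nat) : C :=
  match m with
  | 3%N => 1
  | 4%N => sqrtC 2
  | 5%N => golden
  | _ => 0
  end.

(* Twice the canonical bilinear form (e_i, e_j) = - cos (pi / m_ij) of a
   Coxeter diagram, given by its edges ((i, j), m_ij) with m_ij >= 3. *)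
Definition coxeter_form (D : seq (nat * nat * nat)) (i j : nat) : C :=
  if i == j then 2
  else - \sum_(e <- D | (e.1 == (i, j)) || (e.1 == (j, i)))
         two_cos_pi_div e.2.

Definition coxeter_group n D : (nat -> nat -> C) * seq (C * seq C) :=
  (coxeter_form D, [seq (-1, mkseq (fun j => (j == k)%:R) n) | k <- iota 0 n]).

(* Standard Hermitian form, roots with the eigenvalue of their reflection. *)
Definition unitary_group (roots : seq (C * seq C)) :
    (nat -> nat -> C) * seq (C * seq C) :=
  (fun i j => (i == j)%:R, roots).

Definition st_data (i : nat) : (nat -> nat -> C) * seq (C * seq C) :=
  let w := omega in let l := lambda7 in let t := golden in
  match i with
  | 23%N => coxeter_group 3 [:: (0, 1, 3); (1, 2, 5)]%N
  | 24%N => unitary_group [:: (-1, [:: 2; 0; 0]); (-1, [:: l; l; 0]);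
                            (-1, [:: l^*; 1; 1])]
  | 25%N => unitary_group [:: (w, [:: 1; 0; 0]); (w, [:: 1; 1; 1]);
                            (w, [:: 0; 1; 0])]
  | 26%N => unitary_group [:: (-1, [:: 1; -1; 0]); (w, [:: 1; 0; 0]);
                            (w, [:: 1; 1; 1])]
  | 27%N => unitary_group [:: (-1, [:: 2; 0; 0]); (-1, [:: t; t^-1; 1]);
                            (-1, [:: 1; t^-1 * w; t * w ^+ 2])]
  | 28%N => coxeter_group 4 [:: (0, 1, 3); (1, 2, 4); (2, 3, 3)]%N
  | 29%N => unitary_group [:: (-1, [:: 1; -1; 0; 0]); (-1, [:: 0; 1; -1; 0]);
                            (-1, [:: 0; 1; - 'i; 0]); (-1, [:: 1; 1; 1; 1])]
  | 30%N => coxeter_group 4 [:: (0, 1, 3); (1, 2, 3); (2, 3, 5)]%N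
  | 31%N => unitary_group [:: (-1, [:: 1; -1; 0; 0]); (-1, [:: 0; 1; -1; 0]);
                            (-1, [:: 0; 1; - 'i; 0]); (-1, [:: 1; 1; 1; 1]);
                            (-1, [:: 1; 0; 0; 0])]
  | 32%N => unitary_group [:: (w, [:: 1; 0; 0; 0]); (w, [:: 1; 1; 1; 0]);
                            (w, [:: 0; 1; 0; 0]); (w, [:: 0; 1; -1; 1])]
  | 33%N => (* the hyperplane x_5 = x_6 of C^6, with coordinates x_1, ..., x_5;
             the roots are those of G_34 below other than e_4 - e_5 *)
          (fun i j => if i == j then if i == 4%N then 2 else 1 else 0,
           [:: (-1, [:: 1; 1; 1; 1; 1]); (-1, [:: 1; - w; 0; 0; 0]);
               (-1, [:: 1; -1; 0; 0; 0]); (-1, [:: 0; 1; -1; 0; 0]);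
               (-1, [:: 0; 0; 1; -1; 0])])
  | 34%N => unitary_group [:: (-1, [:: 1; 1; 1; 1; 1; 1]);
                            (-1, [:: 1; - w; 0; 0; 0; 0]);
                            (-1, [:: 1; -1; 0; 0; 0; 0]);
                            (-1, [:: 0; 1; -1; 0; 0; 0]);
                            (-1, [:: 0; 0; 1; -1; 0; 0]);
                            (-1, [:: 0; 0; 0; 1; -1; 0])]
  | 35%N => coxeter_group 6 [:: (0, 2, 3); (2, 3, 3); (3, 4, 3); (4, 5, 3);
                              (1, 3, 3)]%N
  | 36%N => coxeter_group 7 [:: (0, 2, 3); (2, 3, 3); (3, 4, 3); (4, 5, 3);
                              (5, 6, 3); (1, 3, 3)]%N
  | 37%N => coxeter_group 8 [:: (0, 2, 3); (2, 3, 3); (3, 4, 3); (4, 5, 3);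
                              (5, 6, 3); (6, 7, 3); (1, 3, 3)]%N
  | _ => unitary_group [::]
  end.

Definition st_form i : 'M[C]_(st_rank i) := \matrix_(j, k) (st_data i).1 j k.

Definition st_reflections i : set 'M[C]_(st_rank i) :=
  [set g | exists2 za, za \in (st_data i).2 &
     g = root_reflection (st_form i) za.1 (\row_j za.2`_j)]%classic.

Definition st_model i : set 'M[C]_(st_rank i) :=
  generated_group (@st_reflections i).

(* Shephard-Todd groups are linear groups up to conjugacy in GL_n(C). *)
Definition is_shephard_todd i (W : set 'M[C]_(st_rank i)) : Prop :=
  exists2 P, P \in unitmx &
    W = [set invmx P *m g *m P | g in @st_model i]%classic.

End ShephardTodd.

(* Main.v *)
From Stdlib Require Import BinIntDef.
From Stdlib Require QArith_base Qreduction.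
From mathcomp Require Import all_classical.
From mathcomp Require Import all_boot all_order all_algebra all_fingroup finmap.
From mathcomp Require Import ssrZ ring.
Require Import Defs.
Import QArith_base(Q, Qmake, Qnum, Qden, Qeq, Qeq_bool, Qeq_bool_iff).
Import QArith_base(Qplus, Qmult, Qinv, Qdiv, inject_Z).
Import Qreduction(Qred, Qred_correct).

Set Implicit Arguments.
Unset Strict Implicit.
Unset Printing Implicit Defensive.

Import Order.TTheory GRing.Theory Num.Theory.
Local Open Scope ring_scope.

(** For a real reflection arrangement the simplicial identity counts pairs of a
    chamber and one of its walls, but for the complex groups there is nothing to
    count and both sides are numbers that have to be determined: even a direct
    computation for E_8 would meet 120 hyperplanes and 696729600 chambers.  The
    proof reduces the identity to a recursion whose data depend only on the orbits of
    flats, of which there are at most 41, and then evaluates this recursion.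

    The recursion.  By Whitney, chi(t) is the alternating sum of t^dim over the
    intersections of all subsets of the arrangement (mobius_whitney).  Let a(X) be
    the number of hyperplanes that contain X, and let G satisfy
    G(X) = phi(X) - \sum_(H not containing X) G(X :&: H) / a(X :&: H).  Substituting phi
    in the alternating sum of phi, and cancelling the subset S against the subset
    H |: S, leaves G of the whole space (whitney_sum_recursive); this is the
    theorem of Weisner, averaged over the hyperplanes.  At t = -1 the signs
    disappear: flag_sum, a sum of positive terms, is up to sign the value at -1 of
    the characteristic polynomial of A, and of A^X if the hyperplanes that contain X
    are not counted in a.  Thus simplicial means that the hyperplanes meet in 0 and
    n * flag_sum(V) = 2 * \sum_H flag_sum(H) (simplicial_flag_sum).

    The orbits.  flag_sum is invariant under linear maps that permute the
    hyperplanes (flag_sum_symmetry).  A certificate lists a representative X of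
    every orbit of flats, given by hyperplanes that cut it out.  Restricting all
    linear forms to X by elimination shows which hyperplanes contain X and how the
    others group into the flats X :&: H; for each orbit of these under some
    symmetries of X, a word in the reflections carries one of them to an earlier
    representative.  This gives the values of flag_sum from the bottom of the
    lattice upwards (run_types_ok, verdict_ok).

    The arrangement.  The lines of the roots are generated as the orbit of the
    given roots, and it remains to see that they carry all reflections of W.  The
    product J of the corresponding linear forms is multiplied by a character of W.
    On a reflection s whose hyperplane is one of the family, the other factors of J
    are permuted and do not vanish at a generic fixed point of s, which shows that
    the character is det s; hence it is det on W.  On a reflection with a
    different hyperplane J itself does not vanish at a generic fixed point and the
    character is 1, but the determinant of a reflection is not 1
    (prod_moved_factors, reflection_in_family).

    Numbers live in the integers or in an iterated quadratic extension of them,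
    where zero is recognized by coordinates and non-zero by the norm, and are
    mapped to complex numbers only in the statements. *)

(** * Whitney sums of an arrangement *)
Section Whitney.
Context {I : finType} {R : comPzRingType}.
Implicit Types (S D : {set I}).

(** Pairing S with i |: S is the only cancellation behind the results on
    characteristic polynomials below. *)
Lemma big_subset_toggle D i (f : {set I} -> R) : i \in D ->
  \sum_(S : {set I} | S \subset D) f S =
  \sum_(S : {set I} | (S \subset D) && (i \notin S)) (f S + f (i |: S)).
Proof.
move=> iD; rewrite (bigID (fun S : {set I} => i \notin S)) big_split /=.
congr (_ + _).
rewrite (reindex_onto (fun S => i |: S) (fun S => S :\ i)) /=; last first.
  by move=> S /andP[_]; rewrite negbK => iS; rewrite setD1K.
apply: eq_bigl => S.
rewrite subUset sub1set iD setU11 /= andbT; congr (_ && _).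
apply/eqP/idP => [<-|iS]; last exact: setU1K.
by rewrite !inE eqxx.
Qed.

Lemma sum_sign_subsets D : D != set0 ->
  \sum_(S : {set I} | S \subset D) (-1) ^+ #|S| = 0 :> R.
Proof.
case/set0Pn=> i iD; rewrite (big_subset_toggle _ iD) big1 // => S /andP[_ iS].
by rewrite cardsU1 iS exprS mulN1r subrr.
Qed.

End Whitney.

Section WhitneyArrangement.
Context {K : fieldType} {V : vectType K} {I : finType}.
Variable H : I -> {vspace V}.
Implicit Types (S D : {set I}) (E X Y : {vspace V}).

Definition meet E S : {vspace V} := (E :&: \bigcap_(i in S) H i)%VS.

Lemma meet0 E : meet E set0 = E.
Proof. by rewrite /meet big_set0 capvf. Qed.

Lemma meetU1 E i S : meet E (i |: S) = (meet E S :&: H i)%VS.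
Proof.
have [iS|iS] := boolP (i \in S); last first.
  by rewrite /meet big_setU1 //= (capvC (H i)) capvA.
rewrite (setUidPr _) ?sub1set //; apply/esym/capv_idPl.
rewrite /meet (bigD1 i) //=.
by apply: (subv_trans (capvSr _ _)); exact: capvSl.
Qed.

Lemma sub_meet E S X : (X <= meet E S)%VS =
  (X <= E)%VS && (S \subset [set i | (X <= H i)%VS]).
Proof.
rewrite /meet subv_cap; congr (_ && _).
apply/subv_bigcapP/subsetP => h i /h; first by rewrite inE.
by rewrite inE.
Qed.

Section Sums.
Variables (E : {vspace V}) (D : {set I}).
Hypothesis properD : forall i, i \in D -> ~~ (E <= H i)%VS.

Let meet_eq_top S : S \subset D -> (meet E S == E) = (S == set0).
Proof.
move=> SD; apply/eqP/eqP => [h|->]; last exact: meet0.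
have := subvv E; rewrite -{2}h sub_meet => /andP[_ /subsetP hS].
apply/eqP; case: (set_0Vmem S) => [->//|[i iS]].
by have := hS i iS; rewrite inE (negPf (properD (subsetP SD i iS))).
Qed.

(** The formula of Whitney for the Moebius number of X.  Subfamilies are indexed by
    sets of indices, so that a family with repetitions, such as a restriction, needs
    no separate treatment. *)
Definition whitney_number X : int :=
  \sum_(S : {set I} | (S \subset D) && (meet E S == X)) (-1) ^+ #|S|.

Section Moebius.
Variable L : {fset {vspace V}}.
Hypothesis memL : forall Y, reflect (exists2 S : {set I}, S \subset D & Y = meet E S) (Y \in L).

Let inL S : S \subset D -> meet E S \in L.
Proof. by move=> SD; apply/memL; exists S. Qed.

Let sum_over_L (M : nmodType) (F : {vspace V} -> {set I} -> M) (P : pred {vspace V}) :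
  \sum_(Z <- L | P Z) \sum_(S : {set I} | (S \subset D) && (meet E S == Z)) F Z S
  = \sum_(S : {set I} | (S \subset D) && P (meet E S)) F (meet E S) S.
Proof.
under eq_bigr do rewrite big_mkcond /=.
rewrite exchange_big /= [RHS]big_mkcond /=; apply: eq_bigr => S _.
have [SD|SD] := boolP (S \subset D); last by rewrite big1.
rewrite -big_mkcondr /=.
have [PS|PS] := boolP (P _).
  rewrite big_mkcond (bigD1_seq (meet E S)) ?inL ?fset_uniq //= PS eqxx /=.
  by rewrite big1 ?addr0 // => Z; rewrite eq_sym => /negPf->; rewrite andbF.
rewrite big1 // => Z /andP[PZ /eqP SZ]; by rewrite SZ PZ in PS.
Qed.

(** The subfamilies whose meet contains X are the subsets of one set, which is not
    empty since X is not E. *)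
Lemma whitney_number_sum X : X \in L -> X != E ->
  \sum_(Z <- L | (X <= Z)%VS) whitney_number Z = 0.
Proof.
move=> /memL[S SD ->{X}] XE; rewrite sum_over_L.
set X := meet E S in XE *.
have XsubE : (X <= E)%VS by rewrite /X capvSl.
rewrite (eq_bigl (fun T : {set I} => T \subset D :&: [set i | (X <= H i)%VS])); last first.
  by move=> T; rewrite sub_meet XsubE subsetI.
apply: sum_sign_subsets; apply: contraNneq XE => D0.
rewrite /X meet_eq_top // -subset0 -D0 subsetI SD /=.
by have := subvv X; rewrite {2}/X sub_meet => /andP[].
Qed.

Lemma mobius_whitney X : X \in L ->
  mobius (@reverse_inclusion K V) L E X = whitney_number X.
Proof.
have EL : E \in L by rewrite -(meet0 E) inL ?sub0set.
have top : whitney_number E = 1.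
  rewrite /whitney_number (big_pred1 set0) ?cards0 // => S.
  apply/andP/eqP => [[SD]|->]; last by rewrite sub0set meet0.
  by rewrite meet_eq_top // => /eqP.
have subE Z : Z \in L -> (Z <= E)%VS by case/memL=> S _ ->; exact: capvSl.
have [m] := ubnP (\dim E - \dim X); elim: m X => // m IH X hm XL.
have [->|XE] := eqVneq X E; first by rewrite mobius_xx top.
have refl : reflexive (@reverse_inclusion K V) by move=> Y; exact: subvv.
have trans : transitive (@reverse_inclusion K V).
  by move=> Y Z T h1 h2; exact: subv_trans h2 h1.
have anti : antisymmetric (@reverse_inclusion K V).
  by move=> Y Z /andP[h1 h2]; apply/eqP; rewrite eqEsubv; apply/andP; split.
have hL (F : {vspace V} -> int) :
    \sum_(Z <- L | (X <= Z)%VS) F Z =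
    F X + \sum_(Z <- L | (X <= Z)%VS && (Z != X)) F Z.
  rewrite big_mkcond (bigD1_seq X) ?fset_uniq //= subvv; congr (_ + _).
  by rewrite big_mkcond [RHS]big_mkcond; apply: eq_bigr => Z _; case: (_ == _); rewrite ?andbF ?andbT.
have nuX := whitney_number_sum XL XE.
have muX : \sum_(Z <- L | (X <= Z)%VS) mobius (@reverse_inclusion K V) L E Z = 0.
  rewrite eq_sym in XE.
  rewrite -[RHS](mobius_sum refl trans anti EL XL (subE X XL) XE).
  rewrite big_seq_cond [RHS]big_seq_cond; apply: eq_bigl => Z.
  by rewrite /reverse_inclusion; have [/subE->|] := boolP (Z \in L).
move/eqP: muX; rewrite hL addr_eq0 => /eqP->.
move/eqP: nuX; rewrite hL addr_eq0 => /eqP->; congr (- _).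
rewrite big_seq_cond [RHS]big_seq_cond; apply: eq_bigr => Z /andP[ZL /andP[XZ nXZ]].
have dXZ : (\dim X < \dim Z)%N.
  rewrite ltn_neqAle (dimvS XZ) andbT; apply: contraNneq nXZ => dXZ.
  by rewrite eq_sym eqEdim XZ dXZ /=.
apply: IH => //; apply: leq_trans (hm : (_ <= m)%N); apply: ltn_sub2l => //.
exact: leq_trans dXZ (dimvS (subE Z ZL)).
Qed.


Lemma mobius_sum_whitney (M : lmodType int) (F : {vspace V} -> M) :
  \sum_(X <- L) mobius (@reverse_inclusion K V) L E X *: F X =
    \sum_(S : {set I} | S \subset D) (-1) ^+ #|S| *: F (meet E S).
Proof.
rewrite big_seq_cond (eq_bigr (fun X => \sum_(S : {set I} | (S \subset D) &&
    (meet E S == X)) (-1) ^+ #|S| *: F X)); last first.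
  by move=> X /andP[XL _]; rewrite mobius_whitney // scaler_suml.
rewrite -big_seq_cond (sum_over_L (fun X (S : {set I}) => (-1) ^+ #|S| *: F X)).
by apply: eq_bigl => S; rewrite andbT.
Qed.

End Moebius.

Lemma characteristic_polynomial_whitney (A : {fset {vspace V}}) :
    (forall Y, reflect (exists2 S : {set I}, S \subset D & Y = meet E S)
                       (Y \in intersection_lattice E A)) ->
  characteristic_polynomial E A =
    \sum_(S : {set I} | S \subset D) (-1) ^+ #|S| *: 'X^(\dim (meet E S)).
Proof.
by move=> memL; exact: mobius_sum_whitney. Qed.


(** The arrangement A may list f i in place of H i; a restriction to E does so, with
    f i the trace of H i on E. *)
Lemma mem_intersection_lattice (A : {fset {vspace V}}) (f : I -> {vspace V}) :
    (forall Y, reflect (exists2 i, i \in D & Y = f i) (Y \in A)) ->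
    (forall i, i \in D -> (E :&: f i = E :&: H i)%VS) ->
  forall Y, reflect (exists2 S : {set I}, S \subset D & Y = meet E S)
                    (Y \in intersection_lattice E A).
Proof.
move=> memA fE Y.
have subf X i : i \in D -> (X <= E)%VS -> (X <= f i)%VS = (X <= H i)%VS.
  by move=> iD XE; have := congr1 (fun Z => X <= Z)%VS (fE i iD); rewrite !subv_cap XE.
have eqI (U W : {vspace V}) : (forall X, (X <= U)%VS = (X <= W)%VS) -> U = W.
  by move=> h; apply/eqP; rewrite eqEsubv h subvv -h subvv.
have subB X (B : {fset {vspace V}}) : (X <= E :&: \bigcap_(Z <- B) Z)%VS =
    (X <= E)%VS && [forall Z : B, (X <= val Z)%VS].
  rewrite subv_cap; congr (_ && _).
  rewrite big_seq_fsetE; apply/subv_bigcapP/forallP => h Z //; exact: h.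
apply: (iffP idP) => [/imfsetP[/= B]|[S SD ->]].
  rewrite fpowersetE => /fsubsetP BA ->{Y}.
  exists [set i in D | f i \in B]; first by apply/subsetP=> i; rewrite inE => /andP[].
  apply: eqI => X; rewrite subB sub_meet; have [XE|//] := boolP (X <= E)%VS.
  apply/forallP/subsetP => h => [i|[Z /= ZB]].
    by rewrite !inE => /andP[iD fB]; rewrite -subf //; exact: (h [` fB]%fset).
  have /memA[i iD eZ] := BA Z ZB; rewrite eZ subf //.
  by have := h i; rewrite !inE iD -eZ ZB => ->.
apply/imfsetP; exists [fset f i | i in S]%fset.
  rewrite /= fpowersetE; apply/fsubsetP => _ /imfsetP[i /= iS ->].
  by apply/memA; exists i => //; exact: (subsetP SD).
apply: eqI => X; rewrite subB sub_meet; have [XE|//] := boolP (X <= E)%VS.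
apply/subsetP/forallP => h => [[_ /= /imfsetP[i /= iS ->]]|i iS].
  by rewrite subf ?(subsetP SD) //; have := h i iS; rewrite inE.
have fB : f i \in [fset f i | i in S]%fset by exact: in_imfset.
by rewrite inE -subf ?(subsetP SD) //; exact: (h [` fB]%fset).
Qed.

(** With g(X) = G(X) / a(X) and H fixed, the terms g(X_S :&: H) of the subfamilies S
    with X_S not inside H cancel those of the S that contain H, up to the terms
    g(X_S) of the S with X_S inside H (cancel_i).  Summing over H weights g(X_S) by
    a(X_S), which restores G(X_S) and leaves only the empty subfamily. *)
Lemma whitney_sum_recursive (F : numFieldType) (phi G : {vspace V} -> F) :
    (forall S : {set I}, S \subset D -> let X := meet E S in
      G X = phi X - \sum_(i in D | ~~ (X <= H i)%VS)
         G (X :&: H i)%VS / #|[set j in D | (X :&: H i <= H j)%VS]|%:R) ->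
  \sum_(S : {set I} | S \subset D) (-1) ^+ #|S| * phi (meet E S) = G E.
Proof.
move=> recG.
pose a X := #|[set j in D | (X <= H j)%VS]|.
pose g X := G X / (a X)%:R.
have cancel_i i : i \in D ->
    \sum_(S : {set I} | (S \subset D) && ~~ (meet E S <= H i)%VS)
       (-1) ^+ #|S| * g (meet E S :&: H i)%VS =
  - \sum_(S : {set I} | (S \subset D) && (meet E S <= H i)%VS) (-1) ^+ #|S| * g (meet E S).
  move=> iD; apply/eqP; rewrite -addr_eq0; apply/eqP.
  rewrite [X in X + _]big_mkcondr [X in _ + X]big_mkcondr -big_split /=.
  rewrite (big_subset_toggle _ iD) big1 // => S /andP[SD iS].
  rewrite meetU1 capvSr /= cardsU1 iS add0r.
  case: ifPn => [/negPf->|/negPn h]; first by rewrite addr0 exprS mulN1r mulNr subrr.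
  by rewrite h (capv_idPl h) add0r exprS mulN1r mulNr subrr.
rewrite (eq_bigr (fun S : {set I} => (-1) ^+ #|S| * G (meet E S) +
   \sum_(i in D | ~~ (meet E S <= H i)%VS) (-1) ^+ #|S| * g (meet E S :&: H i)%VS));
   last first.
  by move=> S SD; rewrite -mulr_sumr -mulrDr recG // /g /a subrK.
rewrite big_split /=.
have -> : \sum_(S : {set I} | S \subset D) \sum_(i in D | ~~ (meet E S <= H i)%VS)
      (-1) ^+ #|S| * g (meet E S :&: H i)%VS =
    - \sum_(S : {set I} | S \subset D) (-1) ^+ #|S| * (g (meet E S) * (a (meet E S))%:R).
  rewrite (exchange_big_dep (fun i => i \in D)) /=; last by move=> S i _ /andP[].
  rewrite (eq_bigr (fun i => - \sum_(S : {set I} |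
      (S \subset D) && (meet E S <= H i)%VS) (-1) ^+ #|S| * g (meet E S))).
    rewrite sumrN; congr (- _).
    rewrite (exchange_big_dep (fun S : {set I} => S \subset D)) /=; last by move=> i S _ /andP[].
    apply: eq_bigr => S SD; rewrite sumr_const -mulrnAr mulr_natr; congr (_ * (_ *+ _)).
    by apply: eq_card => i; rewrite !inE SD.
  move=> i iD; rewrite -cancel_i //; apply: eq_bigl => S.
  by rewrite iD.
rewrite -sumrB (bigD1 set0) ?sub0set //= big1 ?addr0.
  rewrite cards0 expr0 !mul1r meet0 [a E](_ : _ = 0%N) ?mulr0 ?subr0 //.
  apply/eqP; rewrite cards_eq0; apply/eqP/setP => i; rewrite !inE.
  by case iD: (i \in D); rewrite // (negPf (properD iD)).
move=> S /andP[SD S0]; rewrite /g mulfVK ?subrr // pnatr_eq0 /a cards_eq0.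
have /set0Pn[i iS] := S0; apply/set0Pn; exists i; rewrite inE (subsetP SD) //=.
by have := subvv (meet E S); rewrite sub_meet => /andP[_ /subsetP/(_ i iS)]; rewrite inE.
Qed.
End Sums.
End WhitneyArrangement.

(** * The simplicial identity as a sum over flags of flats *)
Section FlagSum.
Context {K : fieldType} {V : vectType K} {I : finType}.
Variable H : I -> {vspace V}.
Implicit Types (S D : {set I}) (E X Y : {vspace V}).

Definition flat X : {set I} := [set j | (X <= H j)%VS].

(** Unfolded, flag_sum adds over the chains X > X1 > ... of flats, each step
    cutting by a hyperplane, the product of the 1 / (a(Xj) - a0).  The number k is
    the dimension of X, which drops by one at every step; a0 is the number of
    hyperplanes that contain the space to which the arrangement is restricted. *)
Fixpoint flag_sum (a0 k : nat) X : rat :=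
  if k is k'.+1 then
    1 + \sum_(j | ~~ (X <= H j)%VS)
          flag_sum a0 k' (X :&: H j)%VS / (#|flat (X :&: H j)%VS| - a0)%:R
  else 1.

Hypothesis hyperH : forall i, is_hyperplane fullv (H i).

Lemma dim_cap_hyperplane X j :
  ~~ (X <= H j)%VS -> (\dim (X :&: H j)).+1 = \dim X.
Proof.
have [_ dH] := hyperH j => nXH.
have dlt : (\dim (X :&: H j) < \dim X)%N.
  rewrite ltn_neqAle (dimvS (capvSl _ _)) andbT; apply: contraNneq nXH => dXH.
  by apply/capv_idPl/eqP; rewrite eqEdim capvSl dXH leqnn.
apply/eqP; rewrite eqn_leq dlt /= -(leq_add2r (\dim (H j))) addSnnS dH.
have := dimv_sum_cap X (H j); rewrite addnC => <-.
by rewrite leq_add2l dimvS // subvf.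
Qed.

Lemma characteristic_polynomial_at_N1 E (A : {fset {vspace V}}) :
    (forall Y, reflect (exists2 S : {set I}, S \subset ~: flat E & Y = meet H E S)
                       (Y \in intersection_lattice E A)) ->
  ((characteristic_polynomial E A).[-1])%:~R =
    (-1) ^+ \dim E * flag_sum #|flat E| (\dim E) E :> rat.
Proof.
move=> memL.
have properD i : i \in ~: flat E -> ~~ (E <= H i)%VS by rewrite !inE.
rewrite (characteristic_polynomial_whitney properD memL) horner_sum rmorph_sum /=.
pose G X : rat := (-1) ^+ \dim X * flag_sum #|flat E| (\dim X) X.
rewrite -/(G E) -(@whitney_sum_recursive _ _ _ H E _ properD rat
   (fun X => (-1) ^+ \dim X) G).
  apply: eq_bigr => S _.
  by rewrite hornerZ hornerXn rmorphM !rmorphXn /= rmorphN1.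
move=> S SD X.
have XE : (X <= E)%VS by exact: capvSl.
have flatE Y : (Y <= E)%VS ->
    #|[set j in ~: flat E | (Y <= H j)%VS]| = (#|flat Y| - #|flat E|)%N.
  move=> YE; have sub : flat E \subset flat Y.
    by apply/subsetP=> j; rewrite !inE; exact: subv_trans.
  rewrite -[in RHS](setIidPr sub) -cardsD; apply: eq_card => j; by rewrite !inE.
rewrite /G; case dX : (\dim X) => [|d] /=.
  rewrite big_pred0 ?subr0 ?mulr1 // => i.
  have /eqP-> : X == 0%VS by rewrite -dimv_eq0 dX.
  by rewrite sub0v andbF.
rewrite mulrDr mulr1 mulr_sumr; congr (_ + _); rewrite -sumrN.
apply: eq_big => [i|i nXH].
  by rewrite !inE; case h : (X <= H i)%VS; rewrite ?andbF // andbT; apply/esym;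
     apply: contraFN h; exact: subv_trans.
have dXH := dim_cap_hyperplane nXH; rewrite dX in dXH; case: dXH => ->.
rewrite flatE; last exact: subv_trans (capvSl _ _) XE.
by rewrite exprS mulN1r mulNr mulrA.
Qed.

Hypothesis injH : injective H.

Lemma flat_hyperplane i : flat (H i) = [set i].
Proof.
apply/setP => j; rewrite !inE; apply/idP/eqP => [HH|->]; last exact: subvv.
apply: injH; apply/esym/eqP; rewrite eqEdim HH /=.
by have [_ di] := hyperH i; have [_ dj] := hyperH j; rewrite -ltnS di dj.
Qed.

Theorem simplicial_flag_sum (A : set {vspace V}) : A = range H ->
  simplicial A <->
  (\bigcap_i H i)%VS = 0%VS /\
  (\dim {:V})%:R * flag_sum 0 (\dim {:V}) fullv =
    2 * \sum_i flag_sum 1 (\dim {:V}).-1 (H i).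
Proof.
move=> defA.
have finA : finite_set A by rewrite defA; exact: finite_image.
pose B := [fset H i | i in I]%fset.
have BE : fset_set A = B.
  apply/fsetP => Y; rewrite in_fset_set // defA.
  apply/idP/imfsetP => [/set_mem[i _ <-]|[i _ ->]]; first by exists i.
  by apply/mem_set; exists i.
have memB Y : reflect (exists i, Y = H i) (Y \in B).
  by apply: (iffP (imfsetP _ _ _ _)) => [[i _ ->]|[i ->]]; exists i.
have sumB (F : {vspace V} -> int) : \sum_(Y <- B) F Y = \sum_i F (H i).
  rewrite big_imfset /=; last by move=> i j _ _ /injH.
  by rewrite big_enum_cond.
have flatT : flat fullv = set0.
  apply/setP => i; rewrite !inE; apply/negP => /dimvS.
  by have [_ <-] := hyperH i; rewrite ltnn.
have chiT : ((characteristic_polynomial fullv B).[-1])%:~R =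
    (-1) ^+ \dim {:V} * flag_sum 0 (\dim {:V}) fullv :> rat.
  rewrite characteristic_polynomial_at_N1 ?flatT ?cards0 //.
  apply: (mem_intersection_lattice (f := H)) => // Y.
  apply: (iffP (memB Y)) => [[i ->]|[i _ ->]]; exists i => //.
  by rewrite !inE.
have chiH i : ((characteristic_polynomial (H i) (restriction B (H i))).[-1])%:~R =
    (-1) ^+ (\dim {:V}).-1 * flag_sum 1 (\dim {:V}).-1 (H i) :> rat.
  have dH : (\dim {:V}).-1 = \dim (H i) by have [_ <-] := hyperH i.
  rewrite dH characteristic_polynomial_at_N1 ?flat_hyperplane ?cards1 //.
  apply: (mem_intersection_lattice (f := fun j => H i :&: H j)%VS).
    move=> Y; apply: (iffP (imfsetP _ _ _ _)) => /=.
      move=> [Z]; rewrite inE => /andP[/memB[j ->] h ->]; exists j => //.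
      by rewrite -flat_hyperplane !inE.
    move=> [j]; rewrite -flat_hyperplane !inE => h ->; exists (H j) => //.
    by rewrite inE h andbT; apply/memB; exists j.
  by move=> j _; rewrite capvA capvv.
have key : ((\dim {:V})%:R * (characteristic_polynomial fullv B).[-1]
        + 2 * \sum_(H <- B) (characteristic_polynomial H (restriction B H)).[-1] = 0)
   <-> (\dim {:V})%:R * flag_sum 0 (\dim {:V}) fullv =
    2 * \sum_i flag_sum 1 (\dim {:V}).-1 (H i) :> rat.
  pose sgn : rat := (-1) ^+ (\dim {:V}).-1.
  have [d0|d0] := posnP (\dim {:V}).
    have noI (i : I) : False by have [_] := hyperH i; rewrite d0.
    rewrite sumB d0 !big1 => [|i|i]; try by case: (noI i).
    by rewrite !mul0r !mulr0 add0r.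
  have sgn0 : sgn != 0 by rewrite signr_eq0.
  set e : int := _ + _.
  have eE : e%:~R = sgn * (2 * \sum_i flag_sum 1 (\dim {:V}).-1 (H i)
      - (\dim {:V})%:R * flag_sum 0 (\dim {:V}) fullv).
    rewrite /e sumB rmorphD !rmorphM /= rmorph_sum /= !rmorph_nat chiT.
    under eq_bigr do rewrite chiH.
    rewrite -mulr_sumr -/sgn -[in (-1) ^+ \dim _](prednK d0) exprS -/sgn.
    by ring.
  split=> [e0|eq0].
    move/eqP: eE; rewrite e0 eq_sym mulf_eq0 (negPf sgn0) subr_eq0 /=.
    by move/eqP.
  by apply/eqP; rewrite -(intr_eq0 rat) eE eq0 subrr mulr0.
have bigB : (\bigcap_(Y <- B) Y)%VS = (\bigcap_i H i)%VS.
  rewrite big_imfset /=; last by move=> i j _ _ /injH.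
  by rewrite big_enum_cond.
rewrite /simplicial BE bigB.
split=> [[_ _ h1 /key h2]|[h1 /key h2]]; first by split.
by split=> // Y; rewrite defA => -[i _ <-].
Qed.
End FlagSum.

(** * Symmetries of an arrangement *)
Section Transport.
Context {K : fieldType} {V : vectType K} {I : finType}.
Variable H : I -> {vspace V}.
Implicit Types (X : {vspace V}).

(** The orientation is chosen so that the flat with hyperplanes in B is mapped to the
    flat with hyperplanes in the preimage of B. *)
Definition symmetry (f : 'End(V)) (p : I -> I) :=
  [/\ lker f == 0%VS, injective p & forall j, (f @: H (p j))%VS = H j].

Variables (f : 'End(V)) (p : I -> I).
Hypothesis sym : symmetry f p.

Lemma sub_symmetry X j : (f @: X <= H j)%VS = (X <= H (p j))%VS.
Proof. have [kf _ fH] := sym; rewrite -fH; exact: limg_ker0. Qed.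

Lemma card_flat_symmetry X : #|flat H (f @: X)%VS| = #|flat H X|.
Proof.
have [_ ip _] := sym; rewrite -[RHS](card_preimset _ ip).
by apply: eq_card => j; rewrite !inE sub_symmetry.
Qed.

Lemma dim_symmetry X : \dim (f @: X) = \dim X.
Proof. by have [/eqP kf _ _] := sym; rewrite limg_dim_eq ?kf ?capv0. Qed.

Lemma flag_sum_symmetry a0 k X : flag_sum H a0 k (f @: X)%VS = flag_sum H a0 k X.
Proof.
have [kf ip fH] := sym.
elim: k X => //= k IHk X; congr (_ + _); rewrite [RHS](reindex_inj ip).
apply: eq_big => [j|j _]; first by rewrite sub_symmetry.
by rewrite -[in LHS]fH -!lker0_img_cap // IHk card_flat_symmetry.
Qed.

End Transport.

(** * Linear forms and rank one perturbations of the identity *)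
Section Forms.
Context {K : fieldType} {n : nat}.
Implicit Types (c h : 'cV[K]_n) (v b : 'rV[K]_n).

Definition form_map c : 'Hom('rV[K]_n, 'M[K]_1) := linfun (mulmxr c).

Definition form_kernel c : {vspace 'rV[K]_n} := lker (form_map c).

Lemma mem_form_kernel c v : (v \in form_kernel c) = (v *m c == 0).
Proof. by rewrite memv_ker lfunE. Qed.

Lemma form_nonzero_at c : c != 0 -> exists v, v *m c != 0.
Proof.
case/cV0Pn=> i ci; exists (delta_mx 0 i); apply: contraNneq ci => e.
by rewrite -rowE in e; have := congr1 (fun A : 'M__ => A 0 0) e; rewrite !mxE => ->.
Qed.

Lemma form_kernel_hyperplane c : c != 0 -> is_hyperplane fullv (form_kernel c).
Proof.
move=> c0; split; first exact: subvf.
rewrite -(limg_ker_dim (form_map c) fullv) capvC capvf.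
have -> : \dim (limg (form_map c)) = 1%N; last by rewrite addn1.
apply/anti_leq/andP; split.
  by apply: leq_trans (dimvS (subvf _)) _; rewrite dimvf /dim /= mul1n.
have [v vc] := form_nonzero_at c0.
rewrite lt0n dimv_eq0; apply: contraNneq vc => l0.
by rewrite -memv0 -l0 -[v *m c]/(mulmxr c v) -lfunE memv_img ?memvf.
Qed.

Lemma form_kernel_eq c h : h != 0 -> (form_kernel c <= form_kernel h)%VS -> c != 0 ->
  form_kernel h = form_kernel c.
Proof.
move=> h0 ch c0; apply/esym/eqP; rewrite eqEdim ch.
have [_ dc] := form_kernel_hyperplane c0; have [_ dh] := form_kernel_hyperplane h0.
by rewrite -ltnS dc dh /=.
Qed.

Lemma form_kernelZ a c : a != 0 -> form_kernel (a *: c) = form_kernel c.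
Proof.
move=> a0; apply/vspaceP => v; rewrite !mem_form_kernel -scalemxAr.
by rewrite scaler_eq0 (negPf a0).
Qed.

Lemma form_kernel_mul w c v : (v \in form_kernel (w *m c)) = (v *m w \in form_kernel c).
Proof. by rewrite !mem_form_kernel mulmxA. Qed.

Lemma mem_fixed_space (C : numClosedFieldType) m (g : 'M[C]_m) (v : 'rV_m) :
  (v \in fixed_space g) = (v *m g == v).
Proof. by apply/fixedSpaceP/eqP; rewrite lfunE /=. Qed.

End Forms.

Section Avoidance.
Context {C : numClosedFieldType} {n : nat}.

(** A vector space over an infinite field is not a finite union of proper subspaces.
    If v avoids all kernels but the one of c j, then so does v + t u for generic t,
    where u is outside of that kernel. *)
Lemma avoid_forms (I : eqType) (s : seq I) (c : I -> 'cV[C]_n) (U : {vspace 'rV[C]_n}) :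
    (forall i, i \in s -> ~~ (U <= form_kernel (c i))%VS) ->
  exists2 v, v \in U & forall i, i \in s -> v *m c i != 0.
Proof.
elim: s => [|j s IHs] ns; first by exists 0; rewrite ?mem0v.
have [i si|v vU vs] := IHs; first by apply: ns; rewrite inE si orbT.
have [u uU uj] : exists2 u, u \in U & u *m c j != 0.
  have /subvPn[u uU] := ns j (mem_head _ _); rewrite mem_form_kernel; by exists u.
pose q i : {poly C} := ((v *m c i) 0 0)%:P + (u *m c i) 0 0 *: 'X.
have qE i t : (q i).[t] = ((v + t *: u) *m c i) 0 0.
  by rewrite /q hornerD hornerC hornerZ hornerX mulmxDl -scalemxAl !mxE mulrC.
have q0 i : i \in j :: s -> q i != 0.
  rewrite inE => /orP[/eqP->|si].
    apply: contraNneq uj => /(congr1 (fun p : {poly C} => p`_1)).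
    rewrite coefD coefC coefZ coefX coef0 add0r mulr1 => e.
    by apply/eqP/matrixP => a b; rewrite !ord1 e mxE.
  apply: contraNneq (vs i si) => /(congr1 (fun p : {poly C} => p`_0)).
  rewrite coefD coefC coefZ coefX coef0 mulr0 addr0 => e.
  by apply/eqP/matrixP => a b; rewrite !ord1 e mxE.
have : \prod_(i <- j :: s) q i != 0.
  by rewrite prodf_seq_neq0; apply/allP => i /q0.
case/closed_nonrootP=> t; rewrite /root horner_prod prodf_seq_neq0 => /allP ht.
exists (v + t *: u); first by rewrite memvD ?memvZ.
move=> i si; have := ht i si; rewrite /= qE; apply: contraNneq => ->.
by rewrite mxE.
Qed.

End Avoidance.

Section RankOne.
Context {C : numClosedFieldType} {n : nat}.
Implicit Types (h : 'cV[C]_n) (b : 'rV[C]_n) (w : 'M[C]_n).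

(** Two triangular block factorizations of the same matrix. *)
Lemma det_one_plus_rank_one h b : \det (1%:M + h *m b) = 1 + (b *m h) 0 0.
Proof.
have e1 : block_mx 1%:M 0 b 1%:M *m block_mx (1%:M + h *m b) h 0 1%:M *m
     block_mx 1%:M 0 (- b) 1%:M = block_mx (1%:M : 'M_n) h 0 (1%:M + b *m h).
  rewrite !mulmx_block !mul1mx !mulmx1 !mul0mx !mulmx0 !addr0 !add0r.
  rewrite !mulmxDr !mulmxDl !mulmx1 !mulmxN !mul1mx ?mulmx1 mulmxA.
  congr block_mx; last by rewrite addrC.
    by rewrite addrK.
  by rewrite -addrA [X in _ + X]addrA subrr sub0r subrr.
have := congr1 (@determinant _ _) e1.
rewrite !det_mulmx !det_lblock !det_ublock !det1 !mul1r !mulr1 => ->.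
by rewrite [1%:M + _]mx11_scalar det_scalar1 !mxE eqxx.
Qed.

(** For v with v h = a <> 0, every u differs from a multiple of v by a fixed vector. *)
Lemma rank_one_of_fixed w h : h != 0 ->
  (form_kernel h <= fixed_space w)%VS -> exists b, w = 1%:M + h *m b.
Proof.
move=> h0 /subvP fixh; have [v vh] := form_nonzero_at h0.
pose a := (v *m h) 0 0.
have vha : v *m h = a%:M by exact: mx11_scalar.
have a0 : a != 0 by apply: contraNneq vh => a0; rewrite vha a0 -scalemx1 scale0r.
exists (a^-1 *: (v *m (w - 1%:M))); apply/eqP; rewrite -subr_eq0 opprD addrA; apply/eqP.
apply/row_matrixP => i; rewrite !rowE; set u := delta_mx 0 i.
rewrite mulmx0 mulmxBr -!scalemxAr [u *m (h *m _)]mulmxA [u *m h]mx11_scalar mul_scalar_mx.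
set t := (u *m h) 0 0.
have : u - (t / a) *: v \in form_kernel h.
  by rewrite mem_form_kernel mulmxBl -scalemxAl vha [u *m h]mx11_scalar -/t scale_scalar_mx divfK ?subrr.
move/fixh; rewrite mem_fixed_space => /eqP e; apply/eqP; rewrite subr_eq0; apply/eqP.
have : (u - (t / a) *: v) *m (w - 1%:M) = 0 by rewrite mulmxBr e mulmx1 subrr.
rewrite mulmxBl -scalemxAl => /eqP; rewrite subr_eq0 => /eqP->.
by rewrite scalerA [a^-1 * t]mulrC.
Qed.

Lemma fixed_rank_one h b : b != 0 -> fixed_space (1%:M + h *m b) = form_kernel h.
Proof.
move=> b0; apply/vspaceP => v; rewrite mem_fixed_space mem_form_kernel.
rewrite mulmxDr mulmx1 mulmxA [v *m h]mx11_scalar mul_scalar_mx.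
rewrite -subr_eq0 addrAC subrr add0r scaler_eq0 (negPf b0) orbF.
by rewrite -scalemx1 scaler_eq0 oner_eq0 orbF.
Qed.

(** The powers of a reflection of eigenvalue 1 + b h. *)
Lemma rank_one_expr h b k :
  (1%:M + h *m b) ^+ k =
    1%:M + (\sum_(i < k) (1 + (b *m h) 0 0) ^+ i) *: (h *m b).
Proof.
elim: k => [|k IHk]; first by rewrite big_ord0 scale0r addr0 expr0.
rewrite exprSr IHk big_ord_recr /=; set s := \sum_(_ < _) _; set z := (b *m h) 0 0.
have hb2 : (h *m b) *m (h *m b) = z *: (h *m b).
  by rewrite mulmxA -(mulmxA h) [b *m h]mx11_scalar -/z mul_mx_scalar scalemxAl.
have -> : (1 + z) ^+ k = 1 + s * z.
  rewrite mulrC; have := subrX1 (1 + z) k; rewrite -/s [1 + z - 1]addrAC subrr add0r => <-.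
  by rewrite addrCA subrr addr0.
rewrite -[_ * _]/(_ *m _) mulmxDl mul1mx mulmxDr mulmx1 -scalemxAl hb2 -!addrA; congr (_ + _).
by rewrite scalerA !scalerDl scale1r [RHS]addrCA.
Qed.


Lemma is_reflection_rank_one h b k : (0 < k)%N -> h != 0 ->
    (1 + (b *m h) 0 0) ^+ k = 1 -> (b *m h) 0 0 != 0 ->
  is_reflection (1%:M + h *m b).
Proof.
move=> k0 h0 zk bh0; have b0 : b != 0 by apply: contraNneq bh0 => ->; rewrite mul0mx mxE.
split; last by rewrite fixed_rank_one //; exact: form_kernel_hyperplane.
exists k => //; rewrite rank_one_expr.
set z := (b *m h) 0 0 in bh0 zk *.
have /eqP : z * \sum_(i < k) (1 + z) ^+ i = 0.
  by rewrite -[X in X * _](addrK 1) [z + 1]addrC -subrX1 zk subrr.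
by rewrite mulf_eq0 (negPf bh0) /= => /eqP->; rewrite scale0r addr0.
Qed.

(** If b h were 0, then w would be a transvection, of infinite order in
    characteristic 0. *)
Lemma reflection_form w : is_reflection w ->
  exists h b, [/\ h != 0, w = 1%:M + h *m b, fixed_space w = form_kernel h & (b *m h) 0 0 != 0].
Proof.
case=> -[k k0 wk] hyp.
have [h h0 sub] : exists2 h, h != 0 & (fixed_space w <= form_kernel h)%VS.
  have w1 : w - 1%:M != 0.
    apply/negP; rewrite subr_eq0 => /eqP w1; have [_] := hyp.
    suff -> : fixed_space w = fullv by move/eqP; rewrite -addn1 -{2}[\dim _]addn0 eqn_add2l.
    by apply/vspaceP => v; rewrite mem_fixed_space w1 mulmx1 eqxx memvf.
  have [j cj] : exists j, col j (w - 1%:M) != 0.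
    apply/existsP; apply: contraNT w1 => /existsPn e.
    apply/eqP/matrixP => a b; have /negPn/eqP/colP/(_ a) := e b.
    by rewrite !mxE.
  exists (col j (w - 1%:M)) => //; apply/subvP => v; rewrite mem_fixed_space mem_form_kernel => /eqP e.
  by rewrite -[col _ _]/(col _ _) colE mulmxA mulmxBr e mulmx1 subrr mul0mx.
have fE : fixed_space w = form_kernel h.
  apply/eqP; rewrite eqEdim sub; have [_ d1] := hyp; have [_ d2] := form_kernel_hyperplane h0.
  by rewrite -ltnS d1 d2 /=.
have [b wE] : exists b, w = 1%:M + h *m b by apply: rank_one_of_fixed h0 _; rewrite fE.
exists h, b; split=> //; apply/eqP => bh0.
move: wk; rewrite wE rank_one_expr bh0 addr0.
under eq_bigr do rewrite expr1n.
rewrite sumr_const card_ord -[RHS]addr0 => /addrI/eqP.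
rewrite scaler_eq0 pnatr_eq0 eqn0Ngt k0 /= => /eqP hb0.
have [_] := hyp; rewrite wE hb0 addr0.
suff -> : fixed_space (1%:M : 'M[C]_n) = fullv.
  by move/eqP; rewrite -addn1 -{2}[\dim _]addn0 eqn_add2l.
by apply/vspaceP => v; rewrite mem_fixed_space mulmx1 eqxx memvf.
Qed.

End RankOne.

(** * The reflections of a group generated by reflections *)
Section LinePermutations.
Context {C : numClosedFieldType} {n : nat} {I : finType}.
Variable c : I -> 'cV[C]_n.
Hypothesis c_neq0 : forall i, c i != 0.
Hypothesis c_inj : injective (fun i => form_kernel (c i)).
Implicit Types (w : 'M[C]_n) (p : {perm I}) (lam : I -> C).

Definition permutes_forms w p lam := forall i, w *m c i = lam i *: c (p i).

(** The product of the factors lam is the factor by which w multiplies the product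
    of all forms.  That it is det w is inherited by products and inverses, and so by
    the group generated by matrices with this property. *)
Definition det_permutes w :=
  w \in unitmx /\ exists p lam, permutes_forms w p lam /\ \prod_i lam i = \det w.

Lemma permutes_forms_neq0 w p lam i :
  w \in unitmx -> permutes_forms w p lam -> lam i != 0.
Proof.
move=> wu wp; apply: contraNneq (c_neq0 i) => li.
by rewrite -(mulKmx wu (c i)) wp li scale0r mulmx0.
Qed.

(** Evaluate the product of the forms whose kernels differ from that of h at a
    point of the kernel of h where it does not vanish: w permutes these forms and
    fixes this point. *)
Lemma prod_moved_factors w p lam h : w \in unitmx -> permutes_forms w p lam -> h != 0 ->
    (form_kernel h <= fixed_space w)%VS ->
  \prod_(i | form_kernel (c i) != form_kernel h) lam i = 1.
Proof.
move=> wu wp h0 fix_h; pose D := [pred i | form_kernel (c i) != form_kernel h].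
have [v vh vD] : exists2 v, v \in form_kernel h & forall i, i \in enum D -> v *m c i != 0.
  apply: avoid_forms => i; rewrite mem_enum inE; apply: contra => sub.
  by apply/eqP; apply: form_kernel_eq.
have vw : v *m w = v by apply/eqP; rewrite -mem_fixed_space; exact: (subvP fix_h).
have stab i : (p i \in D) = (i \in D).
  have -> : (p i \in D) = (form_kernel (w *m c i) != form_kernel h).
    by rewrite inE wp form_kernelZ // (permutes_forms_neq0 _ wu wp).
  rewrite inE; congr (~~ _).
  have sub (d : 'cV[C]_n) : d != 0 -> (form_kernel h <= form_kernel d)%VS = (form_kernel d == form_kernel h).
    move=> d0; apply/idP/eqP => [s|->//]; exact: form_kernel_eq.
  have wc0 : w *m c i != 0.
    by rewrite wp scaler_eq0 negb_or c_neq0 (permutes_forms_neq0 _ wu wp).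
  rewrite -(sub _ wc0) -(sub _ (c_neq0 i)).
  have fixv u : u \in form_kernel h -> u *m w = u.
    by move/(subvP fix_h); rewrite mem_fixed_space => /eqP.
  apply/idP/idP => /subvP s; apply/subvP => u uh; have := s u uh.
    by rewrite form_kernel_mul fixv.
  by rewrite (form_kernel_mul w (c i) u) fixv.
pose P := \prod_(i | i \in D) (v *m c i) 0 0.
have P0 : P != 0.
  apply/prodf_neq0 => i iD; apply: contraNneq (vD i _) => [e|]; last by rewrite mem_enum.
  by apply/eqP/matrixP => a b; rewrite !ord1 e mxE.
apply: (mulIf P0); rewrite mul1r {1}/P [X in _ * X](reindex_inj (@perm_inj _ p)) /=.
rewrite [X in _ * X](eq_bigl (fun i => i \in D)) // -big_split /=; apply: eq_bigr => i iD.
by have := congr1 (fun u => (u *m c i) 0 0) vw; rewrite /= -mulmxA wp -scalemxAr mxE.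
Qed.

(** The only factor left by prod_moved_factors is the one of c i0, an eigenvector
    of w with eigenvalue det w. *)
Lemma det_permutes_reflection w p lam i0 :
    w \in unitmx -> permutes_forms w p lam -> fixed_space w = form_kernel (c i0) ->
  det_permutes w.
Proof.
move=> wu wp fixw; split=> //; exists p, lam; split=> //.
have sub : (form_kernel (c i0) <= fixed_space w)%VS by rewrite fixw.
have [b wE] := rank_one_of_fixed (c_neq0 i0) sub.
rewrite (bigD1 i0) //= -[X in _ * X](_ : \prod_(i | form_kernel (c i) != form_kernel (c i0)) lam i = _); last first.
  by apply: eq_bigl => i; rewrite (inj_eq c_inj).
rewrite (prod_moved_factors wu wp) // mulr1 wE det_one_plus_rank_one.
have wc : w *m c i0 = (1 + (b *m c i0) 0 0) *: c i0.
  set z := (b *m _) 0 0; rewrite wE mulmxDl mul1mx -mulmxA [b *m _]mx11_scalar -/z.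
  by rewrite mul_mx_scalar scalerDl scale1r.
have := wp i0; rewrite wc => e.
have z0 : 1 + (b *m c i0) 0 0 != 0 by rewrite -det_one_plus_rank_one -wE -unitfE -unitmxE.
have pi0 : p i0 = i0.
  apply: c_inj; rewrite -(form_kernelZ _ (permutes_forms_neq0 i0 wu wp)) -wp wc.
  exact: form_kernelZ.
rewrite pi0 in e; apply/eqP; rewrite -subr_eq0.
move/eqP: e; rewrite eq_sym -subr_eq0 -scalerBl scaler_eq0 (negPf (c_neq0 i0)) orbF.
by [].
Qed.

(** Otherwise no form is left out in prod_moved_factors and det w = 1, whereas a
    reflection has a determinant other than 1. *)
Lemma reflection_in_family w : det_permutes w -> is_reflection w ->
  exists i, fixed_space w = form_kernel (c i).
Proof.
move=> [wu [p [lam [wp detw]]]] /reflection_form[h [b [h0 wE fixw bh0]]].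
apply: contrapT => no.
have sub : (form_kernel h <= fixed_space w)%VS by rewrite fixw.
have := prod_moved_factors wu wp h0 sub.
rewrite (eq_bigl predT) => [|i]; last first.
  by apply/negP => /eqP e; apply: no; exists i; rewrite fixw e.
rewrite detw wE det_one_plus_rank_one -[RHS]addr0 => /addrI/eqP.
exact/negP.
Qed.

Lemma det_permutes1 : det_permutes 1%:M.
Proof.
split; first exact: unitmx1.
exists 1%g, (fun=> 1); split=> [i|]; first by rewrite mul1mx perm1 scale1r.
by rewrite big1 ?det1.
Qed.

Lemma det_permutesM w1 w2 : det_permutes w1 -> det_permutes w2 -> det_permutes (w1 *m w2).
Proof.
move=> [u1 [p1 [l1 [h1 d1]]]] [u2 [p2 [l2 [h2 d2]]]].
split; first by rewrite unitmx_mul u1.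
exists (p2 * p1)%g, (fun i => l2 i * l1 (p2 i)); split=> [i|].
  by rewrite -mulmxA h2 -scalemxAr h1 scalerA permM.
by rewrite big_split /= d2 det_mulmx -d1 mulrC [in RHS](reindex_inj (@perm_inj _ p2)).
Qed.

Lemma det_permutesV w : det_permutes w -> det_permutes (invmx w).
Proof.
move=> [u [p [l [h d]]]]; split; first by rewrite unitmx_inv.
have l0 i := permutes_forms_neq0 i u h.
exists p^-1%g, (fun i => (l (p^-1%g i))^-1); split=> [i|].
  have := h (p^-1%g i); rewrite permKV => /(congr1 (mulmx (invmx w))).
  by rewrite mulKmx // -scalemxAr => ->; rewrite scalerK.
rewrite det_inv -d -prodfV [RHS](reindex_inj (@perm_inj _ p^-1%g)).
exact: eq_bigr.
Qed.

Lemma det_permutes_generated (S : set 'M[C]_n) :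
    (forall g, S g -> det_permutes g) ->
  forall w, generated_group S w -> det_permutes w.
Proof.
move=> hS w; elim=> [|g Sg|g h' _ Qg _ Qh|g _ Qg].
- exact: det_permutes1.
- exact: hS.
- exact: det_permutesM.
- exact: det_permutesV.
Qed.

End LinePermutations.

Section Conjugation.
Context {C : numClosedFieldType} {n : nat} {I : finType}.
Implicit Types (w s : 'M[C]_n) (c : I -> 'cV[C]_n).

Lemma fixed_space_conj w s (v : 'rV_n) : s \in unitmx ->
  (v \in fixed_space (invmx s *m w *m s)) = (v *m invmx s \in fixed_space w).
Proof.
move=> su; rewrite !mem_fixed_space !mulmxA; apply/eqP/eqP => [e|->]; last by rewrite mulmxKV.
by rewrite -{2}e mulmxK.
Qed.

Lemma reflection_conj w s (h : 'cV[C]_n) : s \in unitmx -> is_reflection w -> h != 0 ->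
    fixed_space w = form_kernel h ->
  is_reflection (invmx s *m w *m s) /\
  fixed_space (invmx s *m w *m s) = form_kernel (invmx s *m h).
Proof.
move=> su [[k k0 wk] _] h0 fixw.
have fixE : fixed_space (invmx s *m w *m s) = form_kernel (invmx s *m h).
  by apply/vspaceP => v; rewrite fixed_space_conj // fixw (form_kernel_mul (invmx s) h).
split=> //; split; last first.
  rewrite fixE; apply: form_kernel_hyperplane; apply: contraNneq h0 => e.
  by rewrite -(mulKVmx su h) e mulmx0.
exists k => //; have -> : (invmx s *m w *m s) ^+ k = invmx s *m w ^+ k *m s.
  elim: (k) => [|m IHm]; first by rewrite !expr0 mulmx1 mulVmx.
  rewrite !exprSr IHm -[_ * _ in LHS]/(_ *m _) -[_ * _ in RHS]/(_ *m _).
  by rewrite !mulmxA mulmxK.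
by rewrite wk mulmx1 mulVmx.
Qed.

Lemma reflection_arrangement_conj c (S : set 'M[C]_n) (P : 'M[C]_n) :
    P \in unitmx ->
    (forall i, c i != 0) -> injective (fun i => form_kernel (c i)) ->
    (forall g, S g -> det_permutes c g) ->
    (forall i, exists w, [/\ generated_group S w, is_reflection w &
                             fixed_space w = form_kernel (c i)]) ->
  reflection_arrangement [set invmx P *m g *m P | g in generated_group S]%classic =
  range (fun i => form_kernel (invmx P *m c i)).
Proof.
move=> Pu c0 cinj hS hR; apply/seteqP; split=> [X [_ [[g Wg <-] refl] <-]|X [i _ <-]].
  have [|i ei] := reflection_in_family c0 (det_permutes_generated c0 hS Wg) _.
    have [h [b [h0 _ fixg _]]] := reflection_form refl.
    have PVu : invmx P \in unitmx by rewrite unitmx_inv.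
    have gE : P *m (invmx P *m g *m P) *m invmx P = g.
      by rewrite !mulmxA mulmxV // mul1mx mulmxK.
    have [+ _] := reflection_conj PVu refl h0 fixg.
    by rewrite invmxK gE.
  exists i; first by [].
  apply/vspaceP => v.
  rewrite (fixed_space_conj g v Pu) ei (form_kernel_mul (invmx P) (c i)).
  by [].
have [w [Ww refl fixw]] := hR i.
have [r1 r2] := reflection_conj Pu refl (c0 i) fixw.
exists (invmx P *m w *m P); last exact: r2.
by split; [exists w | exact: r1].
Qed.

End Conjugation.

(** * The certificate checker *)
Local Close Scope ring_scope.

(** A ring with computable operations.  The tests is_zero and is_nonzero are separate
    since each of them only has to be sound: a computation in which both fail on a
    number that matters is rejected.  The operation rquo divides by an integer known
    to divide. *)
Record ring_ops := RingOps {
  elt :> Type;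
  rzero : elt;
  radd : elt -> elt -> elt;
  rsub : elt -> elt -> elt;
  rmul : elt -> elt -> elt;
  rofZ : Z -> elt;
  rconj : elt -> elt;
  rquo : elt -> Z -> elt;
  is_zero : elt -> bool;
  is_nonzero : elt -> bool }.

Definition Zops := {| rzero := Z0; radd := Z.add; rsub := Z.sub; rmul := Z.mul;
  rofZ := id; rconj := id; rquo := Z.div; is_zero := Z.eqb Z0; is_nonzero := fun x => ~~ Z.eqb Z0 x |}.

(** Pairs x.1 + x.2 * r with r ^ 2 = p * r + q.  The non-vanishing test is that of the
    norm, and complex conjugation fixes r or replaces it by p - r, its conjugate. *)
Definition quad_ops (R : ring_ops) (p q : Z) (real : bool) := {|
  rzero := (rzero R, rzero R);
  radd := fun x y => (radd x.1 y.1, radd x.2 y.2);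
  rsub := fun x y => (rsub x.1 y.1, rsub x.2 y.2);
  rmul := fun x y =>
    let bd := rmul x.2 y.2 in
    (radd (rmul x.1 y.1) (rmul (rofZ R q) bd),
     radd (radd (rmul x.1 y.2) (rmul x.2 y.1)) (rmul (rofZ R p) bd));
  rofZ := fun n => (rofZ R n, rzero R);
  rconj := fun x => let y := (rconj x.1, rconj x.2) in
    if real then y else (radd y.1 (rmul (rofZ R p) y.2), rsub (rzero R) y.2);
  rquo := fun x n => (rquo x.1 n, rquo x.2 n);
  is_zero := fun x => is_zero x.1 && is_zero x.2;
  is_nonzero := fun x => is_nonzero
    (rsub (rmul x.1 (radd x.1 (rmul (rofZ R p) x.2))) (rmul (rofZ R q) (rmul x.2 x.2))) |}.

Section Checker.
Variable R : ring_ops.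
Notation vec := (seq R).

(** A reflection v |-> v - f (v, b) / (a, b) a, where a is gen_root and b is gen_form,
    with f = 1 - z for the eigenvalue z.  Its action on forms has the integer
    denominator gen_norm = (a, b), and gen_start is a multiple of b whose orbit is
    integral. *)
Record generator := Generator {
  gen_factor : R; gen_root : vec; gen_form : vec; gen_norm : Z; gen_start : vec }.

Record reflection_data := ReflectionData {
  eigenvalue : R; root : vec; root_norm : Z; start_factor : R }.

Definition dot (u v : vec) : R :=
  foldr (fun xy s => radd (rmul xy.1 xy.2) s) (rzero R) (zip u v).

Definition generator_of n (B : nat -> nat -> R) r :=
  let b := mkseq (fun j => dot (mkseq (B j) n) (map (@rconj R) (root r))) n in
  Generator (rsub (rofZ R (Zpos xH)) (eigenvalue r)) (root r) b (root_norm r)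
    (map (rmul (start_factor r)) b).

(** The image of a form, multiplied by (a, b) to avoid divisions. *)
Definition gen_apply g (c : vec) : vec :=
  let m := rmul (gen_factor g) (dot (gen_root g) c) in
  let d := dot (gen_root g) (gen_form g) in
  [seq rsub (rmul d xy.1) (rmul m xy.2) | xy <- zip c (gen_form g)].

Definition proportional (u v : vec) : bool :=
  let p := find (@is_nonzero R) v in
  if (p < size v)%N then
    let up := nth (rzero R) u p in let vp := nth (rzero R) v p in
    all (fun xy => is_zero (rsub (rmul xy.1 vp) (rmul xy.2 up))) (zip u v)
  else false.

Definition add_line (L : seq vec) u := if has (proportional u) L then L else rcons L u.

(** Breadth-first closure of the lines under the generators; todo holds the lines of L
    whose images have not been taken. *)
Fixpoint grow_lines fuel gens (todo L : seq vec) : seq vec :=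
  if fuel is f.+1 then
    if todo is c :: r then
      let L' := foldl (fun L g => add_line L [seq rquo x (gen_norm g) | x <- gen_apply g c]) L gens in
      grow_lines f gens (r ++ drop (size L) L') L'
    else L
  else L.

(** No group has more than 126 lines, so fuel 200 suffices here and for grow_pool. *)
Definition all_lines gens :=
  let L := foldl add_line [::] (map gen_start gens) in grow_lines 200 gens L L.

Definition gen_perm (L : seq vec) g : seq nat :=
  [seq find (proportional (gen_apply g c)) L | c <- L].

Definition perm_inv (p : seq nat) := [seq index k p | k <- iota 0 (size p)].
(** The permutation h p h^-1. *)
Definition perm_conj (h p : seq nat) := [seq nth 0 h (nth 0 p k) | k <- perm_inv h].

Definition add_refl (P : seq (nat * seq nat)) x := if x.1 \in unzip1 P then P else rcons P x.

(** One reflection for each line: the entry (j, p) is the permutation p of the lines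
    by a reflection whose hyperplane is the one of line j, and conjugating it by a
    generator h gives such a reflection for the line h j.  The lines are visited in
    the order of grow_lines, so that the words of the certificates may refer to
    reflections by the number of their line. *)
Fixpoint grow_pool fuel perms (todo P : seq (nat * seq nat)) :=
  if fuel is f.+1 then
    if todo is x :: r then
      let P' := foldl (fun P h => let j := nth 0 h x.1 in
         if j \in unzip1 P then P else rcons P (j, perm_conj h x.2)) P perms in
      grow_pool f perms (r ++ drop (size P) P') P'
    else P
  else P.

Definition pool (L : seq vec) gens :=
  let perms := map (gen_perm L) gens in
  let P := foldl add_refl [::] (zip [seq find (proportional (gen_form g)) L | g <- gens] perms) in
  grow_pool 200 perms P P.

Definition skip {T} p (s : seq T) := take p s ++ drop p.+1 s.

(** Let p be a coordinate where v does not vanish.  In the basis of the kernel of v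
    given by v_p e_k - v_k e_p, for k <> p, a form r has these coordinates. *)
Definition eliminate (v r : vec) : vec :=
  let p := find (@is_nonzero R) v in
  let vp := nth (rzero R) v p in let rp := nth (rzero R) r p in
  [seq rsub (rmul vp xy.2) (rmul xy.1 rp) | xy <- zip (skip p v) (skip p r)].

Definition eliminate_row (T : seq vec) j := map (eliminate (nth [::] T j)) T.

Definition row_zero (r : vec) := all (@is_zero R) r.
Definition certified (T : seq vec) := all (fun r => row_zero r || has (@is_nonzero R) r) T.
Definition zero_mask (T : seq vec) : seq bool := map row_zero T.

(** Sets of lines are bit masks; this is the preimage of the set M under p. *)
Definition pull (M : seq bool) (p : seq nat) := map (nth false M) p.

(** A representative flat, the intersection of the hyperplanes in base; reflections
    that stabilize it; and for each orbit of hyperplanes H of its restriction under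
    these, one H with a word of reflections that carries X :&: H to a representative
    treated before. *)
Record flat_type := FlatType {
  base : seq nat; stab : seq nat; covers : seq (nat * seq nat) }.

(** The mask of a flat, with its flag_sum relative to a0 = 0 and to a0 = 1. *)
Definition entry := (seq bool * (Q * Q))%type.

(** Marks the orbit of todo in seen and counts the newly marked indices.  Beyond the
    end of seen everything counts as marked. *)
Fixpoint mark_orbit fuel (stabs : seq (seq nat)) todo seen cnt : seq bool * nat :=
  if fuel is f.+1 then
    if todo is x :: r then
      if nth true seen x then mark_orbit f stabs r seen cnt
      else mark_orbit f stabs (map (nth 0 ^~ x) stabs ++ r) (set_nth true seen x true) cnt.+1
    else (seen, cnt)
  else (seen, cnt).

Definition indices (M : seq bool) := [seq k <- iota 0 (size M) | nth false M k].

Definition lookup (env : seq entry) M : option (Q * Q) :=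
  ohead [seq e.2 | e <- env & e.1 == M].

(** Each item of the result is the number of hyperplanes H in one orbit, the number
    of hyperplanes through X :&: H, and the values of this flat. *)
Fixpoint run_covers (pl : seq (seq nat)) env (T : seq vec) M (stabs : seq (seq nat)) cs seen
    : option (seq (nat * (nat * (Q * Q)))) :=
  if cs is (j, w) :: cs' then
    let v := nth [::] T j in
    let T' := map (eliminate v) T in
    if has (@is_nonzero R) v && certified T' then
      let M' := zero_mask T' in
      let M'' := foldl (fun M i => pull M (nth (iota 0 (size T)) pl i)) M' w in
      if lookup env M'' is Some q then
        let todo := [seq k <- indices M' | ~~ nth false M k] in
        (* an index enters todo at the start and once for each element of stabs *)
        let: (seen', cnt) := mark_orbit (size T * (size stabs).+2) stabs todo seen 0 in
        if run_covers pl env T M stabs cs' seen' is Some l then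
          Some ((cnt, (count id M', q)) :: l)
        else None
      else None
    else None
  else if all id seen then Some [::] else None.

Definition Qnat (k : nat) : Q := inject_Z (BinIntDef.Z.of_nat k).

(** The recursion for flag_sum.  At the whole space, a0 = 1 meets items with a = 1;
    both here and in flag_sum the inverse of 0 is 0. *)
Definition weigh (a0 : nat) (pr : Q * Q -> Q) (l : seq (nat * (nat * (Q * Q)))) : Q :=
  foldr (fun x s =>
      Qred (Qplus (Qmult (Qnat x.1) (Qdiv (pr x.2.2) (Qnat (x.2.1 - a0)))) s))
    (inject_Z (Zpos xH)) l.

(** The mask of the flat and the orbits of its hyperplanes. *)
Definition run_type (L : seq vec) (pl : seq (seq nat)) env t : option (seq bool * seq (nat * (nat * (Q * Q)))) :=
  let go := foldl (fun oT j => if oT is Some T then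
      if has (@is_nonzero R) (nth [::] T j) then Some (eliminate_row T j) else None
      else None) (Some L) (base t) in
  if go is Some T then
    let M := zero_mask T in
    let stabs := [seq nth (iota 0 (size T)) pl i | i <- stab t] in
    if certified T && all (fun p => pull M p == M) stabs then
      if run_covers pl env T M stabs (covers t) M is Some l then Some (M, l) else None
    else None
  else None.

Fixpoint run_types L pl env ts : option (seq entry) :=
  if ts is t :: ts' then
    if run_type L pl env t is Some (M, l) then
      run_types L pl ((M, (weigh 0 fst l, weigh 1 snd l)) :: env) ts'
    else None
  else Some env.

(** The count says that the hyperplane of u is not contained in that of another
    line. *)
Definition lines_ok n (L : seq vec) :=
  all (fun u => [&& size u == n, has (@is_nonzero R) u,
      certified (map (eliminate u) L) & count row_zero (map (eliminate u) L) == 1]) L.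

(** The reflections have order 2 or 3. *)
Definition finite_order_factor (f : R) :=
  let u := rofZ R (Zpos xH) in let z := rsub u f in
  is_nonzero f && (is_zero (rsub (rmul z z) u) || is_zero (rsub (rmul z (rmul z z)) u)).

Definition gens_ok n (L : seq vec) gens :=
  all (fun g => [&& is_nonzero (dot (gen_root g) (gen_form g)), finite_order_factor (gen_factor g),
      size (gen_root g) == n, size (gen_form g) == n,
      has (proportional (gen_form g)) L & all (ltn^~ (size L)) (gen_perm L g)]) gens.

(** None rejects the certificate; Some b says whether the simplicial identity holds. *)
Definition gens_verdict n gens ts top : option bool :=
  let L := all_lines gens in
  let P := pool L gens in
  let pl := unzip2 P in
  if [&& lines_ok n L, gens_ok n L gens, all (mem (unzip1 P)) (iota 0 (size L)),
         has (fun t => size (base t) == n) ts & size (base top) == 0] then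
    if run_types L pl [::] ts is Some env then
      if run_type L pl env top is Some (M, l) then
        Some (Qeq_bool (Qmult (Qnat n) (weigh 0 fst l))
          (Qmult (Qnat 2) (foldr (fun x s =>
             Qplus (Qmult (Qnat x.1) x.2.2.2) s) (inject_Z Z0) l)))
      else None
    else None
  else None.

Definition verdict n B refs ts top := gens_verdict n (map (generator_of n B) refs) ts top.

End Checker.

Local Open Scope ring_scope.

(** * Exact numbers and their complex values *)
Section BinaryIntegers.

Lemma int_of_Z_add x y : int_of_Z (Z.add x y) = int_of_Z x + int_of_Z y.
Proof. exact: (rmorphD int_of_Z x y). Qed.

Lemma int_of_Z_opp x : int_of_Z (Z.opp x) = - int_of_Z x.
Proof. exact: (rmorphN int_of_Z x). Qed.

Lemma int_of_Z_sub x y : int_of_Z (Z.sub x y) = int_of_Z x - int_of_Z y.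
Proof. by rewrite -int_of_Z_opp -int_of_Z_add. Qed.

Lemma int_of_Z_mul x y : int_of_Z (Z.mul x y) = int_of_Z x * int_of_Z y.
Proof. exact: (rmorphM int_of_Z x y). Qed.

Lemma int_of_Z_eq0 x : (int_of_Z x == 0) = (Z.eqb Z0 x).
Proof.
apply/idP/idP; last by case: x.
by rewrite -[0]/(int_of_Z Z0) (can_eq int_of_ZK) => /eqP->.
Qed.

Lemma int_of_Z_nat k : int_of_Z (Z.of_nat k) = k%:Z.
Proof. exact: (Z_of_intK k%:Z). Qed.

End BinaryIntegers.

Section RationalValues.
Definition ratQ (x : Q) : rat :=
  (int_of_Z (Qnum x))%:~R / (int_of_Z (Zpos (Qden x)))%:~R.

Lemma den_neq0 (d : positive) : (int_of_Z (Zpos d))%:~R != 0 :> rat.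
Proof. by rewrite intr_eq0 int_of_Z_eq0. Qed.

Lemma ratQ_eq x y : Qeq x y <-> ratQ x = ratQ y.
Proof.
case: x y => [a b] [c d]; rewrite /Qeq /ratQ.
split=> [e|/eqP]; first apply/eqP.
  by rewrite eqr_div ?den_neq0 // -!intrM -!int_of_Z_mul eqr_int (can_eq int_of_ZK) e.
by rewrite eqr_div ?den_neq0 // -!intrM -!int_of_Z_mul eqr_int (can_eq int_of_ZK) => /eqP.
Qed.

Lemma ratQD x y : ratQ (Qplus x y) = ratQ x + ratQ y.
Proof.
case: x y => [a b] [c d]; rewrite /ratQ /Qplus.
rewrite addf_div ?den_neq0 // -!intrM -intrD -!int_of_Z_mul -int_of_Z_add.
by [].
Qed.

Lemma ratQM x y : ratQ (Qmult x y) = ratQ x * ratQ y.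
Proof.
case: x y => [a b] [c d]; rewrite /ratQ /Qmult.
by rewrite mulf_div -!intrM -!int_of_Z_mul.
Qed.

Lemma ratQV x : ratQ (Qinv x) = (ratQ x)^-1.
Proof.
have negE a b : ratQ (Qmake (Zneg a) b) = - ratQ (Qmake (Zpos a) b).
  by rewrite /ratQ -[Zneg a]/(Z.opp (Zpos a)) int_of_Z_opp rmorphN mulNr.
have posV a b : ratQ (Qmake (Zpos b) a) = (ratQ (Qmake (Zpos a) b))^-1.
  by rewrite /ratQ invf_div.
case: x => [[|p|p] d]; first by rewrite /ratQ /= !mul0r invr0.
  exact: posV.
by rewrite negE invrN -posV -negE.
Qed.

Lemma ratQ_nat k : ratQ (Qnat k) = k%:R.
Proof. by rewrite /ratQ /Qnat divr1 int_of_Z_nat. Qed.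

Lemma ratQ_red x : ratQ (Qred x) = ratQ x.
Proof. by apply/ratQ_eq; exact: Qred_correct. Qed.

End RationalValues.

Section Embeddings.
Context {C : numClosedFieldType}.

(** Sound complex values of the numbers of R. *)
Record embedding (R : ring_ops) := Embedding {
  ev :> R -> C;
  ev0 : ev (rzero R) = 0;
  evD : forall x y, ev (radd x y) = ev x + ev y;
  evB : forall x y, ev (rsub x y) = ev x - ev y;
  evM : forall x y, ev (rmul x y) = ev x * ev y;
  evZ : forall m, ev (rofZ R m) = (int_of_Z m)%:~R;
  evJ : forall x, ev (rconj x) = (ev x)^*;
  ev_zero : forall x, is_zero x -> ev x = 0;
  ev_nonzero : forall x, is_nonzero x -> ev x != 0 }.

Definition Z_embedding : embedding Zops.
Proof.
apply: (@Embedding Zops (fun m : Z => (int_of_Z m)%:~R)) => [|x y|x y|x y|m|m|x|x] //.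
- by rewrite int_of_Z_add rmorphD.
- by rewrite int_of_Z_sub rmorphB.
- by rewrite int_of_Z_mul rmorphM.
- by rewrite rmorph_int.
- by rewrite -[is_zero _]/(Z.eqb Z0 x) -int_of_Z_eq0 => /eqP->.
- by rewrite -[is_nonzero _]/(~~ Z.eqb Z0 x) intr_eq0 int_of_Z_eq0.
Defined.

(** The product of x.1 + x.2 a with its conjugate x.1 + x.2 (P - a) is the norm, so a
    non-zero norm excludes the value 0. *)
Lemma quad_embedding R (e : embedding R) (p q : Z) (real : bool) (a : C) :
  a ^+ 2 = (int_of_Z p)%:~R * a + (int_of_Z q)%:~R ->
  a^* = (if real then a else (int_of_Z p)%:~R - a) ->
  { f : embedding (quad_ops R p q real) | forall x, f x = e x.1 + e x.2 * a }.
Proof.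
move=> a2 aJ; set P : C := (int_of_Z p)%:~R in a2 aJ *; set Q : C := (int_of_Z q)%:~R in a2 *.
unshelve eexists; first unshelve eapply (@Embedding (quad_ops R p q real) (fun x => e x.1 + e x.2 * a)).
all: rewrite /=.
- by rewrite ev0 mul0r addr0.
- by move=> x y; rewrite !evD; ring.
- by move=> x y; rewrite !evB; ring.
- move=> x y; rewrite !(evD, evM, evZ) -/P -/Q.
  have -> : (e x.1 + e x.2 * a) * (e y.1 + e y.2 * a) =
    e x.1 * e y.1 + (e x.1 * e y.2 + e x.2 * e y.1) * a + e x.2 * e y.2 * a ^+ 2 by ring.
  by rewrite a2; ring.
- by move=> m; rewrite evZ ev0 mul0r addr0.
- move=> x; rewrite rmorphD rmorphM /= aJ -!evJ; case: (real) => //=.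
  by rewrite !(evD, evB, evM, evZ, ev0) -/P; ring.
- by move=> x /andP[/(ev_zero e)-> /(ev_zero e)->]; rewrite mul0r addr0.
- move=> x /(ev_nonzero e); rewrite !(evD, evM, evZ, evB) -/P -/Q; apply: contraNneq => e0.
  have -> : e x.1 * (e x.1 + P * e x.2) - Q * (e x.2 * e x.2) =
      (e x.1 + e x.2 * a) * (e x.1 + e x.2 * (P - a)) + e x.2 ^+ 2 * (a ^+ 2 - (P * a + Q)) by ring.
  by rewrite e0 a2 subrr mul0r mulr0 addr0.
by [].
Defined.

End Embeddings.

(** * Flats and elimination *)

Lemma size_skip T p (s : seq T) : (p < size s)%N -> size (skip p s) = (size s).-1.
Proof.
move=> ps; rewrite size_cat size_take ps size_drop.
by case: (size s) ps => // m pm; rewrite subSS subnKC.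
Qed.

Lemma nth_skip T (x0 : T) p (s : seq T) k : (p <= size s)%N ->
  nth x0 (skip p s) k = nth x0 s (bump p k).
Proof.
move=> ps; rewrite nth_cat size_takel // /bump; case: (ltnP k p) => kp.
  by rewrite nth_take.
by rewrite nth_drop addSn subnKC // add1n.
Qed.

Section Tables.
Context {C : numClosedFieldType} {R : ring_ops} (e : embedding (C := C) R).
Context {n N : nat}.
Variable c : 'I_N -> 'cV[C]_n.
Hypothesis c_neq0 : forall j, c j != 0.
Implicit Types (X Y : {vspace 'rV[C]_n}) (T : seq (seq R)) (M : seq bool).

Local Notation H := (fun j => form_kernel (c j)).
Local Notation z0 := (rzero R).

Definition is_flat X := exists B : {set 'I_N}, X = (\bigcap_(j in B) H j)%VS.

Definition mask_set M : {set 'I_N} := [set j : 'I_N | nth false M j].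

(** The row of line j in T holds the values of the form c j on a basis U of X. *)
Definition represents X T (d : nat) :=
  [/\ size T = N, is_flat X, (forall j : 'I_N, size (nth [::] T j) = d) &
      exists U : seq 'rV[C]_n, [/\ size U = d, basis_of X U &
        forall (j : 'I_N) k, (k < d)%N ->
          e (nth z0 (nth [::] T j) k) = (U`_k *m c j) 0 0]].

Lemma form_hyperplane j : is_hyperplane fullv (H j).
Proof. exact: form_kernel_hyperplane. Qed.

Lemma represents_dim X T d : represents X T d -> \dim X = d.
Proof. by case=> _ _ _ [U [<- /andP[/eqP<- /eqP->]]]. Qed.

Lemma find_nonzero (v : seq R) : has (@is_nonzero R) v ->
  (find (@is_nonzero R) v < size v)%N /\ e (nth z0 v (find (@is_nonzero R) v)) != 0.
Proof.
by move=> hv; split; [rewrite -has_find | exact: ev_nonzero (nth_find z0 hv)].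
Qed.

Lemma sub_basis X (U : seq 'rV[C]_n) j : basis_of X U ->
  (X <= H j)%VS = all (fun u => u *m c j == 0) U.
Proof.
move=> bU; rewrite -(span_basis bU); apply/span_subvP/allP => h u /h.
  by rewrite mem_form_kernel.
by rewrite mem_form_kernel.
Qed.

Lemma represents_zero X T d (j : 'I_N) : represents X T d -> certified T ->
  (X <= H j)%VS = row_zero (nth [::] T j).
Proof.
move=> [sT _ sr [U [sU bU rU]]] cT; rewrite (sub_basis _ bU).
apply/allP/idP => [h|z u uU].
  have /orP[//|/find_nonzero[]] : row_zero (nth [::] T j) || has (@is_nonzero R) (nth [::] T j).
    by apply: (all_nthP [::] cT); rewrite sT.
  set k := find _ _; rewrite sr => kd; rewrite rU // => /negP[].
  have /eqP-> : U`_k *m c j == 0 by apply: h; rewrite mem_nth ?sU.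
  by rewrite mxE.
have /(nthP 0)[k ks <-] := uU; rewrite sU in ks.
apply/eqP/matrixP => a b; rewrite !ord1 -rU // mxE.
apply: ev_zero; apply: (all_nthP z0 z); by rewrite sr.
Qed.

Lemma bigcap_sub (B : {set 'I_N}) j : j \in B -> (\bigcap_(i in B) H i <= H j)%VS.
Proof. by move=> jB; rewrite (bigD1 j jB) /= capvSl. Qed.

Lemma represents_flat X T d : represents X T d -> certified T ->
  flat H X = mask_set (zero_mask T).
Proof.
move=> rX cT; apply/setP => j; rewrite !inE (represents_zero _ rX cT).
by have [sT _ _ _] := rX; rewrite (nth_map [::]) ?sT.
Qed.

Lemma bigcap_flat X : is_flat X -> (\bigcap_(j in flat H X) H j)%VS = X.
Proof.
case=> B ->; apply/eqP; rewrite eqEsubv; apply/andP; split.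
  apply/subv_bigcapP => j jB; apply: bigcap_sub.
  by rewrite inE; exact: bigcap_sub.
by apply/subv_bigcapP => j; rewrite inE.
Qed.

Lemma is_flat_cap X j : is_flat X -> is_flat (X :&: H j)%VS.
Proof.
case=> B ->; exists (j |: B); apply/eqP; rewrite eqEsubv; apply/andP; split.
  apply/subv_bigcapP => i; rewrite !inE => /orP[/eqP->|iB]; first exact: capvSr.
  by apply: subv_trans (capvSl _ _) _; exact: bigcap_sub.
rewrite subv_cap; apply/andP; split.
  by apply/subv_bigcapP => i iB; apply: bigcap_sub; rewrite !inE iB orbT.
by apply: bigcap_sub; rewrite !inE eqxx.
Qed.

(** The new vectors lie in the kernel of c j and span, together with U_p, all of X;
    so they are a basis of X :&: H j by a comparison of dimensions. *)
Lemma represents_eliminate X T d (j : 'I_N) : represents X T d ->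
    has (@is_nonzero R) (nth [::] T j) ->
  ~~ (X <= H j)%VS /\ represents (X :&: H j)%VS (eliminate_row T j) d.-1.
Proof.
move=> rX nz; have dX := represents_dim rX.
have [sT fX sr [U [sU bU rU]]] := rX.
set v := nth [::] T j in nz *; have [] := find_nonzero nz.
set p := find _ _; rewrite sr => pd vp0.
have d0 : (0 < d)%N by exact: leq_ltn_trans pd.
have bump_lt k : (k < d.-1)%N -> (bump p k < d)%N.
  by rewrite ltn_predRL /bump; case: (p <= k)%N => // /ltnW.
have nX : ~~ (X <= H j)%VS.
  rewrite (sub_basis _ bU); apply/allPn; exists U`_p; first by rewrite mem_nth ?sU.
  apply: contraNneq vp0; rewrite /v rU // => ->; by rewrite mxE.
split=> //; split; first by rewrite size_map.
- exact: is_flat_cap.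
- move=> i; rewrite (nth_map [::]) ?sT // size_map size_zip !size_skip ?sr //.
  by rewrite minnn.
pose w k : 'rV[C]_n := e (nth z0 v p) *: U`_(bump p k) - e (nth z0 v (bump p k)) *: U`_p.
have dXj := dim_cap_hyperplane form_hyperplane nX; rewrite dX in dXj.
have dcap : \dim (X :&: H j) = d.-1 by rewrite -dXj.
have UX k : (k < d)%N -> U`_k \in X by move=> kd; rewrite (basis_mem bU) // mem_nth ?sU.
have wval i k : (k < d.-1)%N -> (w k *m c i) 0 0 =
    e (nth z0 v p) * e (nth z0 (nth [::] T i) (bump p k)) -
    e (nth z0 v (bump p k)) * e (nth z0 (nth [::] T i) p).
  move=> kd; have pairing a b (u v' : 'rV[C]_n) : ((a *: u - b *: v') *m c i) 0 0 =
      a * (u *m c i) 0 0 - b * (v' *m c i) 0 0.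
    by rewrite mulmxBl -!scalemxAl; move: (u *m _) (v' *m _) => y1 y2; rewrite !mxE.
  by rewrite pairing !rU ?bump_lt.
exists (mkseq w d.-1); rewrite size_mkseq; split=> //; last first.
  move=> i k kd; rewrite nth_mkseq // wval // (nth_map [::]) ?sT //.
  rewrite /eliminate (nth_map (z0, z0)); last first.
    by rewrite size_zip !size_skip ?sr // minnn.
  by rewrite nth_zip ?size_skip ?sr //= !nth_skip ?sr ?(ltnW pd) // evB !evM.
have sub : (<<mkseq w d.-1>> <= X :&: H j)%VS.
  apply/span_subvP => u /mapP[k]; rewrite mem_iota add0n => /andP[_ kd] ->.
  rewrite memv_cap memvB ?memvZ ?UX ?bump_lt //= mem_form_kernel.
  apply/eqP/matrixP => a b; rewrite !ord1 wval // mxE -/v.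
  by rewrite mulrC subrr.
have dsp : (d <= (\dim <<mkseq w d.-1>>).+1)%N.
  rewrite -[X in (X <= _)%N]dX -[X in (_ <= X)%N]addn1.
  apply: leq_trans (_ : \dim (<<mkseq w d.-1>> + <[U`_p]>)%VS <= _)%N.
    apply: dimvS; rewrite -(span_basis bU); apply/span_subvP => u /(nthP 0)[k]; rewrite sU => kd <-.
    have [->|kp] := eqVneq k p; first by rewrite memvE addvSr.
    have [m md ->] : exists2 m, (m < d.-1)%N & k = bump p m.
      exists (unbump p k); last by rewrite unbumpK // inE.
      rewrite /unbump; case: (ltnP p k) => h; first by rewrite subn1 -ltnS !prednK // (leq_ltn_trans _ h).
      rewrite subn0; apply: leq_trans (_ : p <= _)%N; first by rewrite ltn_neqAle kp.
      by rewrite -ltnS prednK.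
    have -> : U`_(bump p m) = (e (nth z0 v p))^-1 *: w m +
        ((e (nth z0 v p))^-1 * e (nth z0 v (bump p m))) *: U`_p.
      by rewrite /w scalerBr scalerA mulVf // scale1r scalerA subrK.
    apply: memv_add; rewrite memvZ ?memv_line // memv_span //.
    by apply/mapP; exists m; rewrite // mem_iota.
  apply: leq_trans (leq_of_leqif (dimv_add_leqif _ _)) _; rewrite leq_add2l dim_vline; exact: leq_b1.
rewrite basisEdim size_mkseq dcap.
have dle : (d.-1 <= \dim <<mkseq w d.-1>>)%N by rewrite -ltnS prednK.
rewrite leqnn andbT; have : (<<mkseq w d.-1>> == X :&: H j)%VS by rewrite eqEdim sub dcap.
by move/eqP->.
Qed.

Lemma represents_base X T d (bs : seq nat) T' :
    represents X T d ->
    foldl (fun oT j => if oT is Some T then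
      if has (@is_nonzero R) (nth [::] T j) then Some (eliminate_row T j) else None
      else None) (Some T) bs = Some T' ->
  exists X', represents X' T' (d - size bs) /\ (size bs = 0%N -> X' = X).
Proof.
elim: bs X T d => [|j bs IH] X T d rX /=; first by move=> [<-]; exists X; rewrite subn0.
have none : forall f : seq (seq R) -> nat -> _,
    foldl (fun oT j => if oT is Some T then f T j else None) None bs = None.
  by move=> f; elim: (bs).
case: ifP => [nz|_]; last by rewrite none.
have jN : (j < N)%N.
  have [sT _ _ _] := rX; rewrite ltnNge; apply/negP => Nj.
  by move: nz; rewrite nth_default ?sT.
have [_ rX'] := represents_eliminate (j := Ordinal jN) rX nz.
case/(IH _ _ _ rX') => X' [rX'' _]; exists X'; split=> //.
by rewrite subnS -subn1 subnAC subn1.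
Qed.

End Tables.

(** * Soundness of the traversal of the flats *)
Section Runs.
Context {C : numClosedFieldType} {R : ring_ops} (e : embedding (C := C) R).
Context {n N : nat}.
Variable c : 'I_N -> 'cV[C]_n.
Hypothesis c_neq0 : forall j, c j != 0.
Implicit Types (X Y : {vspace 'rV[C]_n}) (T : seq (seq R)) (M : seq bool).

Local Notation H := (fun j => form_kernel (c j)).
Local (** Symmetries are tracked by the permutations of the lines alone. *)
Definition realizes (p : seq nat) := size p = N /\
  exists (f : 'End('rV[C]_n)) (g : 'I_N -> 'I_N),
    symmetry H f g /\ forall j : 'I_N, nth 0%N p j = g j.

Lemma realizes_id : realizes (iota 0 N).
Proof.
split; first by rewrite size_iota.
exists \1%VF, id; split; last by move=> j; rewrite nth_iota.
split=> //; last by move=> j; rewrite lim1g.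
by apply/eqP; apply/eqP/lker0P => u v; rewrite !id_lfunE.
Qed.

Lemma mask_set_pull M p (g : 'I_N -> 'I_N) : size p = N ->
  (forall j : 'I_N, nth 0%N p j = g j) ->
  @mask_set N (pull M p) = g @^-1: @mask_set N M.
Proof.
by move=> sp pg; apply/setP => j; rewrite !inE (nth_map 0%N) ?sp // pg.
Qed.

Lemma card_mask_set M : size M = N -> #|@mask_set N M| = count id M.
Proof.
move=> sM; rewrite -sum1_count big_mkcond (big_nth false) sM big_mkord -sum1_card.
by rewrite [LHS]big_mkcond; apply: eq_bigr => j _; rewrite inE.
Qed.

Lemma is_flat_symmetry X f g : symmetry H f g -> is_flat c X -> is_flat c (f @: X)%VS.
Proof.
move=> [kf gi fH] [B ->]; exists (g @^-1: B).
rewrite (big_morph (fun U => f @: U)%VS (fun U W => lker0_img_cap U W kf) (lker0_limgf kf)).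
rewrite (reindex_inj gi) /=; apply: eq_big => [j|j _]; first by rewrite inE.
exact: fH.
Qed.

(** The two values depend only on the orbit of X, as shown in has_value_symmetry. *)
Definition has_value X (q : Q * Q) :=
  flag_sum H 0 (\dim X) X = ratQ q.1 /\ flag_sum H 1 (\dim X) X = ratQ q.2.

Lemma has_value_symmetry X f g q : symmetry H f g ->
  has_value (f @: X)%VS q <-> has_value X q.
Proof. by move=> s; rewrite /has_value (dim_symmetry s) !(flag_sum_symmetry s). Qed.

Lemma realizes_pull X M p : realizes p -> is_flat c X -> flat H X = @mask_set N M ->
  exists X', [/\ is_flat c X', flat H X' = @mask_set N (pull M p) &
                 forall q, has_value X' q <-> has_value X q].
Proof.
move=> [sp [f [g [s pg]]]] fX XM; exists (f @: X)%VS; split.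
- exact: is_flat_symmetry s fX.
- rewrite (mask_set_pull M sp pg) -XM; apply/setP => j.
  by rewrite !inE (sub_symmetry s).
- by move=> q; exact: has_value_symmetry s.
Qed.

Lemma flat_inj X Y : is_flat c X -> is_flat c Y -> flat H X = flat H Y -> X = Y.
Proof. by move=> fX fY XY; rewrite -(bigcap_flat fX) -(bigcap_flat fY) XY. Qed.

Definition entry_ok (en : entry) := exists X,
  [/\ is_flat c X, flat H X = @mask_set N en.1 & has_value X en.2].

Fixpoint env_ok (env : seq entry) :=
  if env is en :: env' then entry_ok en /\ env_ok env' else True.

Lemma lookup_ok env M q : env_ok env -> lookup env M = Some q -> entry_ok (M, q).
Proof.
rewrite /lookup; elim: env => //= -[M' q'] env IH [ok /IH {IH}]; case: eqP => //= eM IH.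
by case=> <-; rewrite -eM.
Qed.

Definition pool_ok (pl : seq (seq nat)) := forall i, (i < size pl)%N -> realizes (nth [::] pl i).

Lemma pool_nth pl i : pool_ok pl -> realizes (nth (iota 0 N) pl i).
Proof.
move=> ok; case: (ltnP i (size pl)) => hi; last by rewrite nth_default //; exact: realizes_id.
by rewrite (set_nth_default [::]) //; exact: ok.
Qed.

(** A word carries X to a flat with the mask of an entry, and a flat is determined by
    its mask. *)
Lemma word_value pl (w : seq nat) X M q : pool_ok pl -> is_flat c X ->
    flat H X = @mask_set N M ->
    entry_ok (foldl (fun M i => pull M (nth (iota 0 N) pl i)) M w, q) ->
  has_value X q.
Proof.
move=> ok; elim: w X M => [|i w IH] X M fX XM /=.
  by case=> Y [fY YM vY]; rewrite (flat_inj fX fY) // XM YM.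
have [X' [fX' XM' vX']] := realizes_pull (pool_nth i ok) fX XM.
by move/(IH X' _ fX' XM'); rewrite vX'.
Qed.

(** What is marked leaves the sum over the unmarked indices with the constant
    value t. *)
Lemma mark_orbit_sum (p : nat -> Prop) (F : nat -> rat) t stabs :
    (forall x, p x -> F x = t) ->
    (forall s, s \in stabs -> forall x, p x -> p (nth 0%N s x)) ->
  forall fuel todo seen cnt seen' cnt', (forall x, x \in todo -> p x) ->
    size seen = N -> mark_orbit fuel stabs todo seen cnt = (seen', cnt') ->
  size seen' = N /\
  \sum_(j < N | ~~ nth true seen j) F j + cnt%:R * t =
  \sum_(j < N | ~~ nth true seen' j) F j + cnt'%:R * t.
Proof.
move=> pF ps; elim=> [|fuel IH] [|x todo] seen cnt seen' cnt' ptodo sseen /=; try by case=> <- <-.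
case: ifP => xs; first by apply: IH => // y yt; apply: ptodo; rewrite inE yt orbT.
have px : p x by apply: ptodo; rewrite inE eqxx.
have xN : (x < N)%N by rewrite -sseen ltnNge; apply: contraFN xs => ?; rewrite nth_default.
have ss' : size (set_nth true seen x true) = N.
  by rewrite size_set_nth sseen; apply/maxn_idPr.
case/IH => //.
  move=> y; rewrite mem_cat => /orP[/mapP[s sS ->]|yt]; first exact: ps.
  by apply: ptodo; rewrite inE yt orbT.
move=> ss <-; split=> //.
have unseenE : \sum_(j < N | ~~ nth true seen j) F j =
    t + \sum_(j < N | ~~ nth true (set_nth true seen x true) j) F j.
  rewrite (bigD1 (Ordinal xN)) /= ?xs // pF //; congr (_ + _).
  apply: eq_bigl => j; rewrite nth_set_nth /= -val_eqE /=.
  by case: eqP => //=; rewrite ?andbF ?andbT.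
by rewrite unseenE -natr1; ring.
Qed.

(** Stated for any F that depends on X :&: H only through the data of the items, since
    it is applied to both flag sums and, at the whole space, to their sum over the
    hyperplanes. *)
Lemma run_covers_sum pl env X T d stabs :
    pool_ok pl -> env_ok env -> represents e c X T d -> certified T ->
    (forall s, s \in stabs -> realizes s /\ pull (zero_mask T) s = zero_mask T) ->
  forall cs seen l, size seen = N ->
    run_covers pl env T (zero_mask T) stabs cs seen = Some l ->
  forall (F : nat -> rat) (Phi : nat -> Q * Q -> rat),
    (forall (j : 'I_N) a q, ~~ (X <= H j)%VS -> #|flat H (X :&: H j)%VS| = a ->
       has_value (X :&: H j)%VS q -> F j = Phi a q) ->
  \sum_(j < N | ~~ nth true seen j) F j = \sum_(x <- l) x.1%:R * Phi x.2.1 x.2.2.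
Proof.
move=> plok envok rX cT hst; have [sT fX sr _] := rX.
have XM := represents_flat rX cT.
elim=> [|[j w] cs IH] seen l sseen /=.
  case: ifP => // /allP aseen [<-] F Phi _; rewrite big_nil big1 // => j.
  by rewrite (aseen (nth true seen j)) // mem_nth // sseen.
case: ifP => // /andP[nz cT']; case eq: lookup => [q|] //.
case em: mark_orbit => [seen' cnt]; case er: run_covers => [l'|] // [<-] F Phi hF.
have jN : (j < N)%N.
  by rewrite ltnNge; apply/negP => Nj; move: nz; rewrite nth_default ?sT.
have [nX rY] := represents_eliminate c_neq0 (j := Ordinal jN) rX nz.
set Y := (X :&: _)%VS in rY; have [sT' fY _ _] := rY.
have YM := represents_flat rY cT'.
set M' := zero_mask _ in eq em er *.
have vY : has_value Y q.
  rewrite sT in eq; exact: word_value plok fY YM (lookup_ok envok eq).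
have aY : #|flat H Y| = count id M' by rewrite YM card_mask_set // size_map.
pose p (x : nat) := exists k : 'I_N, [/\ x = k :> nat, ~~ (X <= H k)%VS,
   #|flat H (X :&: H k)%VS| = count id M' & has_value (X :&: H k)%VS q].
have pF x : p x -> F x = Phi (count id M') q by case=> k [-> nk ak vk]; exact: hF.
have ps s : s \in stabs -> forall x, p x -> p (nth 0%N s x).
  move=> /hst[[ss [f [g [sym sg]]]] Ms] x [k [-> nk ak vk]]; exists (g k); rewrite sg.
  have fXX : (f @: X)%VS = X.
    apply: flat_inj => //; first exact: is_flat_symmetry sym fX.
    rewrite XM -[in RHS]Ms (mask_set_pull _ ss sg) -XM; apply/setP => i.
    by rewrite !inE (sub_symmetry sym).
  have fXk : (f @: (X :&: H (g k)))%VS = (X :&: H k)%VS.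
    by have [kf _ fH] := sym; rewrite lker0_img_cap // fXX fH.
  split=> //.
  - by rewrite -(sub_symmetry sym) fXX.
  - by rewrite -(card_flat_symmetry sym) fXk.
  - by apply/(has_value_symmetry _ _ sym); rewrite fXk.
have [|ss' unseenE] := mark_orbit_sum pF ps _ sseen em.
  move=> k; rewrite mem_filter mem_filter mem_iota add0n size_map size_map sT.
  case/and3P=> nk kM /andP[_ kN]; pose k' := Ordinal kN.
  have kY : (Y <= H k')%VS by have := in_set (fun j => Y <= H j)%VS k'; rewrite -/(flat H Y) YM inE => <-.
  have nk' : ~~ (X <= H k')%VS.
    by have := in_set (fun j => X <= H j)%VS k'; rewrite -/(flat H X) XM inE => <-.
  have XkY : (X :&: H k')%VS = Y.
    apply/esym/eqP; rewrite eqEdim subv_cap capvSl kY /=.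
    by rewrite -ltnS !(dim_cap_hyperplane (form_hyperplane c_neq0)).
  by exists k'; rewrite XkY.
rewrite mul0r addr0 in unseenE.
by rewrite unseenE big_cons (IH _ _ ss' er F Phi hF) addrC.
Qed.

End Runs.

#[local] Arguments Qred : simpl never.
#[local] Arguments Qplus : simpl never.
#[local] Arguments Qmult : simpl never.
#[local] Arguments Qdiv : simpl never.

Section Verdict.
Context {C : numClosedFieldType} {R : ring_ops} (e : embedding (C := C) R).
Context {n N : nat}.
Variable c : 'I_N -> 'cV[C]_n.
Hypothesis c_neq0 : forall j, c j != 0.
Implicit Types (X Y : {vspace 'rV[C]_n}) (T : seq (seq R)) (M : seq bool).

Local Notation H := (fun j => form_kernel (c j)).

Lemma weigh_sum a0 pr l : ratQ (weigh a0 pr l) =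
  1 + \sum_(x <- l) x.1%:R * (ratQ (pr x.2.2) / (x.2.1 - a0)%:R).
Proof.
rewrite /weigh; elim: l => [|x l IH] /=; first by rewrite big_nil addr0.
by rewrite ratQ_red ratQD ratQM [ratQ (Qdiv _ _)]ratQM ratQV !ratQ_nat IH big_cons addrCA.
Qed.

Variable L : seq (seq R).
Hypothesis reprL : represents e c fullv L n.

Lemma run_type_ok pl env t M l : pool_ok c pl -> env_ok c env ->
    run_type L pl env t = Some (M, l) ->
  exists X, [/\ [/\ is_flat c X, flat H X = @mask_set N M, \dim X = (n - size (base t))%N &
                    (size (base t) = 0%N -> X = fullv)],
    has_value c X (weigh 0 fst l, weigh 1 snd l) &
    forall (F : nat -> rat) (Phi : nat -> Q * Q -> rat),
    (forall (j : 'I_N) a q, ~~ (X <= H j)%VS -> #|flat H (X :&: H j)%VS| = a ->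
       has_value c (X :&: H j)%VS q -> F j = Phi a q) ->
  \sum_(j < N | ~~ (X <= H j)%VS) F j = \sum_(x <- l) x.1%:R * Phi x.2.1 x.2.2].
Proof.
move=> plok envok; rewrite /run_type.
case eT: (foldl _ _ _) => [T|] //; case: ifP => // /andP[cT /allP stabT].
case er: run_covers => [l'|] // [<- <-].
have [X [rX X0]] := represents_base c_neq0 reprL eT.
have XM := represents_flat rX cT; have [sT fX _ _] := rX.
have hst s : s \in [seq nth (iota 0 (size T)) pl i | i <- stab t] ->
    realizes c s /\ pull (zero_mask T) s = zero_mask T.
  move=> sin; split; last by apply/eqP; exact: stabT.
  by case/mapP: sin => i _ ->; rewrite sT; exact: pool_nth.
have smask : size (zero_mask T) = N by rewrite size_map.
have sumF (F : nat -> rat) (Phi : nat -> Q * Q -> rat) : (forall (j : 'I_N) a q, ~~ (X <= H j)%VS ->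
      #|flat H (X :&: H j)%VS| = a -> has_value c (X :&: H j)%VS q -> F j = Phi a q) ->
    \sum_(j < N | ~~ (X <= H j)%VS) F j = \sum_(x <- l') x.1%:R * Phi x.2.1 x.2.2.
  move=> hF; rewrite -(run_covers_sum c_neq0 plok envok rX cT hst smask er hF).
  apply: eq_bigl => j.
  have := in_set (fun j => X <= H j)%VS j; rewrite -/(flat H X) XM inE => <-.
  by rewrite !(nth_map [::]) ?sT.
exists X; split=> //; first by split=> //; exact: represents_dim rX.
have val a pr : (forall Y q, has_value c Y q -> flag_sum H a (\dim Y) Y = ratQ (pr q)) ->
    flag_sum H a (\dim X) X = ratQ (weigh a pr l').
  move=> prE; rewrite weigh_sum.
  rewrite -(sumF (fun j => if insub j is Some j' then
     flag_sum H a (\dim (X :&: H j')) (X :&: H j')%VS / (#|flat H (X :&: H j')%VS| - a)%:R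
     else 0) (fun a' q => ratQ (pr q) / (a' - a)%:R)); last first.
    by move=> j a' q nX aX vX; rewrite valK (prE _ _ vX) aX.
  case dX: (\dim X) => [|d] /=.
    rewrite big_pred0 ?addr0 // => j.
    have /eqP-> : X == 0%VS by rewrite -dimv_eq0 dX.
    by rewrite sub0v.
  congr (_ + _); apply: eq_bigr => j nX; rewrite valK.
  by have := dim_cap_hyperplane (form_hyperplane c_neq0) nX; rewrite dX => -[->].
by split; apply: val => Y q [].
Qed.

Lemma run_types_ok pl ts : pool_ok c pl -> forall env env', env_ok c env ->
  run_types L pl env ts = Some env' -> env_ok c env' /\
  (has (fun t => size (base t) == n) ts -> exists X, is_flat c X /\ X = 0%VS).
Proof.
move=> plok; elim: ts => [|t ts IH] env env' envok /=; first by case=> <-.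
case er: run_type => [[M l]|] //.
have [X [[fX XM dX _] vX _]] := run_type_ok plok envok er.
case/IH => [|ok' hz]; first by split=> //; exists X.
split=> // /orP[/eqP sb|//]; exists X; split=> //.
by apply/eqP; rewrite -dimv_eq0 dX sb subnn.
Qed.

(** Some representative is cut out by n hyperplanes, hence 0. *)
Lemma verdict_ok pl ts top env M l :
    pool_ok c pl -> run_types L pl [::] ts = Some env ->
    run_type L pl env top = Some (M, l) ->
    has (fun t => size (base t) == n) ts -> size (base top) = 0%N ->
  (\bigcap_i H i)%VS = 0%VS /\
  (Qeq_bool (Qmult (Qnat n) (weigh 0 fst l))
    (Qmult (Qnat 2) (foldr (fun x s =>
       Qplus (Qmult (Qnat x.1) x.2.2.2) s) (inject_Z Z0) l))
   <-> (n%:R * flag_sum H 0 n fullv = 2 * \sum_j flag_sum H 1 n.-1 (H j))).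
Proof.
move=> plok ets et hz st0.
have [envok /(_ hz)[Y [fY Y0]]] := run_types_ok plok (I : env_ok c [::]) ets.
split.
  apply/eqP; rewrite -subv0 -Y0; case: fY => B ->.
  by apply/subv_bigcapP => j _; rewrite (bigD1 j) //= capvSl.
have [X [[fX XM dX /(_ st0) X1] [v0 _] sumF]] := run_type_ok plok envok et.
rewrite st0 subn0 in dX.
have foldE : ratQ (foldr (fun x s => Qplus (Qmult (Qnat x.1) x.2.2.2) s)
     (inject_Z Z0) l) = \sum_(x <- l) x.1%:R * ratQ x.2.2.2.
  elim: (l) => [|x l' IH] /=; first by rewrite big_nil /ratQ /= mul0r.
  by rewrite ratQD ratQM ratQ_nat IH big_cons.
have nX j : ~~ (X <= H j)%VS.
  rewrite X1; apply/negP => /dimvS; have [_ <-] := form_hyperplane c_neq0 j; by rewrite ltnn.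
rewrite -(sumF (fun j => if insub j is Some j' then flag_sum H 1 n.-1 (H j') else 0)
    (fun _ q => ratQ q.2)) in foldE; last first.
  move=> j a q _ _; rewrite valK X1 capvC capvf => -[_ <-].
  have dH : \dim (H j) = n.-1.
    have [_] := form_hyperplane c_neq0 j; rewrite dimvf /dim /= mul1n.
    by move/(congr1 predn).
  by rewrite dH.
rewrite (eq_bigl predT) in foldE; last by move=> j; exact: nX.
rewrite (eq_bigr (fun j => flag_sum H 1 n.-1 (H j))) in foldE; last by move=> j _; rewrite valK.
rewrite dX X1 in v0; rewrite -foldE v0 -ratQ_nat -[2]/(2%:R) -(ratQ_nat 2) -!ratQM.
rewrite -ratQ_eq; exact: Qeq_bool_iff.
Qed.

End Verdict.

(** * From the lines to the reflection group *)
Section Realizations.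
Context {C : numClosedFieldType} {n N : nat}.
Variable c : 'I_N -> 'cV[C]_n.
Local Notation H := (fun j => form_kernel (c j)).

Lemma symmetry_mulmx (t : 'M[C]_n) (g : 'I_N -> 'I_N) : t \in unitmx -> injective g ->
    (forall j, form_kernel (t *m c j) = form_kernel (c (g j))) ->
  symmetry H (linfun (mulmxr t)) g.
Proof.
move=> tu gi tE; split=> // [|j].
  apply/lker0P => u v; rewrite !lfunE /= => uv; by rewrite -(mulmxK tu u) uv mulmxK.
apply/vspaceP => v; apply/memv_imgP/idP => [[u uH ->]|vH].
  by rewrite lfunE /= -(form_kernel_mul t (c j) u) tE.
exists (v *m invmx t); last by rewrite lfunE /= mulmxKV.
by rewrite -tE (form_kernel_mul t (c j)) mulmxKV.
Qed.

Lemma symmetry_comp f1 g1 f2 g2 : symmetry H f1 g1 -> symmetry H f2 g2 ->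
  symmetry H (f2 \o f1)%VF (g1 \o g2).
Proof.
move=> [k1 i1 h1] [k2 i2 h2]; split; last by move=> j; rewrite limg_comp h1 h2.
  move/lker0P: k1 => k1; move/lker0P: k2 => k2.
  by apply/lker0P => u v; rewrite !comp_lfunE => /k2/k1.
exact: inj_comp.
Qed.

Lemma symmetry_inv f g (gi : injective g) : symmetry H f g ->
  symmetry H f^-1%VF (invF gi).
Proof.
move=> [k _ h]; split=> [||j].
- apply/lker0P => u v uv; by rewrite -(lker0_lfunVK k u) uv lker0_lfunVK.
- exact: (can_inj (f_invF gi)).
by have /= <- := h (invF gi j); rewrite -limg_comp f_invF lker0_compVf // lim1g.
Qed.

Lemma perm_list p (g : 'I_N -> 'I_N) : size p = N -> (forall j : 'I_N, nth 0%N p j = g j) ->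
  p = [seq val (g j) | j <- enum 'I_N].
Proof.
move=> sp pg; apply: (@eq_from_nth _ 0%N); first by rewrite size_map size_enum_ord.
move=> i; rewrite sp => iN; rewrite (nth_map (Ordinal iN)) ?size_enum_ord //.
by have := pg (nth (Ordinal iN) (enum 'I_N) i); rewrite nth_enum_ord.
Qed.

Lemma realizes_conj h p : realizes c h -> realizes c p -> realizes c (perm_conj h p).
Proof.
move=> [sh [f [g [sym hg]]]] [sp [f' [g' [sym' pg]]]].
have [_ gi _] := sym; split; first by rewrite !size_map size_iota.
exists ((f^-1 \o f') \o f)%VF, (g \o (g' \o invF gi)); split.
  exact: (symmetry_comp sym (symmetry_comp sym' (symmetry_inv gi sym))).
move=> j; rewrite (nth_map 0%N) ?size_map ?size_iota ?sh //.
rewrite (nth_map 0%N) ?size_iota ?sh // nth_iota ?sh // add0n.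
have -> : index (j : nat) h = invF gi j.
  have vg_inj : injective (fun i => val (g i)) by move=> i k /val_inj/gi.
  have := index_map vg_inj (enum 'I_N) (invF gi j).
  by rewrite /= f_invF -(perm_list sh hg) index_enum_ord.
by rewrite pg hg.
Qed.

End Realizations.

Section Generators.
Context {C : numClosedFieldType} {R : ring_ops} (e : embedding (C := C) R).
Context {n : nat}.
Implicit Types (u v : seq R) (g : generator R).

Local Notation z0 := (rzero R).

Definition col_of u : 'cV[C]_n := \col_k e (nth z0 u k).
Definition row_of u : 'rV[C]_n := \row_k e (nth z0 u k).

(** Row vectors are acted on from the right and forms, which are columns, from the
    left. *)
Definition gen_mx g : 'M[C]_n :=
  1%:M - (e (gen_factor g) / e (dot (gen_root g) (gen_form g))) *:
    (col_of (gen_form g) *m row_of (gen_root g)).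

Lemma e_dot_sum u v : size u = size v ->
  e (dot u v) = \sum_(0 <= k < size u) e (nth z0 u k) * e (nth z0 v k).
Proof.
elim: u v => [|x u IH] [|y v] //= => [_|[suv]]; first by rewrite big_nil /dot /= ev0.
by rewrite /dot /= evD evM -/(dot u v) IH // big_nat_recl.
Qed.

Lemma e_dot u v : size u = n -> size v = n -> e (dot u v) = (row_of u *m col_of v) 0 0.
Proof.
move=> su sv; rewrite mxE e_dot_sum ?su ?sv // big_mkord.
by apply: eq_bigr => k _; rewrite !mxE.
Qed.

Lemma col_gen_apply g v : size (gen_root g) = n -> size (gen_form g) = n -> size v = n ->
    e (dot (gen_root g) (gen_form g)) != 0 ->
  col_of (gen_apply g v) = e (dot (gen_root g) (gen_form g)) *: (gen_mx g *m col_of v).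
Proof.
move=> sr sf sv d0; rewrite /gen_mx mulmxBl mul1mx -scalemxAl -mulmxA.
rewrite [row_of _ *m _]mx11_scalar -e_dot // mul_mx_scalar scalerA scalerBr scalerA.
rewrite mulrA [_ * (_ / _)]mulrC divfK //; apply/colP => k; rewrite !mxE.
by rewrite (nth_map (z0, z0)) ?size_zip ?sv ?sf ?minnn // nth_zip ?sv ?sf //= evB !evM.
Qed.

Lemma size_gen_apply g v : size (gen_form g) = n -> size v = n -> size (gen_apply g v) = n.
Proof. by move=> sf sv; rewrite size_map size_zip sf sv minnn. Qed.

Lemma proportional_col u v : size u = n -> size v = n -> proportional u v ->
  exists a, col_of u = a *: col_of v.
Proof.
move=> su sv; rewrite /proportional; case: ifP => // pv.
have [|_] := find_nonzero e (v := v); first by rewrite has_find.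
set p := find _ _ => vp0 /(all_nthP (z0, z0)) h.
exists (e (nth z0 u p) / e (nth z0 v p)); apply/colP => k; rewrite !mxE.
have := h k; rewrite size_zip su sv minnn nth_zip ?su ?sv // => /(_ (ltn_ord k)).
move/(ev_zero e)/eqP; rewrite /= evB !evM subr_eq0 => /eqP E.
by apply: (mulIf vp0); rewrite E mulrAC divfK // mulrC.
Qed.

Definition gen_valid g := [/\ e (dot (gen_root g) (gen_form g)) != 0, e (gen_factor g) != 0 &
  exists2 k, (0 < k)%N & (1 - e (gen_factor g)) ^+ k = 1].

Lemma gen_mx_reflection g : size (gen_root g) = n -> size (gen_form g) = n -> gen_valid g ->
  [/\ gen_mx g \in unitmx, is_reflection (gen_mx g), col_of (gen_form g) != 0 &
      fixed_space (gen_mx g) = form_kernel (col_of (gen_form g))].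
Proof.
move=> sr sf [d0 f0 [k k0 fk]].
set h := col_of (gen_form g); pose d := e (dot (gen_root g) (gen_form g)).
pose b : 'rV[C]_n := - (e (gen_factor g) / d) *: row_of (gen_root g).
have gE : gen_mx g = 1%:M + h *m b.
  by rewrite /gen_mx /b -scalemxAr scaleNr.
have bh : (b *m h) 0 0 = - e (gen_factor g).
  rewrite /b -scalemxAl mxE -e_dot // -/d mulNr divfK //.
have bh0 : (b *m h) 0 0 != 0 by rewrite bh oppr_eq0.
have h0 : h != 0 by apply: contraNneq bh0 => ->; rewrite mulmx0 mxE.
have b0 : b != 0 by apply: contraNneq bh0 => ->; rewrite mul0mx mxE.
rewrite gE; split.
- rewrite unitmxE det_one_plus_rank_one bh unitfE; apply/eqP => z.
  by move: fk; rewrite z expr0n gtn_eqF // => /eqP; rewrite eq_sym oner_eq0.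
- by apply: (is_reflection_rank_one k0 h0) => //; rewrite bh.
- exact: h0.
- exact: fixed_rank_one.
Qed.

End Generators.

Section Lines.
Context {C : numClosedFieldType} {R : ring_ops} (e : embedding (C := C) R).
Context {n : nat} (P : 'M[C]_n) (Punit : P \in unitmx).
Variables (gens : seq (generator R)) (g0 : generator R) (L : seq (seq R)).

Local Notation N := (size L).
Local Notation z0 := (rzero R).

Definition line_form (j : 'I_N) : 'cV[C]_n := col_of e (nth [::] L j).
(** The forms of the hyperplanes of the group conjugated by P. *)
Definition conj_form (j : 'I_N) : 'cV[C]_n := invmx P *m line_form j.

Hypothesis linesL : lines_ok n L.
Hypothesis gensL : gens_ok n L gens.

Lemma gen_of_gens_ok i : (i < size gens)%N -> let g := nth g0 gens i in
  [/\ size (gen_root g) = n, size (gen_form g) = n,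
      has (proportional (gen_form g)) L & all (ltn^~ N) (gen_perm L g)].
Proof. by move=> hi; have /and3P[_ _ /and4P[/eqP ? /eqP ? ? ?]] := all_nthP g0 gensL i hi. Qed.

Lemma gen_valid_gens_ok i : (i < size gens)%N -> gen_valid e (nth g0 gens i).
Proof.
move=> hi; have /and3P[d0 ff _] := all_nthP g0 gensL i hi.
split; first exact: ev_nonzero d0.
  by case/andP: ff => /(ev_nonzero e).
have e1 : e (rofZ R (Zpos xH)) = 1 by rewrite evZ.
case/andP: ff => _ /orP[]/(ev_zero e)/eqP; rewrite !(evB, evM) e1 subr_eq0 => /eqP z.
  by exists 2%N; rewrite // expr2.
by exists 3%N; rewrite // !exprS expr0 mulr1.
Qed.


Local Notation H := (fun j => form_kernel (conj_form j)).

Let lineP (j : 'I_N) : let u := nth [::] L j in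
  [/\ size u = n, has (@is_nonzero R) u, certified (map (eliminate u) L) &
      count (@row_zero R) (map (eliminate u) L) = 1%N].
Proof.
by move=> u; have /and4P[/eqP ? ? ? /eqP ?] := all_nthP [::] linesL j (ltn_ord j).
Qed.

Lemma line_form_neq0 j : line_form j != 0.
Proof.
have [su /find_nonzero-/(_ _ e)[pn p0] _ _] := lineP j; rewrite su in pn.
by apply: contraNneq p0 => /colP/(_ (Ordinal pn)); rewrite !mxE /= => ->.
Qed.

Lemma conj_form_neq0 j : conj_form j != 0.
Proof.
apply: contraNneq (line_form_neq0 j) => h.
by rewrite -(mulKVmx Punit (line_form j)) -/(conj_form j) h mulmx0.
Qed.

Lemma represents_lines : represents e conj_form fullv L n.
Proof.
split=> //; first by exists set0; rewrite big_set0.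
  by move=> j; have [] := lineP j.
exists [seq row k P | k <- enum 'I_n]; rewrite size_map size_enum_ord; split=> //.
  rewrite basisEdim size_map size_enum_ord dimvf /dim /= mul1n leqnn andbT.
  apply/subvP => v _; rewrite -(mulmxKV Punit v) mulmx_sum_row.
  apply: memv_suml => k _; apply: memvZ; apply: memv_span.
  by apply: map_f; rewrite mem_enum.
move=> j k kn; rewrite (nth_map (Ordinal kn)) ?size_enum_ord //.
by rewrite rowE /conj_form -mulmxA mulKVmx // -rowE !mxE nth_enum_ord.
Qed.

(** By lines_ok, the hyperplane of line i lies in no other hyperplane. *)
Lemma conj_form_inj : injective (fun j => H j).
Proof.
move=> i j /= ij; have [su nz cert cnt] := lineP i.
have [_] := represents_eliminate conj_form_neq0 (j := i) represents_lines nz.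
rewrite capvC capvf => rH; have := represents_flat rH cert.
move=> /(congr1 (fun B : {set 'I_N} => #|B|)).
rewrite card_mask_set ?size_map // /zero_mask -[count id _]/(count id _) count_map.
rewrite [count _ _]cnt => /eqP/cards1P[k flatE].
have : i \in flat (fun j => form_kernel (conj_form j)) (form_kernel (conj_form i)) by rewrite inE subvv.
have : j \in flat (fun j => form_kernel (conj_form j)) (form_kernel (conj_form i)) by rewrite inE ij subvv.
by rewrite flatE !inE => /eqP-> /eqP->.
Qed.

Lemma line_form_inj : injective (fun j => form_kernel (line_form j)).
Proof.
move=> i j /= ij; apply: conj_form_inj => /=; apply/vspaceP => v.
have E m : (v \in form_kernel (conj_form m)) = (v *m invmx P \in form_kernel (line_form m)).
  exact: (form_kernel_mul (invmx P) (line_form m) v).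
by rewrite (E i) (E j) ij.
Qed.

Lemma gen_permutes i : (i < size gens)%N -> let g := nth g0 gens i in
  exists (p : {perm 'I_N}) lam, permutes_forms line_form (gen_mx e g) p lam /\
    forall j : 'I_N, nth 0%N (gen_perm L g) j = p j.
Proof.
move=> hi g; have [sr sf hasf permN] := gen_of_gens_ok hi; have vg := gen_valid_gens_ok hi.
have [gu _ _ _] := gen_mx_reflection sr sf vg; have [d0 _ _] := vg.
have pN (j : 'I_N) : (nth 0%N (gen_perm L g) j < N)%N.
  by apply: (all_nthP 0%N permN); rewrite size_map.
pose p j : 'I_N := Ordinal (pN j).
have pE j : exists a, gen_mx e g *m line_form j = a *: line_form (p j).
  have [sj _ _ _] := lineP j; have [sp _ _ _] := lineP (p j).
  have prop : proportional (gen_apply g (nth [::] L j)) (nth [::] L (p j)).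
    by rewrite /= (nth_map [::]) // nth_find // has_find; have := pN j; rewrite (nth_map [::]).
  have [a] := proportional_col e (size_gen_apply sf sj) sp prop.
  rewrite col_gen_apply // => E; exists ((e (dot (gen_root g) (gen_form g)))^-1 * a).
  by rewrite -scalerA -E scalerK.
have [lam lamE] : exists lam : 'I_N -> C, forall j, gen_mx e g *m line_form j = lam j *: line_form (p j).
  by have [lam] := choice pE; exists lam.
have lam0 j : lam j != 0.
  apply: contraNneq (line_form_neq0 j) => l0.
  by rewrite -(mulKmx gu (line_form j)) lamE l0 scale0r mulmx0.
have pinj : injective p.
  move=> j k jk; apply: line_form_inj => /=.
  have E m : line_form m = invmx (gen_mx e g) *m (lam m *: line_form (p m)).
    by rewrite -lamE mulKmx.
  rewrite (E j) (E k) jk -!scalemxAr !form_kernelZ //.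
exists (perm pinj), lam; split=> j; first by rewrite permE.
by rewrite permE.
Qed.


Variable S : set 'M[C]_n.
Hypothesis genS : forall s, S s <-> exists2 i, (i < size gens)%N & s = gen_mx e (nth g0 gens i).

(** The hyperplane of line j is that of a reflection of the group. *)
Definition reflecting_line (j : nat) := exists i : 'I_N, j = i /\ exists w,
  [/\ generated_group S w, is_reflection w & fixed_space w = form_kernel (line_form i)].

Definition good_refl (x : nat * seq nat) := reflecting_line x.1 /\ realizes conj_form x.2.

Let perms := map (gen_perm L) gens.

Lemma gen_realizes h : h \in perms -> realizes conj_form h.
Proof.
case/(nthP [::]) => i; rewrite size_map => hi; rewrite (nth_map g0) // => <-.
have [p [lam [wp hp]]] := gen_permutes hi.
split; first by rewrite size_map.
have [sr sf _ _] := gen_of_gens_ok hi.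
have [gu _ _ _] := gen_mx_reflection sr sf (gen_valid_gens_ok hi).
exists (linfun (mulmxr (invmx P *m gen_mx e (nth g0 gens i) *m P))), p.
split=> [|j]; last by rewrite hp.
apply: symmetry_mulmx; first by rewrite !unitmx_mul unitmx_inv Punit gu.
  exact: perm_inj.
move=> j; rewrite /conj_form -!mulmxA mulKVmx // wp -scalemxAr form_kernelZ //.
exact: (permutes_forms_neq0 line_form_neq0 j gu wp).
Qed.

Lemma gen_line i : (i < size gens)%N -> let g := nth g0 gens i in
  exists j : 'I_N, [/\ find (proportional (gen_form g)) L = j, (gen_mx e g : 'M[C]_n) \in unitmx,
    is_reflection (gen_mx e g : 'M[C]_n) & fixed_space (gen_mx e g) = form_kernel (line_form j)].
Proof.
move=> hi g; have [sr sf hasf _] := gen_of_gens_ok hi.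
have [gu gr f0 gf] := gen_mx_reflection sr sf (gen_valid_gens_ok hi).
have jN : (find (proportional (gen_form g)) L < N)%N by rewrite -has_find.
exists (Ordinal jN); split=> //; rewrite gf.
have /and4P[/eqP sj _ _ _] := all_nthP [::] linesL _ jN.
have [a E] := proportional_col e sf sj (nth_find [::] hasf).
rewrite E form_kernelZ //; apply: contraNneq f0 => a0; by rewrite E a0 scale0r.
Qed.

Lemma good_start x : x \in zip [seq find (proportional (gen_form g)) L | g <- gens] perms ->
  good_refl x.
Proof.
case/(nthP (0%N, [::])) => i; rewrite size_zip !size_map minnn => hi <-.
rewrite nth_zip ?size_map //; split.
  rewrite /= (nth_map g0) //; have [j [-> _ gr gf]] := gen_line hi.
  exists j; split=> //; exists (gen_mx e (nth g0 gens i)); split=> //.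
  by apply: generated_gen; apply/genS; exists i.
by apply: gen_realizes; rewrite mem_nth ?size_map.
Qed.

(** Conjugation by a generator moves reflections and their hyperplanes along. *)
Lemma good_conj h x : h \in perms -> good_refl x -> good_refl (nth 0%N h x.1, perm_conj h x.2).
Proof.
move=> hp [[j [xj [w [Sw rw fw]]]] rx]; split; last exact: realizes_conj (gen_realizes hp) rx.
have [i hi hE] : exists2 i, (i < size gens)%N & h = gen_perm L (nth g0 gens i).
  case/(nthP [::]): hp => i; rewrite size_map => hi <-; exists i => //.
  by rewrite (nth_map g0).
have [p [lam [wp ph]]] := gen_permutes hi.
have [_ [_ gu _ _]] := gen_line hi.
have := wp j; set s := gen_mx e _ in gu wp * => sj.
exists (p j); split; first by rewrite /= hE xj ph.
have Ss : generated_group S s by apply: generated_gen; apply/genS; exists i.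
have Vu : invmx s \in unitmx by rewrite unitmx_inv.
have [r1 r2] := reflection_conj Vu rw (line_form_neq0 j) fw.
exists (invmx (invmx s) *m w *m invmx s); split=> //.
  by rewrite invmxK; apply: generated_mul; [apply: generated_mul | apply: generated_inv].
rewrite r2 invmxK sj form_kernelZ //.
exact: (permutes_forms_neq0 line_form_neq0 j gu wp).
Qed.

Lemma good_grow fuel todo acc : {in todo, forall x, good_refl x} -> {in acc, forall x, good_refl x} ->
  {in grow_pool fuel perms todo acc, forall x, good_refl x}.
Proof.
elim: fuel todo acc => [|fuel IH] [|x todo] acc //= gt ga.
set acc' := foldl _ _ _.
have gx : good_refl x by apply: gt; rewrite inE eqxx.
have step hs A : {subset hs <= perms} -> {in A, forall x, good_refl x} ->
    {in foldl (fun A h => let j := nth 0%N h x.1 in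
       if j \in unzip1 A then A else rcons A (j, perm_conj h x.2)) A hs,
     forall x, good_refl x}.
  elim: hs A => //= h hs IHh A hsub gA; apply: IHh => [y yh|].
    by apply: hsub; rewrite inE yh orbT.
  case: ifP => // _ y; rewrite mem_rcons inE => /orP[/eqP->|]; last exact: gA.
  by apply: good_conj => //; apply: hsub; rewrite inE eqxx.
have ga' : {in acc', forall x, good_refl x} by exact: step.
apply: IH => // y; rewrite mem_cat => /orP[yt|/mem_drop]; last exact: ga'.
by apply: gt; rewrite inE yt orbT.
Qed.

Lemma good_pool : {in pool L gens, forall x, good_refl x}.
Proof.
rewrite /pool; set acc := foldl _ _ _.
suff ga : {in acc, forall x, good_refl x} by exact: good_grow.
have := good_start; rewrite /acc -/perms; move: (zip _ _) => s.
have : {in [::], forall x, good_refl x} by [].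
elim: s [::] {acc} => //= x s IH acc ga gs; apply: IH => [|y ys]; last by apply: gs; rewrite inE ys orbT.
rewrite /add_refl; case: ifP => // _ y; rewrite mem_rcons inE => /orP[/eqP->|]; last exact: ga.
by apply: gs; rewrite inE eqxx.
Qed.

Lemma pool_is_ok : pool_ok conj_form (unzip2 (pool L gens)).
Proof.
move=> i; rewrite size_map => hi; rewrite (nth_map (0%N, [::])) //.
by have [] := good_pool (mem_nth (0%N, [::]) hi).
Qed.

Lemma reflection_arrangement_lines : all (mem (unzip1 (pool L gens))) (iota 0 N) ->
  reflection_arrangement [set invmx P *m g *m P | g in generated_group S]%classic =
  range (fun j => form_kernel (conj_form j)).
Proof.
move=> allk; apply: reflection_arrangement_conj => //.
- exact: line_form_neq0.
- by move=> i j; exact: (line_form_inj).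
- move=> s /genS[i hi ->]; have [p [lam [wp _]]] := gen_permutes hi.
  have [j [_ gu _ gf]] := gen_line hi.
  exact: (det_permutes_reflection line_form_neq0 (line_form_inj) gu wp gf).
move=> j; have /mapP[x xin jx] : (j : nat) \in unzip1 (pool L gens).
  by apply: (allP allk); rewrite mem_iota add0n ltn_ord.
have [[i [xi [w ww]]] _] := good_pool xin; exists w.
by have <- : i = j by apply: val_inj; rewrite /= -xi jx.
Qed.

End Lines.


Section Criterion.
Context {C : numClosedFieldType} {R : ring_ops} (e : embedding (C := C) R).
Context {n : nat} (P : 'M[C]_n) (S W : set 'M[C]_n).
Variables (gens : seq (generator R)) (g0 : generator R).

(** The choice of P in the conjugation does not matter: the forms change, but their
    values on the rows of P are those computed. *)
Theorem gens_verdict_simplicial ts top b :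
    P \in unitmx ->
    (forall s, S s <-> exists2 i, (i < size gens)%N & s = gen_mx e (nth g0 gens i)) ->
    W = [set invmx P *m g *m P | g in generated_group S]%classic ->
    gens_verdict n gens ts top = Some b ->
  simplicial (reflection_arrangement W) <-> b.
Proof.
move=> Pu gS ->; rewrite /gens_verdict; set L := all_lines gens.
case: ifP => // /and5P[okL okG okP hz /eqP st].
case ets: run_types => [env|] //; case et: run_type => [[M l]|] // [<-].
have c0 := conj_form_neq0 e Pu okL.
have plok := pool_is_ok Pu okL okG gS.
have [cap0 eqn] := verdict_ok c0 (represents_lines e Pu okL) plok ets et hz st.
have arr := reflection_arrangement_lines Pu okL okG gS okP.
have hyp j : is_hyperplane fullv (form_kernel (conj_form e P (L := L) j)).
  exact: form_kernel_hyperplane.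
have [s1 s2] := simplicial_flag_sum hyp (conj_form_inj Pu okL) arr.
have dimn : \dim {: 'rV[C]_n} = n by rewrite dimvf /dim /= mul1n.
rewrite dimn in s1 s2.
split=> [/s1[_ E]|bT]; first exact/eqn.
by apply: s2; split=> //; apply/eqn.
Qed.

End Criterion.

(** * The models of the Shephard-Todd groups *)
Section ShephardToddCriterion.
Context {C : numClosedFieldType} {R : ring_ops} (e : embedding (C := C) R).
Variables (i : nat) (B : nat -> nat -> R) (refs : seq (reflection_data R)).
Local Notation n := (st_rank i).

Hypothesis formB : forall j k : 'I_n, e (B j k) = (st_data C i).1 j k.
Hypothesis rootsE : (st_data C i).2 =
  [seq (e (eigenvalue r), [seq e x | x <- root r]) | r <- refs].
Hypothesis size_roots : all (fun r => size (root r) == n) refs.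

Lemma gen_mx_root_reflection r : size (root r) = n ->
  gen_mx e (generator_of n B r) =
    root_reflection (st_form C i) (e (eigenvalue r)) (\row_j [seq e x | x <- root r]`_j).
Proof.
move=> sr; set a := \row_j _.
have aE : row_of e (root r) = a.
  by apply/rowP => j; rewrite !mxE (nth_map (rzero R)) ?sr.
have bE : col_of e (gen_form (generator_of n B r)) = st_form C i *m map_mx Num.conj a^T.
  apply/colP => j; rewrite !mxE nth_mkseq // e_dot_sum ?size_map ?size_iota ?sr //.
  rewrite big_mkord; apply: eq_bigr => k _; rewrite !mxE -formB nth_mkseq //.
  by rewrite !(nth_map (rzero R)) ?sr // evJ.
have dE : e (dot (root r) (gen_form (generator_of n B r))) =
    (a *m (st_form C i *m map_mx Num.conj a^T)) 0 0.
  by rewrite (@e_dot C R e n) ?aE ?bE // size_mkseq.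
by rewrite /gen_mx /root_reflection dE bE /= aE evB evZ.
Qed.

Theorem verdict_simplicial ts top b (W : set 'M[C]_n) :
    verdict n B refs ts top = Some b -> is_shephard_todd W ->
  simplicial (reflection_arrangement W) <-> b.
Proof.
move=> vb [P Pu WE]; pose r0 := @ReflectionData R (rzero R) [::] Z0 (rzero R).
apply: (gens_verdict_simplicial (e := e) (g0 := generator_of n B r0) Pu _ WE vb) => s.
rewrite size_map; split=> [[za]|[k kr ->]].
  rewrite rootsE => /(nthP (0, [::]))[k]; rewrite size_map => kr <- ->; exists k => //.
  rewrite (nth_map r0 (generator_of n B r0)) // gen_mx_root_reflection.
    by rewrite (nth_map r0).
  exact/eqP/(all_nthP r0 size_roots).
rewrite (nth_map r0) // gen_mx_root_reflection; last exact/eqP/(all_nthP r0 size_roots).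
exists (e (eigenvalue (nth r0 refs k)), [seq e x | x <- root (nth r0 refs k)]) => //.
by rewrite rootsE; apply/(nthP (0, [::])); exists k; rewrite ?size_map // (nth_map r0).
Qed.

End ShephardToddCriterion.

Section FormsAndRoots.
Variable R : ring_ops.

Definition delta_form (i j : nat) : R := rofZ R (if i == j then Zpos xH else Z0).

(** The Coxeter form with entries in R; b m stands for 2 cos (pi / m). *)
Definition cox_form (b : nat -> R) (D : seq (nat * nat * nat)) (i j : nat) : R :=
  if i == j then rofZ R (Zpos (xO xH)) else
  foldr (fun x s => if (x.1 == (i, j)) || (x.1 == (j, i)) then rsub s (b x.2) else s) (rzero R) D.

Definition cox_reflections n : seq (reflection_data R) :=
  [seq ReflectionData (rofZ R (Zneg xH)) (mkseq (fun j => delta_form j k) n) (Zpos (xO xH))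
     (rofZ R (Zpos xH)) | k <- iota 0 n].

Context {C : numClosedFieldType} (e : embedding (C := C) R).

Lemma delta_formE i j : e (delta_form i j) = (i == j)%:R.
Proof. by rewrite evZ; case: (i == j). Qed.

Lemma cox_formE b D i j : (forall x, x \in D -> e (b x.2) = two_cos_pi_div C x.2) ->
  e (cox_form b D i j) = coxeter_form C D i j.
Proof.
rewrite /cox_form /coxeter_form; case: ifP => _; first by rewrite evZ.
elim: D => [|x D IH] bD /=; first by rewrite big_nil ev0 oppr0.
have {}IH := IH (fun y yD => bD y (mem_behead (yD : y \in behead (x :: D)))).
rewrite big_cons; case: ifP => // _.
by rewrite evB IH bD ?mem_head // opprD addrC.
Qed.

Lemma cox_rootsE n :
  [seq (-1 : C, mkseq (fun j => (j == k)%:R) n) | k <- iota 0 n] =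
  [seq (e (eigenvalue r), [seq e x | x <- root r]) | r <- cox_reflections n].
Proof.
rewrite -map_comp; apply: eq_map => k /=; rewrite evZ -map_comp; congr (_, _).
by apply: eq_map => j /=; rewrite delta_formE.
Qed.

Lemma size_cox_roots n : all (fun r => size (root r) == n) (cox_reflections n).
Proof. by rewrite all_map; apply/allP => k _ /=; rewrite size_mkseq. Qed.

End FormsAndRoots.

Section Constants.
Context {C : numClosedFieldType}.

Definition Z_golden := quad_ops Zops (Zpos xH) (Zpos xH) true.
Definition Z_sqrt2 := quad_ops Zops Z0 (Zpos (xO xH)) true.
Definition Z_lambda7 := quad_ops Zops (Zneg xH) (Zneg (xO xH)) false.
Definition Z_omega := quad_ops Zops (Zneg xH) (Zneg xH) false.
Definition Z_i := quad_ops Zops Z0 (Zneg xH) false.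
Definition Z_golden_omega := quad_ops Z_golden (Zneg xH) (Zneg xH) false.

Lemma sqrtC_nat_conj k : (sqrtC (k%:R : C))^* = sqrtC k%:R.
Proof. by apply: conj_Creal; rewrite ger0_real // sqrtC_ge0 ler0n. Qed.

Lemma golden_sqr : golden C ^+ 2 = golden C + 1.
Proof.
have s5 : sqrtC 5 ^+ 2 = 5 :> C by rewrite sqrtCK.
have -> : golden C ^+ 2 = (1 + 2 * sqrtC 5 + sqrtC 5 ^+ 2) / 4 by rewrite /golden; field.
by rewrite s5 /golden; field.
Qed.

Lemma golden_conj : (golden C)^* = golden C.
Proof. by rewrite /golden fmorph_div rmorphD /= rmorph1 rmorph_nat sqrtC_nat_conj. Qed.

Lemma golden_inv : (golden C)^-1 = golden C - 1.
Proof.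
have E : golden C * (golden C - 1) = 1 by rewrite mulrBr mulr1 -expr2 golden_sqr addrAC subrr add0r.
have g0 : golden C != 0 by apply: contra_eq_neq E => ->; rewrite mul0r eq_sym oner_eq0.
by apply: (mulfI g0); rewrite E mulfV.
Qed.

Lemma i_sqrt_sqr k : ('i * sqrtC k%:R) ^+ 2 = - k%:R :> C.
Proof. by rewrite exprMn sqrCi sqrtCK mulN1r. Qed.

Lemma i_sqrt_conj k : ('i * sqrtC k%:R)^* = - ('i * sqrtC k%:R) :> C.
Proof. by rewrite rmorphM /= conjCi sqrtC_nat_conj mulNr. Qed.

Lemma omega_sqr : omega C ^+ 2 = - omega C - 1.
Proof.
have -> : omega C ^+ 2 = (1 - 2 * ('i * sqrtC 3) + ('i * sqrtC 3) ^+ 2) / 4 by rewrite /omega; field.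
by rewrite i_sqrt_sqr /omega; field.
Qed.

Lemma omega_conj : (omega C)^* = -1 - omega C.
Proof.
rewrite /omega fmorph_div rmorphD /= rmorphN1 rmorph_nat i_sqrt_conj; by field.
Qed.

Lemma lambda7_sqr : lambda7 C ^+ 2 = - lambda7 C - 2.
Proof.
have -> : lambda7 C ^+ 2 = (1 - 2 * ('i * sqrtC 7) + ('i * sqrtC 7) ^+ 2) / 4 by rewrite /lambda7; field.
by rewrite i_sqrt_sqr /lambda7; field.
Qed.

Lemma lambda7_conj : (lambda7 C)^* = -1 - lambda7 C.
Proof.
rewrite /lambda7 fmorph_div rmorphD /= rmorphN1 rmorph_nat i_sqrt_conj; by field.
Qed.

Lemma intZ0 : (int_of_Z Z0)%:~R = 0 :> C. Proof. by []. Qed.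
Lemma intZ1 : (int_of_Z (Zpos xH))%:~R = 1 :> C. Proof. by []. Qed.
Lemma intZ2 : (int_of_Z (Zpos (xO xH)))%:~R = 2 :> C. Proof. by []. Qed.
Lemma intZN1 : (int_of_Z (Zneg xH))%:~R = -1 :> C. Proof. by []. Qed.
Lemma intZN2 : (int_of_Z (Zneg (xO xH)))%:~R = -2 :> C. Proof. by []. Qed.
Definition intZE := (intZ0, intZ1, intZ2, intZN1, intZN2).

Lemma Z_embE m : @Z_embedding C m = (int_of_Z m)%:~R. Proof. by []. Qed.

Lemma golden_embedding :
  { f : @embedding C Z_golden | forall x, f x = Z_embedding x.1 + Z_embedding x.2 * golden C }.
Proof. by apply: quad_embedding; rewrite ?golden_conj // golden_sqr !intZE mul1r. Qed.

Lemma sqrt2_embedding :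
  { f : @embedding C Z_sqrt2 | forall x, f x = Z_embedding x.1 + Z_embedding x.2 * sqrtC 2 }.
Proof. by apply: quad_embedding; rewrite ?sqrtC_nat_conj // sqrtCK !intZE mul0r add0r. Qed.

Lemma lambda7_embedding :
  { f : @embedding C Z_lambda7 | forall x, f x = Z_embedding x.1 + Z_embedding x.2 * lambda7 C }.
Proof. by apply: quad_embedding; rewrite ?lambda7_conj ?lambda7_sqr !intZE ?mulN1r. Qed.

Lemma omega_embedding :
  { f : @embedding C Z_omega | forall x, f x = Z_embedding x.1 + Z_embedding x.2 * omega C }.
Proof. by apply: quad_embedding; rewrite ?omega_conj ?omega_sqr !intZE ?mulN1r. Qed.

Lemma i_embedding :
  { f : @embedding C Z_i | forall x, f x = Z_embedding x.1 + Z_embedding x.2 * 'i }.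
Proof. by apply: quad_embedding; rewrite ?conjCi ?sqrCi !intZE ?mul0r ?add0r ?sub0r. Qed.

Lemma golden_omega_embedding :
  { f : @embedding C Z_golden_omega |
  forall x, f x = sval golden_embedding x.1 + sval golden_embedding x.2 * omega C }.
Proof. by apply: quad_embedding; rewrite ?omega_conj ?omega_sqr !intZE ?mulN1r. Qed.

End Constants.

(** Splits an equation between explicit lists of pairs and lists into equations
    between numbers. *)
Ltac match_lists := repeat match goal with
  | |- _ :: _ = _ :: _ => congr cons
  | |- (_, _) = (_, _) => congr pair
  | |- [::] = [::] => reflexivity
  end.

(** * Certificates for the fifteen groups *)

Local Open Scope Z_scope.
(** For each group: eigenvalue, root, norm of the root and scaling factor of the
    generating reflections. *)
Definition reflections24 := [::
  ReflectionData (R := Z_lambda7) ((-1),0) [:: (2,0); (0,0); (0,0)] 4 (1,0);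
  ReflectionData (R := Z_lambda7) ((-1),0) [:: (0,1); (0,1); (0,0)] 4 (1,0);
  ReflectionData (R := Z_lambda7) ((-1),0) [:: ((-1),(-1)); (1,0); (1,0)] 4 (1,0)].

Definition reflections25 := [::
  ReflectionData (R := Z_omega) (0,1) [:: (1,0); (0,0); (0,0)] 1 ((-1),1);
  ReflectionData (R := Z_omega) (0,1) [:: (1,0); (1,0); (1,0)] 3 (1,0);
  ReflectionData (R := Z_omega) (0,1) [:: (0,0); (1,0); (0,0)] 1 ((-1),1)].

Definition reflections26 := [::
  ReflectionData (R := Z_omega) ((-1),0) [:: (1,0); ((-1),0); (0,0)] 2 (1,0);
  ReflectionData (R := Z_omega) (0,1) [:: (1,0); (0,0); (0,0)] 1 ((-1),1);
  ReflectionData (R := Z_omega) (0,1) [:: (1,0); (1,0); (1,0)] 3 (1,0)].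

Definition reflections27 := [::
  ReflectionData (R := Z_golden_omega) (((-1),0),(0,0)) [:: ((2,0),(0,0)); ((0,0),(0,0));
    ((0,0),(0,0))] 4 ((1,0),(0,0));
  ReflectionData (R := Z_golden_omega) (((-1),0),(0,0)) [:: ((0,1),(0,0)); (((-1),1),(0,0));
    ((1,0),(0,0))] 4 ((1,0),(0,0));
  ReflectionData (R := Z_golden_omega) (((-1),0),(0,0)) [:: ((1,0),(0,0)); ((0,0),((-1),1));
    ((0,(-1)),(0,(-1)))] 4 ((1,0),(0,0))].

Definition reflections29 := [::
  ReflectionData (R := Z_i) ((-1),0) [:: (1,0); ((-1),0); (0,0); (0,0)] 2 (1,1);
  ReflectionData (R := Z_i) ((-1),0) [:: (0,0); (1,0); ((-1),0); (0,0)] 2 (1,1);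
  ReflectionData (R := Z_i) ((-1),0) [:: (0,0); (1,0); (0,(-1)); (0,0)] 2 (1,1);
  ReflectionData (R := Z_i) ((-1),0) [:: (1,0); (1,0); (1,0); (1,0)] 4 (1,0)].

Definition reflections31 := [::
  ReflectionData (R := Z_i) ((-1),0) [:: (1,0); ((-1),0); (0,0); (0,0)] 2 (1,1);
  ReflectionData (R := Z_i) ((-1),0) [:: (0,0); (1,0); ((-1),0); (0,0)] 2 (1,1);
  ReflectionData (R := Z_i) ((-1),0) [:: (0,0); (1,0); (0,(-1)); (0,0)] 2 (1,1);
  ReflectionData (R := Z_i) ((-1),0) [:: (1,0); (1,0); (1,0); (1,0)] 4 (1,0);
  ReflectionData (R := Z_i) ((-1),0) [:: (1,0); (0,0); (0,0); (0,0)] 1 (2,0)].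

Definition reflections32 := [::
  ReflectionData (R := Z_omega) (0,1) [:: (1,0); (0,0); (0,0); (0,0)] 1 ((-1),1);
  ReflectionData (R := Z_omega) (0,1) [:: (1,0); (1,0); (1,0); (0,0)] 3 (1,0);
  ReflectionData (R := Z_omega) (0,1) [:: (0,0); (1,0); (0,0); (0,0)] 1 ((-1),1);
  ReflectionData (R := Z_omega) (0,1) [:: (0,0); (1,0); ((-1),0); (1,0)] 3 (1,0)].

Definition reflections33 := [::
  ReflectionData (R := Z_omega) ((-1),0) [:: (1,0); (1,0); (1,0); (1,0); (1,0)] 6 (1,0);
  ReflectionData (R := Z_omega) ((-1),0) [:: (1,0); (0,(-1)); (0,0); (0,0); (0,0)] 2 ((-1),1);
  ReflectionData (R := Z_omega) ((-1),0) [:: (1,0); ((-1),0); (0,0); (0,0); (0,0)] 2 ((-1),1);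
  ReflectionData (R := Z_omega) ((-1),0) [:: (0,0); (1,0); ((-1),0); (0,0); (0,0)] 2 ((-1),1);
  ReflectionData (R := Z_omega) ((-1),0) [:: (0,0); (0,0); (1,0); ((-1),0); (0,0)] 2 ((-1),1)].

Definition reflections34 := [::
  ReflectionData (R := Z_omega) ((-1),0) [:: (1,0); (1,0); (1,0); (1,0); (1,0); (1,0)] 6 (1,0);
  ReflectionData (R := Z_omega) ((-1),0) [:: (1,0); (0,(-1)); (0,0); (0,0); (0,0); (0,0)] 2
    ((-1),1);
  ReflectionData (R := Z_omega) ((-1),0) [:: (1,0); ((-1),0); (0,0); (0,0); (0,0); (0,0)] 2
    ((-1),1);
  ReflectionData (R := Z_omega) ((-1),0) [:: (0,0); (1,0); ((-1),0); (0,0); (0,0); (0,0)] 2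
    ((-1),1);
  ReflectionData (R := Z_omega) ((-1),0) [:: (0,0); (0,0); (1,0); ((-1),0); (0,0); (0,0)] 2
    ((-1),1);
  ReflectionData (R := Z_omega) ((-1),0) [:: (0,0); (0,0); (0,0); (1,0); ((-1),0); (0,0)] 2
    ((-1),1)].

Local Close Scope Z_scope.
Local Open Scope nat_scope.

(** For each group: representatives of the orbits of flats, from 0 upwards, and the
    whole space. *)
Definition flats23 : seq flat_type := [::
  FlatType [:: 0; 1; 2] [::] [::];
  FlatType [:: 0; 5] [:: 0; 5] [:: (1, [::])];
  FlatType [:: 0; 2] [:: 0; 2] [:: (1, [::])];
  FlatType [:: 0; 1] [:: 0; 1] [:: (2, [::])];
  FlatType [:: 0] [:: 0; 2] [:: (1, [::]); (2, [::]); (5, [::]); (14, [:: 1; 10])]].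
Definition top23 := FlatType [::] [:: 0; 1; 2] [:: (0, [::])].
Definition flats24 : seq flat_type := [::
  FlatType [:: 0; 1; 2] [::] [::];
  FlatType [:: 0; 6] [:: 0; 6] [:: (1, [::])];
  FlatType [:: 0; 1] [:: 0; 1] [:: (2, [::])];
  FlatType [:: 0] [:: 0; 3; 4] [:: (1, [::]); (2, [:: 8; 9]); (6, [::])]].
Definition top24 := FlatType [::] [:: 0; 1; 2] [:: (0, [::])].
Definition flats25 : seq flat_type := [::
  FlatType [:: 0; 1; 2] [::] [::];
  FlatType [:: 0; 2] [:: 0; 2] [:: (1, [::])];
  FlatType [:: 0; 1] [:: 0; 1] [:: (2, [::])];
  FlatType [:: 0] [:: 0; 2] [:: (1, [::]); (2, [::]); (11, [:: 1; 3])]].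
Definition top25 := FlatType [::] [:: 0; 1; 2] [:: (0, [::])].
Definition flats26 : seq flat_type := [::
  FlatType [:: 0; 1; 2] [::] [::];
  FlatType [:: 1; 2] [:: 1; 2] [:: (0, [::])];
  FlatType [:: 0; 2] [:: 0; 2] [:: (1, [::])];
  FlatType [:: 0; 1] [:: 0; 1] [:: (2, [::])];
  FlatType [:: 1] [:: 1; 4; 8] [:: (0, [::]); (2, [::]); (8, [:: 5])];
  FlatType [:: 0] [:: 0; 2; 14] [:: (1, [::]); (2, [::])]].
Definition top26 := FlatType [::] [:: 0; 1; 2] [:: (0, [::]); (1, [::])].
Definition flats27 : seq flat_type := [::
  FlatType [:: 0; 1; 2] [::] [::];
  FlatType [:: 0; 7] [:: 0; 7] [:: (1, [::])];
  FlatType [:: 0; 6] [:: 0; 6] [:: (1, [::])];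
  FlatType [:: 0; 2] [:: 0; 2] [:: (1, [::])];
  FlatType [:: 0; 1] [:: 0; 1] [:: (2, [::])];
  FlatType [:: 0] [:: 0; 18; 34] [:: (1, [::]); (2, [::]); (6, [::]); (7, [::]); (9, [:: 1; 41])]].
Definition top27 := FlatType [::] [:: 0; 1; 2] [:: (0, [::])].
Definition flats28 : seq flat_type := [::
  FlatType [:: 0; 1; 2; 3] [::] [::];
  FlatType [:: 0; 2; 11] [:: 0; 2; 11] [:: (1, [::])];
  FlatType [:: 0; 2; 3] [:: 0; 2; 3] [:: (1, [::])];
  FlatType [:: 0; 1; 3] [:: 0; 1; 3] [:: (2, [::])];
  FlatType [:: 0; 1; 2] [:: 0; 1; 2] [:: (3, [::])];
  FlatType [:: 2; 3] [:: 0; 2; 3; 20] [:: (0, [::]); (1, [:: 13])];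
  FlatType [:: 0; 6] [:: 0; 2; 6; 16] [:: (1, [::]); (3, [:: 7])];
  FlatType [:: 0; 2] [:: 0; 2; 12] [:: (1, [::]); (3, [::]); (9, [:: 7]); (11, [::])];
  FlatType [:: 0; 1] [:: 0; 1; 3; 21] [:: (2, [::]); (3, [::])];
  FlatType [:: 2] [:: 0; 2; 6; 9] [:: (0, [::]); (1, [:: 4]); (3, [::])];
  FlatType [:: 0] [:: 0; 2; 3; 12] [:: (1, [::]); (2, [::]); (6, [::])]].
Definition top28 := FlatType [::] [:: 0; 1; 2; 3] [:: (0, [::]); (2, [::])].
Definition flats29 : seq flat_type := [::
  FlatType [:: 0; 1; 2; 3] [::] [::];
  FlatType [:: 0; 1; 25] [:: 0; 1; 25] [:: (2, [::])];
  FlatType [:: 0; 1; 22] [:: 0; 1; 22] [:: (2, [::])];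
  FlatType [:: 0; 1; 21] [:: 0; 1; 3; 21] [:: (2, [::])];
  FlatType [:: 0; 1; 3] [:: 0; 1; 3] [:: (2, [::])];
  FlatType [:: 0; 1; 2] [:: 0; 1; 2] [:: (3, [::])];
  FlatType [:: 0; 9] [:: 0; 9; 23; 24] [:: (1, [::]); (3, [:: 2; 27]); (8, [:: 31])];
  FlatType [:: 0; 3] [:: 0; 3; 32] [:: (1, [::]); (2, [:: 6; 14]); (6, [:: 18]); (7, [:: 2; 10]);
    (9, [:: 2; 27]); (22, [:: 2; 11])];
  FlatType [:: 0; 1] [:: 0; 1; 3] [:: (2, [::]); (3, [::]); (21, [::]); (22, [::]); (25, [::])];
  FlatType [:: 0] [:: 0; 3; 18; 22] [:: (1, [::]); (3, [::]); (9, [::])]].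
Definition top29 := FlatType [::] [:: 0; 1; 2; 3] [:: (0, [::])].
Definition flats30 : seq flat_type := [::
  FlatType [:: 0; 1; 2; 3] [::] [::];
  FlatType [:: 0; 2; 3] [:: 0; 2; 3] [:: (1, [::])];
  FlatType [:: 0; 1; 7] [:: 0; 1; 7] [:: (2, [::])];
  FlatType [:: 0; 1; 3] [:: 0; 1; 3] [:: (2, [::])];
  FlatType [:: 0; 1; 2] [:: 0; 1; 2] [:: (3, [::])];
  FlatType [:: 0; 11] [:: 0; 2; 11; 37] [:: (1, [::]); (2, [:: 1; 8])];
  FlatType [:: 0; 2] [:: 0; 2; 44] [:: (1, [::]); (3, [::]); (9, [:: 6]); (11, [:: 1; 8]); (14,
    [:: 33]); (18, [:: 10]); (33, [:: 5; 19])];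
  FlatType [:: 0; 1] [:: 0; 1; 3; 55] [:: (2, [::]); (3, [::]); (7, [::])];
  FlatType [:: 0] [:: 0; 2; 3; 33] [:: (1, [::]); (2, [::]); (11, [::])]].
Definition top30 := FlatType [::] [:: 0; 1; 2; 3] [:: (0, [::])].
Definition flats31 : seq flat_type := [::
  FlatType [:: 0; 1; 2; 3] [::] [::];
  FlatType [:: 0; 1; 27] [:: 0; 1; 27] [:: (2, [::])];
  FlatType [:: 0; 1; 3] [:: 0; 1; 3] [:: (2, [::])];
  FlatType [:: 0; 1; 2] [:: 0; 1; 2; 4] [:: (3, [::])];
  FlatType [:: 0; 4] [:: 0; 4; 13; 18; 23] [:: (1, [::]); (3, [:: 10; 27]); (10, [:: 3; 37])];
  FlatType [:: 0; 3] [:: 0; 3; 36] [:: (1, [::]); (2, [:: 4; 13]); (4, [:: 10; 27]); (8, [:: 34]);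
    (9, [:: 11; 26]); (21, [:: 7; 40]); (23, [:: 2; 4; 40; 28]); (38, [:: 2; 16])];
  FlatType [:: 0; 1] [:: 0; 1; 3; 48] [:: (2, [::]); (3, [::]); (27, [::])];
  FlatType [:: 0] [:: 0; 3; 7; 23; 37] [:: (1, [::]); (3, [::]); (4, [::])]].
Definition top31 := FlatType [::] [:: 0; 1; 2; 3; 4] [:: (0, [::])].
Definition flats32 : seq flat_type := [::
  FlatType [:: 0; 1; 2; 3] [::] [::];
  FlatType [:: 0; 1; 3] [:: 0; 1; 3] [:: (2, [::])];
  FlatType [:: 0; 1; 2] [:: 0; 1; 2] [:: (3, [::])];
  FlatType [:: 0; 2] [:: 0; 2; 22] [:: (1, [::]); (3, [:: 7; 20]); (12, [:: 8]); (14, [:: 3; 8])];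
  FlatType [:: 0; 1] [:: 0; 1; 3; 35] [:: (2, [::]); (3, [::])];
  FlatType [:: 0] [:: 0; 2; 3; 22] [:: (1, [::]); (2, [::])]].
Definition top32 := FlatType [::] [:: 0; 1; 2; 3] [:: (0, [::])].
Definition flats33 : seq flat_type := [::
  FlatType [:: 0; 1; 2; 3; 4] [::] [::];
  FlatType [:: 0; 1; 2; 35] [:: 0; 1; 2; 4; 35] [:: (3, [::])];
  FlatType [:: 0; 1; 2; 28] [:: 0; 1; 2; 28] [:: (3, [::])];
  FlatType [:: 0; 1; 2; 4] [:: 0; 1; 2; 4] [:: (3, [::])];
  FlatType [:: 0; 1; 2; 3] [:: 0; 1; 2; 3] [:: (4, [::])];
  FlatType [:: 0; 2; 4] [:: 0; 2; 4; 40] [:: (1, [::]); (3, [:: 24; 30; 32]); (7, [:: 3; 42]);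
    (12, [:: 3; 38]); (24, [:: 3; 16; 40])];
  FlatType [:: 0; 1; 12] [:: 0; 1; 12] [:: (2, [::]); (4, [:: 9; 38]); (9, [:: 4; 42]); (16, [::
    4; 43])];
  FlatType [:: 0; 1; 4] [:: 0; 1; 4] [:: (2, [::]); (3, [:: 20; 27]); (8, [:: 12; 24]); (12, [::
    9; 38]); (28, [:: 43]); (35, [:: 12; 24; 43]); (39, [:: 12; 18; 42])];
  FlatType [:: 0; 1; 2] [:: 0; 1; 2; 4] [:: (3, [::]); (4, [::]); (28, [::]); (35, [::])];
  FlatType [:: 0; 2] [:: 0; 2; 4; 40] [:: (1, [::]); (3, [:: 7; 19; 35]); (4, [::]); (7, [:: 12;
    22]); (12, [:: 7; 18]); (24, [:: 3; 16; 44]); (40, [:: 7; 18]); (44, [:: 12; 22])];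
  FlatType [:: 0; 1] [:: 0; 1; 4; 42] [:: (2, [::]); (3, [:: 12; 18]); (4, [::]); (8, [:: 12;
    24]); (12, [::])];
  FlatType [:: 0] [:: 0; 2; 3; 4; 37] [:: (1, [::]); (2, [::])]].
Definition top33 := FlatType [::] [:: 0; 1; 2; 3; 4] [:: (0, [::])].
Definition flats34 : seq flat_type := [::
  FlatType [:: 0; 1; 2; 3; 4; 5] [::] [::];
  FlatType [:: 0; 1; 2; 4; 87] [:: 0; 1; 2; 4; 87] [:: (3, [::])];
  FlatType [:: 0; 1; 2; 4; 60] [:: 0; 1; 2; 4; 60] [:: (3, [::])];
  FlatType [:: 0; 1; 2; 4; 48] [:: 0; 1; 2; 4; 48] [:: (3, [::])];
  FlatType [:: 0; 1; 2; 4; 45] [:: 0; 1; 2; 4; 45] [:: (3, [::])];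
  FlatType [:: 0; 1; 2; 4; 5] [:: 0; 1; 2; 4; 5] [:: (3, [::])];
  FlatType [:: 0; 1; 2; 3; 55] [:: 0; 1; 2; 3; 55] [:: (4, [::])];
  FlatType [:: 0; 1; 2; 3; 5] [:: 0; 1; 2; 3; 5] [:: (4, [::])];
  FlatType [:: 0; 1; 2; 3; 4] [:: 0; 1; 2; 3; 4] [:: (5, [::])];
  FlatType [:: 0; 1; 4; 87] [:: 0; 1; 4; 87] [:: (2, [::]); (3, [:: 34; 50]); (5, [:: 3; 16; 33]);
    (9, [:: 89; 99]); (14, [:: 10; 56]); (19, [:: 14; 29; 67]); (34, [:: 11; 72; 112]); (35, [::
    101]); (45, [:: 76; 124]); (59, [:: 14; 21; 64]); (71, [:: 78; 104]); (76, [:: 9; 27; 125;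
    47]); (78, [:: 3; 23; 96; 58]); (93, [:: 5; 90])];
  FlatType [:: 0; 1; 4; 34] [:: 0; 1; 4; 34] [:: (2, [:: 11]); (3, [:: 76]); (5, [:: 10; 56]); (9,
    [:: 5; 67]); (35, [:: 10; 122]); (49, [:: 64; 78]); (59, [:: 67; 76]); (87, [:: 11; 72;
    112])];
  FlatType [:: 0; 1; 4; 5] [:: 0; 1; 4; 5] [:: (2, [::]); (3, [:: 34; 44]); (9, [:: 34; 50]); (14,
    [:: 10; 56]); (35, [:: 18; 19]); (49, [:: 3; 28; 88]); (59, [:: 9; 19; 82]); (85, [:: 3; 16;
    33]); (92, [:: 87; 101]); (93, [:: 87; 125]); (101, [:: 9; 27; 47]); (109, [:: 64; 84]); (112,
    [:: 64; 78]); (123, [:: 49; 63; 82])];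
  FlatType [:: 0; 1; 2; 49] [:: 0; 1; 2; 4; 49] [:: (3, [::]); (5, [:: 11]); (19, [:: 5; 123]);
    (45, [:: 5; 38; 116]); (48, [:: 5; 35; 113])];
  FlatType [:: 0; 1; 2; 35] [:: 0; 1; 2; 35; 125] [:: (3, [::]); (5, [:: 11]); (11, [:: 5]); (19,
    [:: 4; 11]); (60, [:: 38; 116]); (125, [:: 5; 123])];
  FlatType [:: 0; 1; 2; 4] [:: 0; 1; 2; 4; 125] [:: (3, [::]); (5, [::]); (19, [:: 11]); (45,
    [::]); (48, [::]); (60, [::]); (87, [::])];
  FlatType [:: 0; 1; 2; 3] [:: 0; 1; 2; 3; 5; 124] [:: (4, [::]); (5, [::]); (55, [::])];
  FlatType [:: 0; 2; 4] [:: 0; 2; 4; 61; 70] [:: (1, [::]); (3, [:: 29; 38; 42]); (5, [:: 8; 19;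
    22]); (8, [:: 3; 64]); (14, [:: 3; 56]); (19, [:: 7; 62; 116]); (25, [:: 34; 47]); (29, [:: 3;
    18; 61]); (34, [:: 25; 44]); (45, [:: 65; 84]); (48, [:: 68; 86]); (50, [:: 70; 95]); (60, [::
    5; 82]); (65, [:: 45; 66]); (68, [:: 48; 69])];
  FlatType [:: 0; 1; 14] [:: 0; 1; 5; 14; 84; 85] [:: (2, [::]); (4, [:: 10; 56]); (5, [:: 11]);
    (10, [:: 4; 64]); (18, [:: 4; 67])];
  FlatType [:: 0; 1; 4] [:: 0; 1; 4; 87; 101] [:: (2, [::]); (3, [:: 23; 32]); (5, [::]); (9, [::
    14; 29]); (14, [:: 10; 56]); (19, [:: 34; 44]); (28, [:: 34; 50]); (34, [::]); (35, [:: 67]);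
    (87, [::])];
  FlatType [:: 0; 1; 2] [:: 0; 1; 2; 4; 5; 123] [:: (3, [::]); (4, [::]); (35, [::]); (49, [::])];
  FlatType [:: 0; 2] [:: 0; 2; 4; 5; 61; 70] [:: (1, [::]); (3, [:: 8; 22; 49]); (4, [::]); (8,
    [:: 14; 26]); (14, [:: 8; 21]); (29, [:: 3; 18; 70])];
  FlatType [:: 0; 1] [:: 0; 1; 4; 5; 64; 85] [:: (2, [::]); (4, [::]); (14, [::])];
  FlatType [:: 0] [:: 0; 2; 3; 4; 5; 53] [:: (1, [::]); (2, [::])]].
Definition top34 := FlatType [::] [:: 0; 1; 2; 3; 4; 5] [:: (0, [::])].
Definition flats35 : seq flat_type := [::
  FlatType [:: 0; 1; 2; 3; 4; 5] [::] [::];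
  FlatType [:: 0; 1; 2; 4; 5] [:: 0; 1; 2; 4; 5] [:: (3, [::])];
  FlatType [:: 0; 1; 2; 3; 30] [:: 0; 1; 2; 3; 5] [:: (4, [::])];
  FlatType [:: 0; 1; 2; 3; 5] [:: 0; 1; 2; 3; 5] [:: (4, [::])];
  FlatType [:: 0; 1; 2; 3; 4] [:: 0; 1; 2; 3; 4] [:: (5, [::])];
  FlatType [:: 0; 1; 4; 8] [:: 0; 1; 4; 8] [:: (2, [::]); (5, [:: 15; 35]); (15, [:: 5; 33])];
  FlatType [:: 0; 1; 2; 34] [:: 0; 1; 2; 4; 5; 34] [:: (3, [::]); (4, [:: 3; 13; 28])];
  FlatType [:: 0; 1; 2; 23] [:: 0; 1; 2; 4; 23] [:: (3, [::]); (5, [:: 9; 19; 33]); (15, [:: 10])];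
  FlatType [:: 0; 1; 2; 4] [:: 0; 1; 2; 4] [:: (3, [::]); (5, [::]); (15, [:: 10]); (27, [:: 9;
    19; 35]); (34, [:: 3; 13; 28])];
  FlatType [:: 0; 1; 2; 3] [:: 0; 1; 2; 3; 5] [:: (4, [::]); (5, [::]); (30, [::])];
  FlatType [:: 0; 1; 8] [:: 0; 1; 5; 8; 33] [:: (2, [::]); (4, [::]); (5, [:: 9; 19; 31]); (9, [::
    4; 28]); (33, [:: 3; 10; 35])];
  FlatType [:: 0; 1; 4] [:: 0; 1; 4; 28] [:: (2, [::]); (3, [:: 8; 16]); (5, [:: 27; 28; 32]); (8,
    [::]); (15, [:: 20; 26]); (20, [:: 3; 5; 33; 19]); (27, [:: 5; 33])];
  FlatType [:: 0; 1; 2] [:: 0; 1; 2; 4; 5] [:: (3, [::]); (4, [::]); (23, [::]); (34, [::])];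
  FlatType [:: 0; 2] [:: 0; 1; 2; 4; 5; 34] [:: (1, [::]); (3, [:: 7]); (4, [:: 3; 13; 28])];
  FlatType [:: 0; 1] [:: 0; 1; 4; 5; 28] [:: (2, [::]); (3, [:: 8; 16]); (4, [::]); (8, [::])];
  FlatType [:: 0] [:: 0; 1; 3; 4; 5; 28] [:: (1, [::]); (2, [::])]].
Definition top35 := FlatType [::] [:: 0; 1; 2; 3; 4; 5] [:: (0, [::])].
Definition flats36 : seq flat_type := [::
  FlatType [:: 0; 1; 2; 3; 4; 5; 6] [::] [::];
  FlatType [:: 0; 1; 2; 4; 5; 6] [:: 0; 1; 2; 4; 5; 6] [:: (3, [::])];
  FlatType [:: 0; 1; 2; 3; 5; 58] [:: 0; 1; 2; 3; 5; 58] [:: (4, [::])];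
  FlatType [:: 0; 1; 2; 3; 5; 44] [:: 0; 1; 2; 3; 5; 44] [:: (4, [::])];
  FlatType [:: 0; 1; 2; 3; 5; 6] [:: 0; 1; 2; 3; 5; 6] [:: (4, [::])];
  FlatType [:: 0; 1; 2; 3; 4; 48] [:: 0; 1; 2; 3; 4; 6] [:: (5, [::])];
  FlatType [:: 0; 1; 2; 3; 4; 6] [:: 0; 1; 2; 3; 4; 6] [:: (5, [::])];
  FlatType [:: 0; 1; 2; 3; 4; 5] [:: 0; 1; 2; 3; 4; 5] [:: (6, [::])];
  FlatType [:: 0; 1; 2; 27; 48] [:: 0; 1; 2; 4; 6; 27; 48] [:: (3, [::]); (5, [:: 11; 49; 55]);
    (6, [:: 5; 18])];
  FlatType [:: 0; 1; 2; 4; 56] [:: 0; 1; 2; 4; 6; 56] [:: (3, [::]); (5, [:: 10; 22; 51; 44]); (6,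
    [:: 49; 55]); (17, [:: 11])];
  FlatType [:: 0; 1; 2; 4; 48] [:: 0; 1; 2; 4; 6; 48] [:: (3, [::]); (5, [:: 53; 57]); (6, [:: 5;
    18]); (49, [:: 3; 15; 42; 34])];
  FlatType [:: 0; 1; 2; 4; 6] [:: 0; 1; 2; 4; 6] [:: (3, [::]); (5, [::]); (17, [:: 5; 18]); (34,
    [:: 49; 55]); (49, [:: 56; 59]); (56, [:: 49; 55])];
  FlatType [:: 0; 1; 2; 4; 5] [:: 0; 1; 2; 4; 5] [:: (3, [::]); (6, [::]); (24, [:: 18]); (40, [::
    53; 57]); (53, [:: 10; 22; 51; 44]); (60, [:: 27; 37; 45])];
  FlatType [:: 0; 1; 2; 3; 58] [:: 0; 1; 2; 3; 5; 6; 58] [:: (4, [::]); (5, [::])];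
  FlatType [:: 0; 1; 2; 3; 39] [:: 0; 1; 2; 3; 5; 39] [:: (4, [::]); (6, [:: 12]); (18, [:: 12])];
  FlatType [:: 0; 1; 2; 3; 5] [:: 0; 1; 2; 3; 5] [:: (4, [::]); (6, [::]); (18, [:: 12]); (44,
    [::]); (58, [::])];
  FlatType [:: 0; 1; 2; 3; 4] [:: 0; 1; 2; 3; 4; 6] [:: (5, [::]); (6, [::]); (48, [::])];
  FlatType [:: 0; 1; 4; 9] [:: 0; 1; 4; 6; 9; 54] [:: (2, [::]); (5, [:: 17; 52]); (6, [:: 3; 5;
    57; 49]); (17, [:: 5; 45]); (54, [:: 3; 57]); (60, [:: 3; 58])];
  FlatType [:: 0; 1; 4; 6] [:: 0; 1; 4; 6; 36; 54] [:: (2, [::]); (3, [:: 5; 9; 19; 18]); (5, [::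
    3; 15; 32; 23]); (9, [:: 3; 5; 57; 49]); (17, [:: 23; 32]); (23, [:: 3; 5; 45; 22]); (34, [::
    5; 45])];
  FlatType [:: 0; 1; 2; 60] [:: 0; 1; 2; 4; 5; 6; 60] [:: (3, [::]); (4, [:: 56; 59]); (27, [::])];
  FlatType [:: 0; 1; 2; 49] [:: 0; 1; 2; 4; 5; 49] [:: (3, [::]); (4, [:: 3; 15; 36]); (6, [:: 5;
    18]); (24, [:: 18]); (40, [:: 3; 12; 48; 14])];
  FlatType [:: 0; 1; 2; 27] [:: 0; 1; 2; 4; 6; 27] [:: (3, [::]); (5, [:: 10; 22; 45]); (6, [:: 5;
    18]); (17, [:: 11]); (48, [::]); (56, [:: 3; 14; 48])];
  FlatType [:: 0; 1; 2; 4] [:: 0; 1; 2; 4; 6] [:: (3, [::]); (5, [::]); (6, [::]); (17, [:: 11]);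
    (34, [:: 10; 22; 52]); (48, [::]); (49, [:: 3; 15; 36]); (56, [::]); (60, [:: 56; 59])];
  FlatType [:: 0; 1; 2; 3] [:: 0; 1; 2; 3; 5; 6] [:: (4, [::]); (5, [::]); (39, [::]); (58, [::])];
  FlatType [:: 0; 1; 60] [:: 0; 1; 4; 5; 6; 36] [:: (2, [::]); (3, [:: 9; 19]); (4, [:: 34; 42]);
    (9, [:: 3; 58])];
  FlatType [:: 0; 1; 9] [:: 0; 1; 5; 6; 9; 45; 60] [:: (2, [::]); (4, [::]); (5, [:: 10; 22; 41]);
    (60, [:: 3; 58])];
  FlatType [:: 0; 1; 4] [:: 0; 1; 4; 6; 36; 54] [:: (2, [::]); (3, [:: 9; 19]); (5, [:: 34; 36;
    42]); (6, [::]); (9, [::]); (17, [:: 23; 32]); (23, [:: 3; 5; 45; 22]); (34, [:: 5; 45]); (54,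
    [:: 23; 32]); (60, [:: 34; 42])];
  FlatType [:: 0; 1; 2] [:: 0; 1; 2; 4; 5; 6] [:: (3, [::]); (4, [::]); (27, [::]); (49, [::]);
    (60, [::])];
  FlatType [:: 0; 2] [:: 0; 1; 2; 4; 5; 6; 49] [:: (1, [::]); (3, [:: 8])];
  FlatType [:: 0; 1] [:: 0; 1; 4; 5; 6; 36] [:: (2, [::]); (3, [:: 9; 19]); (4, [::]); (9, [::]);
    (60, [::])];
  FlatType [:: 0] [:: 0; 1; 3; 4; 5; 6; 36] [:: (1, [::]); (2, [::])]].
Definition top36 := FlatType [::] [:: 0; 1; 2; 3; 4; 5; 6] [:: (0, [::])].
Definition flats37 : seq flat_type := [::
  FlatType [:: 0; 1; 2; 3; 4; 5; 6; 7] [::] [::];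
  FlatType [:: 0; 1; 2; 3; 5; 7; 81] [:: 0; 1; 2; 3; 5; 7; 81] [:: (4, [::])];
  FlatType [:: 0; 1; 2; 3; 5; 6; 119] [:: 0; 1; 2; 3; 5; 6; 119] [:: (4, [::])];
  FlatType [:: 0; 1; 2; 3; 5; 6; 61] [:: 0; 1; 2; 3; 5; 6; 61] [:: (4, [::])];
  FlatType [:: 0; 1; 2; 3; 5; 6; 7] [:: 0; 1; 2; 3; 5; 6; 7] [:: (4, [::])];
  FlatType [:: 0; 1; 2; 3; 4; 6; 67] [:: 0; 1; 2; 3; 4; 6; 67] [:: (5, [::])];
  FlatType [:: 0; 1; 2; 3; 4; 6; 7] [:: 0; 1; 2; 3; 4; 6; 7] [:: (5, [::])];
  FlatType [:: 0; 1; 2; 3; 4; 5; 7] [:: 0; 1; 2; 3; 4; 5; 7] [:: (6, [::])];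
  FlatType [:: 0; 1; 2; 3; 4; 5; 6] [:: 0; 1; 2; 3; 4; 5; 6] [:: (7, [::])];
  FlatType [:: 0; 1; 2; 4; 60; 82] [:: 0; 1; 2; 4; 60; 82] [:: (3, [:: 14]); (5, [:: 7; 20; 115]);
    (6, [:: 5; 20]); (13, [:: 12; 28]); (14, [:: 75; 90; 116]); (21, [:: 11; 26; 51; 41]); (69,
    [:: 39; 51; 64; 63]); (98, [:: 62; 79; 94])];
  FlatType [:: 0; 1; 2; 4; 6; 82] [:: 0; 1; 2; 4; 6; 82] [:: (3, [::]); (5, [:: 19; 33; 78; 67]);
    (7, [:: 60; 72; 83]); (19, [:: 5; 20]); (21, [:: 19; 34; 109; 46]); (35, [:: 21; 115])];
  FlatType [:: 0; 1; 2; 4; 5; 7] [:: 0; 1; 2; 4; 5; 7] [:: (3, [::]); (6, [:: 11; 26; 38; 64;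
    41]); (27, [:: 13; 28]); (48, [:: 27; 41; 83]); (69, [:: 19; 34; 92; 46]); (87, [:: 20; 61;
    83; 72]); (88, [:: 81; 89; 118]); (109, [:: 20; 115])];
  FlatType [:: 0; 1; 2; 4; 5; 6] [:: 0; 1; 2; 4; 5; 6; 119] [:: (3, [::]); (7, [:: 11; 26; 38; 64;
    41]); (35, [:: 28]); (55, [:: 76; 85; 118]); (76, [:: 19; 33; 78; 67])];
  FlatType [:: 0; 1; 2; 3; 5; 73] [:: 0; 1; 2; 3; 5; 7; 73] [:: (4, [:: 118]); (6, [::]); (7, [::
    6; 21]); (81, [:: 119])];
  FlatType [:: 0; 1; 2; 3; 5; 54] [:: 0; 1; 2; 3; 5; 54; 119] [:: (4, [::]); (7, [:: 13; 116]);
    (14, [:: 7]); (119, [:: 6; 21; 117])];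
  FlatType [:: 0; 1; 2; 3; 5; 7] [:: 0; 1; 2; 3; 5; 7] [:: (4, [::]); (6, [::]); (20, [:: 6; 21]);
    (54, [:: 13; 116]); (81, [::]); (91, [:: 6; 21]); (116, [:: 118]); (118, [:: 14; 116])];
  FlatType [:: 0; 1; 2; 3; 5; 6] [:: 0; 1; 2; 3; 5; 6; 119] [:: (4, [::]); (7, [::]); (28, [::
    21]); (61, [::]); (119, [::])];
  FlatType [:: 0; 1; 2; 3; 4; 60] [:: 0; 1; 2; 3; 4; 6; 60] [:: (5, [::]); (7, [:: 14]); (21, [::
    7; 117])];
  FlatType [:: 0; 1; 2; 3; 4; 6] [:: 0; 1; 2; 3; 4; 6; 119] [:: (5, [::]); (7, [::]); (21, [::
    14]); (67, [::])];
  FlatType [:: 0; 1; 2; 3; 4; 5] [:: 0; 1; 2; 3; 4; 5; 7; 118] [:: (6, [::]); (7, [::])];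
  FlatType [:: 0; 1; 2; 31; 60] [:: 0; 1; 2; 4; 6; 31; 60] [:: (3, [::]); (5, [:: 12; 62; 74]);
    (6, [:: 5; 20]); (7, [:: 14; 82; 90]); (21, [:: 5; 7; 28; 90; 82]); (35, [:: 21; 115]); (82,
    [:: 3; 14; 67; 16])];
  FlatType [:: 0; 1; 2; 4; 75] [:: 0; 1; 2; 4; 6; 75; 119] [:: (3, [::]); (5, [:: 11; 25; 65;
    54]); (6, [:: 62; 74]); (7, [:: 14]); (19, [:: 12]); (21, [:: 7; 12; 61; 83; 72]); (35, [::
    12; 28; 118]); (67, [:: 7]); (119, [:: 7; 62; 99; 74])];
  FlatType [:: 0; 1; 2; 4; 60] [:: 0; 1; 2; 4; 6; 60; 119] [:: (3, [::]); (5, [:: 28; 69; 79]);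
    (6, [:: 5; 20]); (7, [:: 75; 85; 116]); (21, [:: 7; 55; 83; 66]); (35, [:: 12; 28]); (55, [::
    5; 20; 90; 82]); (62, [:: 3; 17; 51; 39]); (82, [::])];
  FlatType [:: 0; 1; 2; 4; 6] [:: 0; 1; 2; 4; 6; 119] [:: (3, [::]); (5, [::]); (7, [:: 13; 28]);
    (19, [:: 5; 20]); (21, [:: 14]); (35, [:: 12; 28]); (39, [:: 62; 74]); (55, [:: 11; 13; 57;
    41]); (62, [:: 75; 84]); (67, [:: 12; 27; 57; 41]); (75, [:: 62; 74]); (76, [:: 82; 89; 118]);
    (82, [::])];
  FlatType [:: 0; 1; 2; 4; 5] [:: 0; 1; 2; 4; 5; 7; 118] [:: (3, [::]); (6, [::]); (7, [::]); (27,
    [:: 20]); (48, [:: 28; 69; 79]); (69, [:: 11; 25; 65; 54]); (73, [:: 55; 66; 77])];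
  FlatType [:: 0; 1; 2; 3; 47] [:: 0; 1; 2; 3; 5; 7; 47; 118] [:: (4, [::]); (6, [:: 13]); (7, [::
    6; 21]); (20, [:: 13])];
  FlatType [:: 0; 1; 2; 3; 5] [:: 0; 1; 2; 3; 5; 7; 118] [:: (4, [::]); (6, [::]); (7, [::]); (20,
    [:: 13]); (54, [::]); (73, [::])];
  FlatType [:: 0; 1; 2; 3; 4] [:: 0; 1; 2; 3; 4; 6; 7; 117] [:: (5, [::]); (6, [::]); (60, [::])];
  FlatType [:: 0; 1; 4; 10] [:: 0; 1; 4; 6; 7; 10; 70; 88] [:: (2, [::]); (5, [:: 19; 68]); (6,
    [:: 3; 5; 79; 62]); (19, [:: 5; 56])];
  FlatType [:: 0; 1; 4; 6] [:: 0; 1; 4; 6; 43; 70; 88] [:: (2, [::]); (3, [:: 5; 10; 22; 20]); (5,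
    [:: 3; 17; 37; 26]); (7, [:: 67; 70; 78]); (10, [:: 3; 5; 79; 62]); (19, [:: 26; 37]); (21,
    [:: 43; 55; 66]); (26, [:: 3; 5; 56; 25]); (35, [:: 42; 53]); (39, [:: 5; 56]); (42, [:: 7;
    19; 83; 41]); (55, [:: 5; 7; 57; 28]); (67, [:: 7; 83]); (82, [:: 5; 42; 56; 53])];
  FlatType [:: 0; 1; 2; 62] [:: 0; 1; 2; 4; 5; 7; 62; 118] [:: (3, [::]); (4, [:: 3; 17; 43]); (6,
    [:: 5; 20]); (7, [:: 6; 21; 99; 91]); (27, [:: 14; 20; 116]); (48, [:: 3; 13; 60; 16])];
  FlatType [:: 0; 1; 2; 31] [:: 0; 1; 2; 4; 6; 7; 31; 117] [:: (3, [::]); (5, [:: 11; 25; 56]);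
    (6, [:: 5; 20]); (19, [:: 12]); (60, [::]); (75, [:: 3; 16; 60])];
  FlatType [:: 0; 1; 2; 4] [:: 0; 1; 2; 4; 6; 7; 117] [:: (3, [::]); (5, [::]); (6, [::]); (19,
    [:: 12]); (39, [:: 11; 25; 68]); (60, [::]); (62, [:: 3; 17; 43]); (75, [::])];
  FlatType [:: 0; 1; 2; 3] [:: 0; 1; 2; 3; 5; 6; 7; 116] [:: (4, [::]); (5, [::]); (47, [::])];
  FlatType [:: 0; 1; 10] [:: 0; 1; 5; 6; 7; 10; 56; 88] [:: (2, [::]); (4, [::]); (5, [:: 11; 25;
    50])];
  FlatType [:: 0; 1; 4] [:: 0; 1; 4; 6; 7; 43; 70; 88] [:: (2, [::]); (3, [:: 10; 22]); (5, [::
    39; 43; 51]); (6, [::]); (10, [::]); (19, [:: 26; 37]); (26, [:: 3; 5; 56; 25]); (39, [:: 5;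
    56])];
  FlatType [:: 0; 1; 2] [:: 0; 1; 2; 4; 5; 6; 7; 115] [:: (3, [::]); (4, [::]); (31, [::]); (62,
    [::])];
  FlatType [:: 0; 2] [:: 0; 1; 2; 4; 5; 6; 7; 62] [:: (1, [::]); (3, [:: 9])];
  FlatType [:: 0; 1] [:: 0; 1; 4; 5; 6; 7; 43; 88] [:: (2, [::]); (3, [:: 10; 22]); (4, [::]);
    (10, [::])];
  FlatType [:: 0] [:: 0; 1; 3; 4; 5; 6; 7; 43] [:: (1, [::]); (2, [::])]].
Definition top37 := FlatType [::] [:: 0; 1; 2; 3; 4; 5; 6; 7] [:: (0, [::])].

Local Close Scope nat_scope.

Definition form33 (i j : nat) : Z_omega :=
  rofZ Z_omega (if i == j then if i == 4%N then Zpos (xO xH) else Zpos xH else Z0).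

Definition form23 := cox_form (R := Z_golden) (fun m => if m == 5%N then (Z0, Zpos xH) else (Zpos xH, Z0))
  [:: (0, 1, 3); (1, 2, 5)]%N.
Definition reflections23 := cox_reflections Z_golden 3.
Lemma verdict23 : verdict (st_rank 23) form23 reflections23 flats23 top23 = Some true.
Proof. by vm_compute. Qed.

Lemma verdict24 : verdict (st_rank 24) (@delta_form Z_lambda7) reflections24 flats24 top24 = Some false.
Proof. by vm_compute. Qed.

Lemma verdict25 : verdict (st_rank 25) (@delta_form Z_omega) reflections25 flats25 top25 = Some true.
Proof. by vm_compute. Qed.

Lemma verdict26 : verdict (st_rank 26) (@delta_form Z_omega) reflections26 flats26 top26 = Some true.
Proof. by vm_compute. Qed.

Lemma verdict27 : verdict (st_rank 27) (@delta_form Z_golden_omega) reflections27 flats27 top27 = Some false.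
Proof. by vm_compute. Qed.

Definition form28 := cox_form (R := Z_sqrt2) (fun m => if m == 4%N then (Z0, Zpos xH) else (Zpos xH, Z0))
  [:: (0, 1, 3); (1, 2, 4); (2, 3, 3)]%N.
Definition reflections28 := cox_reflections Z_sqrt2 4.
Lemma verdict28 : verdict (st_rank 28) form28 reflections28 flats28 top28 = Some true.
Proof. by vm_compute. Qed.

Lemma verdict29 : verdict (st_rank 29) (@delta_form Z_i) reflections29 flats29 top29 = Some false.
Proof. by vm_compute. Qed.

Definition form30 := cox_form (R := Z_golden) (fun m => if m == 5%N then (Z0, Zpos xH) else (Zpos xH, Z0))
  [:: (0, 1, 3); (1, 2, 3); (2, 3, 5)]%N.
Definition reflections30 := cox_reflections Z_golden 4.
Lemma verdict30 : verdict (st_rank 30) form30 reflections30 flats30 top30 = Some true.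
Proof. by vm_compute. Qed.

Lemma verdict31 : verdict (st_rank 31) (@delta_form Z_i) reflections31 flats31 top31 = Some true.
Proof. by vm_compute. Qed.

Lemma verdict32 : verdict (st_rank 32) (@delta_form Z_omega) reflections32 flats32 top32 = Some true.
Proof. by vm_compute. Qed.

Lemma verdict33 : verdict (st_rank 33) form33 reflections33 flats33 top33 = Some false.
Proof. by vm_compute. Qed.

Lemma verdict34 : verdict (st_rank 34) (@delta_form Z_omega) reflections34 flats34 top34 = Some false.
Proof. by vm_compute. Qed.

Definition form35 := cox_form (R := Zops) (fun=> Zpos xH)
  [:: (0, 2, 3); (2, 3, 3); (3, 4, 3); (4, 5, 3); (1, 3, 3)]%N.
Definition reflections35 := cox_reflections Zops 6.
Lemma verdict35 : verdict (st_rank 35) form35 reflections35 flats35 top35 = Some true.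
Proof. by vm_compute. Qed.

Definition form36 := cox_form (R := Zops) (fun=> Zpos xH)
  [:: (0, 2, 3); (2, 3, 3); (3, 4, 3); (4, 5, 3); (5, 6, 3); (1, 3, 3)]%N.
Definition reflections36 := cox_reflections Zops 7.
Lemma verdict36 : verdict (st_rank 36) form36 reflections36 flats36 top36 = Some true.
Proof. by vm_compute. Qed.

Definition form37 := cox_form (R := Zops) (fun=> Zpos xH)
  [:: (0, 2, 3); (2, 3, 3); (3, 4, 3); (4, 5, 3); (5, 6, 3); (6, 7, 3); (1, 3, 3)]%N.
Definition reflections37 := cox_reflections Zops 8.
Lemma verdict37 : verdict (st_rank 37) form37 reflections37 flats37 top37 = Some true.
Proof. by vm_compute. Qed.


(** * Fifteen reflection arrangements *)
Section Groups.
Variable C : numClosedFieldType.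

Lemma simplicial_G23 (W : set 'M[C]_(st_rank 23)) : is_shephard_todd W ->
  simplicial (reflection_arrangement W) <-> true.
Proof.
move=> shW; refine (verdict_simplicial (i := 23) (e := (sval golden_embedding)) (B := form23) (refs := reflections23)
  _ _ _ verdict23 shW) => [j k||].
- apply: cox_formE => x; rewrite !inE; do ?[case/predU1P => [->|]]; try move/eqP->;
  by rewrite ?((svalP golden_embedding), Z_embE) /=
    ?((svalP golden_embedding), Z_embE) /= ?intZE ?mul0r ?mul1r ?add0r ?addr0.
- exact: cox_rootsE.
- exact: size_cox_roots.
Qed.

Lemma simplicial_G24 (W : set 'M[C]_(st_rank 24)) : is_shephard_todd W ->
  simplicial (reflection_arrangement W) <-> false.
Proof.
move=> shW; refine (verdict_simplicial (i := 24) (e := (sval lambda7_embedding)) (B := (@delta_form Z_lambda7)) (refs := reflections24)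
  _ _ _ verdict24 shW) => [j k||].
- exact: delta_formE.
- rewrite /= lambda7_conj !((svalP lambda7_embedding), Z_embE) /= !intZE; match_lists; ring.
- by [].
Qed.

Lemma simplicial_G25 (W : set 'M[C]_(st_rank 25)) : is_shephard_todd W ->
  simplicial (reflection_arrangement W) <-> true.
Proof.
move=> shW; refine (verdict_simplicial (i := 25) (e := (sval omega_embedding)) (B := (@delta_form Z_omega)) (refs := reflections25)
  _ _ _ verdict25 shW) => [j k||].
- exact: delta_formE.
- rewrite /= !((svalP omega_embedding), Z_embE) /= !intZE; match_lists; ring.
- by [].
Qed.

Lemma simplicial_G26 (W : set 'M[C]_(st_rank 26)) : is_shephard_todd W ->
  simplicial (reflection_arrangement W) <-> true.
Proof.
move=> shW; refine (verdict_simplicial (i := 26) (e := (sval omega_embedding)) (B := (@delta_form Z_omega)) (refs := reflections26)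
  _ _ _ verdict26 shW) => [j k||].
- exact: delta_formE.
- rewrite /= !((svalP omega_embedding), Z_embE) /= !intZE; match_lists; ring.
- by [].
Qed.

Lemma simplicial_G27 (W : set 'M[C]_(st_rank 27)) : is_shephard_todd W ->
  simplicial (reflection_arrangement W) <-> false.
Proof.
move=> shW; refine (verdict_simplicial (i := 27) (e := (sval golden_omega_embedding)) (B := (@delta_form Z_golden_omega)) (refs := reflections27)
  _ _ _ verdict27 shW) => [j k||].
- exact: delta_formE.
- rewrite /= golden_inv omega_sqr !((svalP golden_omega_embedding), (svalP golden_embedding), Z_embE) /= !intZE; match_lists; ring.
- by [].
Qed.

Lemma simplicial_G28 (W : set 'M[C]_(st_rank 28)) : is_shephard_todd W ->
  simplicial (reflection_arrangement W) <-> true.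
Proof.
move=> shW; refine (verdict_simplicial (i := 28) (e := (sval sqrt2_embedding)) (B := form28) (refs := reflections28)
  _ _ _ verdict28 shW) => [j k||].
- apply: cox_formE => x; rewrite !inE; do ?[case/predU1P => [->|]]; try move/eqP->;
  by rewrite ?((svalP sqrt2_embedding), Z_embE) /=
    ?((svalP sqrt2_embedding), Z_embE) /= ?intZE ?mul0r ?mul1r ?add0r ?addr0.
- exact: cox_rootsE.
- exact: size_cox_roots.
Qed.

Lemma simplicial_G29 (W : set 'M[C]_(st_rank 29)) : is_shephard_todd W ->
  simplicial (reflection_arrangement W) <-> false.
Proof.
move=> shW; refine (verdict_simplicial (i := 29) (e := (sval i_embedding)) (B := (@delta_form Z_i)) (refs := reflections29)
  _ _ _ verdict29 shW) => [j k||].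
- exact: delta_formE.
- rewrite /= !((svalP i_embedding), Z_embE) /= !intZE; match_lists; ring.
- by [].
Qed.

Lemma simplicial_G30 (W : set 'M[C]_(st_rank 30)) : is_shephard_todd W ->
  simplicial (reflection_arrangement W) <-> true.
Proof.
move=> shW; refine (verdict_simplicial (i := 30) (e := (sval golden_embedding)) (B := form30) (refs := reflections30)
  _ _ _ verdict30 shW) => [j k||].
- apply: cox_formE => x; rewrite !inE; do ?[case/predU1P => [->|]]; try move/eqP->;
  by rewrite ?((svalP golden_embedding), Z_embE) /=
    ?((svalP golden_embedding), Z_embE) /= ?intZE ?mul0r ?mul1r ?add0r ?addr0.
- exact: cox_rootsE.
- exact: size_cox_roots.
Qed.

Lemma simplicial_G31 (W : set 'M[C]_(st_rank 31)) : is_shephard_todd W ->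
  simplicial (reflection_arrangement W) <-> true.
Proof.
move=> shW; refine (verdict_simplicial (i := 31) (e := (sval i_embedding)) (B := (@delta_form Z_i)) (refs := reflections31)
  _ _ _ verdict31 shW) => [j k||].
- exact: delta_formE.
- rewrite /= !((svalP i_embedding), Z_embE) /= !intZE; match_lists; ring.
- by [].
Qed.

Lemma simplicial_G32 (W : set 'M[C]_(st_rank 32)) : is_shephard_todd W ->
  simplicial (reflection_arrangement W) <-> true.
Proof.
move=> shW; refine (verdict_simplicial (i := 32) (e := (sval omega_embedding)) (B := (@delta_form Z_omega)) (refs := reflections32)
  _ _ _ verdict32 shW) => [j k||].
- exact: delta_formE.
- rewrite /= !((svalP omega_embedding), Z_embE) /= !intZE; match_lists; ring.
- by [].
Qed.

Lemma simplicial_G33 (W : set 'M[C]_(st_rank 33)) : is_shephard_todd W ->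
  simplicial (reflection_arrangement W) <-> false.
Proof.
move=> shW; refine (verdict_simplicial (i := 33) (e := (sval omega_embedding)) (B := form33) (refs := reflections33)
  _ _ _ verdict33 shW) => [j k||].
- rewrite evZ /=; by case: (_ == _) => //; case: (_ == _).
- rewrite /= !((svalP omega_embedding), Z_embE) /= !intZE; match_lists; ring.
- by [].
Qed.

Lemma simplicial_G34 (W : set 'M[C]_(st_rank 34)) : is_shephard_todd W ->
  simplicial (reflection_arrangement W) <-> false.
Proof.
move=> shW; refine (verdict_simplicial (i := 34) (e := (sval omega_embedding)) (B := (@delta_form Z_omega)) (refs := reflections34)
  _ _ _ verdict34 shW) => [j k||].
- exact: delta_formE.
- rewrite /= !((svalP omega_embedding), Z_embE) /= !intZE; match_lists; ring.
- by [].
Qed.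

Lemma simplicial_G35 (W : set 'M[C]_(st_rank 35)) : is_shephard_todd W ->
  simplicial (reflection_arrangement W) <-> true.
Proof.
move=> shW; refine (verdict_simplicial (i := 35) (e := Z_embedding) (B := form35) (refs := reflections35)
  _ _ _ verdict35 shW) => [j k||].
- apply: cox_formE => x; rewrite !inE; do ?[case/predU1P => [->|]]; try move/eqP->;
  by rewrite ?(Z_embE) /= ?(Z_embE) /= ?intZE ?mul0r ?mul1r ?add0r ?addr0.
- exact: cox_rootsE.
- exact: size_cox_roots.
Qed.

Lemma simplicial_G36 (W : set 'M[C]_(st_rank 36)) : is_shephard_todd W ->
  simplicial (reflection_arrangement W) <-> true.
Proof.
move=> shW; refine (verdict_simplicial (i := 36) (e := Z_embedding) (B := form36) (refs := reflections36)
  _ _ _ verdict36 shW) => [j k||].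
- apply: cox_formE => x; rewrite !inE; do ?[case/predU1P => [->|]]; try move/eqP->;
  by rewrite ?(Z_embE) /= ?(Z_embE) /= ?intZE ?mul0r ?mul1r ?add0r ?addr0.
- exact: cox_rootsE.
- exact: size_cox_roots.
Qed.

Lemma simplicial_G37 (W : set 'M[C]_(st_rank 37)) : is_shephard_todd W ->
  simplicial (reflection_arrangement W) <-> true.
Proof.
move=> shW; refine (verdict_simplicial (i := 37) (e := Z_embedding) (B := form37) (refs := reflections37)
  _ _ _ verdict37 shW) => [j k||].
- apply: cox_formE => x; rewrite !inE; do ?[case/predU1P => [->|]]; try move/eqP->;
  by rewrite ?(Z_embE) /= ?(Z_embE) /= ?intZE ?mul0r ?mul1r ?add0r ?addr0.
- exact: cox_rootsE.
- exact: size_cox_roots.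
Qed.

End Groups.

Theorem proposition6p3 (C : numClosedFieldType) (i : nat)
    (hi : (23 <= i <= 37)%N) (W : set 'M[C]_(st_rank i))
    (hW : is_shephard_todd W) :
  simplicial (reflection_arrangement W) <->
    i \notin [:: 24; 27; 29; 33; 34]%N.
Proof.
move: i hi W hW; do 23 (case; first by []).
case; first by move=> _ W; exact: simplicial_G23.
case; first by move=> _ W; exact: simplicial_G24.
case; first by move=> _ W; exact: simplicial_G25.
case; first by move=> _ W; exact: simplicial_G26.
case; first by move=> _ W; exact: simplicial_G27.
case; first by move=> _ W; exact: simplicial_G28.
case; first by move=> _ W; exact: simplicial_G29.
case; first by move=> _ W; exact: simplicial_G30.
case; first by move=> _ W; exact: simplicial_G31.
case; first by move=> _ W; exact: simplicial_G32.
case; first by move=> _ W; exact: simplicial_G33.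
case; first by move=> _ W; exact: simplicial_G34.
case; first by move=> _ W; exact: simplicial_G35.
case; first by move=> _ W; exact: simplicial_G36.
case; first by move=> _ W; exact: simplicial_G37.
by [].
Qed.
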